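(* Let $L$ be one of the regular crystallographic root lattices $\mathcal{A}_n$, $\mathcal{A}^*_n$ ($n\ge 2$), $\mathcal{D}_n$, $\mathcal{D}^*_n$ ($n\ge 3$), $\mathcal{E}_6$, $\mathcal{E}_7$, $\mathcal{E}_8$ (that is, any lattice of the list $\mathcal{A}_n,\mathcal{A}_n^*,\mathcal{B}_n,\mathcal{D}_n,\mathcal{D}_n^*,\mathcal{E}_j$ other than the Cartesian grid $\mathcal{B}_n=\mathbb{Z}^n$). Then the splines obtained by convolution of Voronoi cells of $L$ are not refinable: for every integer $m\ge1$ and every $0<\lambda<1$, the order-$m$ Voronoi splines on $L$ cannot all be represented as linear combinations of the order-$m$ Voronoi splines on $\lambda L$.
   Context: Each lattice is considered in the Euclidean space $E$ it spans. $\mathcal{A}_n=\{x\in\mathbb{Z}^{n+1}:\sum_i x_i=0\}$; $\mathcal{D}_n=\{x\in\mathbb{Z}^n:\sum_i x_i \text{ even}\}$; $\mathcal{E}_8$ is the set of $x\in\mathbb{Z}^8\cup(\mathbb{Z}+\tfrac12)^8$ with $\sum_i x_i$ even; $\mathcal{E}_7$ is the set of vectors of $\mathcal{E}_8$ orthogonal to a fixed vector of squared length $2$ of $\mathcal{E}_8$; $\mathcal{E}_6$ is the set of vectors of $\mathcal{E}_8$ orthogonal to a fixed sublattice of $\mathcal{E}_8$ isometric to $\mathcal{A}_2$. $L^*=\{y\in E: \langle x,y\rangle\in\mathbb{Z}\text{ for all }x\in L\}$ is the dual lattice. The Voronoi cell of $L$ is $V=\{x\in E: |x|\le|x-l| \text{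 for all } l\in L\}$. The order-$m$ Voronoi splines on $L$ are the functions $\varphi(\cdot-l)$, $l\in L$, where $\varphi$ is the $m$-fold convolution of the indicator function of $V$ with itself ($m=1$: the indicator function itself); those on $\lambda L$ are defined in the same way from the Voronoi cell $\lambda V$ of $\lambda L$. Linear combinations may be infinite (the sums are locally finite), and equality of functions is understood almost everywhere. *)

(* Defs.v *)
From HB Require Import structures.
From mathcomp Require Import all_boot all_order all_algebra.
From mathcomp Require Import all_classical all_reals all_analysis.

Set Implicit Arguments.
Unset Strict Implicit.
Unset Printing Implicit Defensive.

Import Order.TTheory GRing.Theory Num.Theory.
Import numFieldNormedType.Exports.

Local Open Scope classical_set_scope.
Local Open Scope ring_scope.

Section lebesgue_cons.
Context (R : realType) (n : nat).
Local Notation T := (measurableTypeR R).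
Variable mu : {sigma_finite_measure set (n.-tuple T) -> \bar R}.

Definition tuple_cons (p : T * n.-tuple T) : n.+1.-tuple T :=
  [the n.+1.-tuple T of p.1 :: p.2].

Let measurable_tuple_cons : measurable_fun setT tuple_cons.
Proof. exact: measurable_cons. Qed.

Definition lebesgue_cons : set (n.+1.-tuple T) -> \bar R :=
  pushforward (@lebesgue_measure R \x mu)%E tuple_cons.

Let lebesgue_cons0 : lebesgue_cons set0 = 0%E.
Proof. exact: measure0. Qed.

Let lebesgue_cons_ge0 A : (0 <= lebesgue_cons A)%E.
Proof. exact: measure_ge0. Qed.

Let lebesgue_cons_sigma_additive : semi_sigma_additive lebesgue_cons.
Proof. exact: measure_semi_sigma_additive. Qed.

HB.instance Definition _ := isMeasure.Build _ _ _ lebesgue_cons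
  lebesgue_cons0 lebesgue_cons_ge0 lebesgue_cons_sigma_additive.

Let sigma_finite_lebesgue_cons : sigma_finite setT lebesgue_cons.
Proof.
pose g (t : n.+1.-tuple T) : T * n.-tuple T := (thead t, [tuple of behead t]).
have mg : measurable_fun [set: n.+1.-tuple T] g.
  apply/measurable_fun_pair => /=; first exact: measurable_tnth.
  exact: measurable_behead.
have gK : g \o tuple_cons = id.
  by apply/funext => -[x t]; congr pair; exact/val_inj.
have /sigma_finiteP[F [TF ndF Foo]] := sigma_finiteT (@lebesgue_measure R).
have /sigma_finiteP[G [TG ndG Goo]] := sigma_finiteT mu.
exists (fun k => g @^-1` (F k `*` G k)).
  rewrite -preimage_bigcup -(preimage_setT g) -setXTT TF TG; congr (_ @^-1` _).
  apply/seteqP; split => -[x t] /=.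
    move=> [[k _ Fkx] [l _ Glt]]; exists (maxn k l) => //; split.
    - by move: x Fkx; exact/subsetPset/ndF/leq_maxl.
    - by move: t Glt; exact/subsetPset/ndG/leq_maxr.
  by move=> [k _ [? ?]]; split; exists k.
move=> k; have [mF Fk] := Foo k; have [mG Gk] := Goo k; split.
  by rewrite -[X in measurable X]setTI; apply: mg => //; exact: measurableX.
rewrite /lebesgue_cons /pushforward -comp_preimage gK preimage_id.
by rewrite product_measure1E// lte_mul_pinfty// ge0_fin_numE.
Qed.

HB.instance Definition _ := Measure_isSigmaFinite.Build _ _ _
  lebesgue_cons sigma_finite_lebesgue_cons.

End lebesgue_cons.

(* Lebesgue measure on R^n: the n-fold product of [lebesgue_measure],
   transported from nested pairs to tuples. *)
Fixpoint lebesgue_tuple (R : realType) (n : nat) :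
    {sigma_finite_measure set (n.-tuple (measurableTypeR R)) -> \bar R} :=
  match n with
  | 0 => dirac ([tuple] : 0.-tuple (measurableTypeR R))
  | n'.+1 => lebesgue_cons (lebesgue_tuple R n')
  end.

Section euclidean.
Context (R : realType) (N : nat).
Implicit Types (x y : 'rV[R]_N) (L : set 'rV[R]_N).

Definition dot x y : R := \sum_i x 0 i * y 0 i.

(* The Euclidean norm; the library norm `|x| on matrices is the sup norm. *)
Definition enorm x : R := Num.sqrt (dot x x).

Definition linspan L : set 'rV[R]_N :=
  [set x | exists (k : nat) (B : 'M[R]_(k, N)),
     (forall i, L (row i B)) /\ (x <= B)%MS].

Definition dual L : set 'rV[R]_N :=
  [set y | linspan L y /\ forall x, L x -> dot x y \is a Num.int].

Definition voronoi L : set 'rV[R]_N :=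
  [set x | linspan L x /\ forall l, L l -> enorm x <= enorm (x - l)].

Definition scale (lambda : R) L : set 'rV[R]_N := [set lambda *: l | l in L].

End euclidean.

Section lattices.
Context (R : realType).

Definition integral_vec N (x : 'rV[R]_N) := forall i, x 0 i \is a Num.int.

Definition half_integral_vec N (x : 'rV[R]_N) :=
  forall i, x 0 i - 2^-1 \is a Num.int.

Definition even_sum N (x : 'rV[R]_N) :=
  exists k : int, \sum_i x 0 i = (2 * k)%:~R.

Definition latA n : set 'rV[R]_n.+1 :=
  [set x | integral_vec x /\ \sum_i x 0 i = 0].
Arguments latA : clear implicits.

Definition latD n : set 'rV[R]_n := [set x | integral_vec x /\ even_sum x].
Arguments latD : clear implicits.

Definition latE8 : set 'rV[R]_8 :=
  [set x | (integral_vec x \/ half_integral_vec x) /\ even_sum x].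

Definition orthogonal_to N (M : set 'rV[R]_N) : set 'rV[R]_N :=
  [set x | forall y, M y -> dot x y = 0].

Definition isometric N N' (L : set 'rV[R]_N) (M : set 'rV[R]_N') :=
  exists f : 'rV[R]_N -> 'rV[R]_N',
    [/\ forall x y, L x -> L y -> f (x + y) = f x + f y,
        forall x y, L x -> L y -> dot (f x) (f y) = dot x y
      & f @` L = M].

(* E_7 and E_6 depend on the choice of the vector v, resp. the sublattice M;
   every choice is allowed. *)
Inductive non_cartesian_root_lattice : forall N, set 'rV[R]_N -> Prop :=
| root_A n : (2 <= n)%N -> non_cartesian_root_lattice (latA n)
| root_A_dual n : (2 <= n)%N -> non_cartesian_root_lattice (dual (latA n))
| root_D n : (3 <= n)%N -> non_cartesian_root_lattice (latD n)
| root_D_dual n : (3 <= n)%N -> non_cartesian_root_lattice (dual (latD n))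
| root_E6 M : M `<=` latE8 -> isometric (latA 2) M ->
    non_cartesian_root_lattice (latE8 `&` orthogonal_to M)
| root_E7 v : latE8 v -> dot v v = 2 ->
    non_cartesian_root_lattice (latE8 `&` orthogonal_to [set v])
| root_E8 : non_cartesian_root_lattice latE8.

End lattices.

Section splines.
Context (R : realType) (N d : nat).
Implicit Types (Q : 'M[R]_(d, N)) (L : set 'rV[R]_N) (f g : 'rV[R]_N -> R).

(* The rows of Q form an orthonormal basis of the subspace E. *)
Definition orthonormal_basis (E : set 'rV[R]_N) Q :=
  Q *m Q^T = 1%:M /\ forall x, E x <-> (x <= Q)%MS.

(* The isometry from R^d onto E sending coordinates to points. Lebesgue
   measure on E is the image of [lebesgue_tuple R d] by it, and does not depend
   on the orthonormal basis Q; integrals over E and "almost everywhere in E" are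
   thus written in terms of the coordinates t. *)
Definition from_coord Q (t : d.-tuple (measurableTypeR R)) : 'rV[R]_N :=
  (\row_i tnth t i) *m Q.

Definition convolution Q f g : 'rV[R]_N -> R :=
  fun x => \int[lebesgue_tuple R d]_t
             (f (from_coord Q t) * g (x - from_coord Q t)).

(* The m-fold convolution of the indicator of the Voronoi cell, for 1 <= m. *)
Definition voronoi_spline Q L (m : nat) : 'rV[R]_N -> R :=
  iter m.-1 (fun f => convolution Q f \1_(voronoi L)) \1_(voronoi L).

(* The sum over k in L is locally finite because the spline has bounded
   support; [\sum_(k \in L)] is the sum over the (finite) support. *)
Definition spline_combination Q L (m : nat) f :=
  exists c : 'rV[R]_N -> R,
    {ae lebesgue_tuple R d, forall t,
      f (from_coord Q t) =
      \sum_(k \in L) c k * voronoi_spline Q L m (from_coord Q t - k)}.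

Definition refinable Q L (m : nat) (lambda : R) :=
  forall l, L l ->
    spline_combination Q (scale lambda L) m
      (fun x => voronoi_spline Q L m (x - l)).

End splines.

(* Main.v *)
(** Write [phi] and [phi'] for the splines on [L] and [lambda L]. If
[phi = sum_k c_k phi'(. - k)], then both [sum_j phi'(x0 + j) phi(x - j)] and
[sum_l phi(x0 + l) phi'(x - l)] equal [sum_(j, l) c_(l - j) phi'(x0 + j) phi'(x - l)],
so the unknown coefficients, which may have any sign, are traded for two finite
families of nonnegative weights. The Laplace transform in the normal direction
[u] of a facet turns this identity into
[alpha(t) I(t)^m = beta(t) (lambda^d I(lambda t))^m], where [I] is the transform of
the indicator function of the Voronoi cell and [alpha], [beta] are exponential sums
with nonnegative coefficients. Let [s] be the depth below the facet and
[J(t) = t * \int_V e^(- t s)]. As [t] tends to infinity [J] tends to the volume [N]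
of the unit-depth prism over the facet, and comparing leading exponentials gives
[J(lambda t) <= (1 + O(e^(- c t))) J(t)], whence [J(t) (1 - e^(- c t)) <= N] for large
[t]. Since [J(t) >= N (1 - e^(- t)) + t rho_e e^(- e t)] for every [e > 0], where
[rho_e] is the volume of the part of the cell of depth less than [e] that sticks out of
the prism, no volume sticks out for small [e]. This fails if the facet of [u] has a
neighbour with normal [v] such that [0 < <u, v> < |u|^2], and every lattice of the list
has such a pair of facets. *)
Require Import Defs.
From mathcomp Require Import all_boot all_order all_algebra.
From mathcomp Require Import all_classical all_reals all_analysis.
From mathcomp Require Import measurable_realfun ring lra zify.
Set Implicit Arguments.
Unset Strict Implicit.
Unset Printing Implicit Defensive.
Import Order.TTheory GRing.Theory Num.Theory.
Import numFieldNormedType.Exports.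
Local Open Scope classical_set_scope.
Local Open Scope ring_scope.

(** * Affine changes of variables for Lebesgue measure on tuples *)

(** The coefficients of a refinement equation are arbitrary and may grow faster than any
    exponential, so the infinite series cannot be integrated term by term against an exponential
    weight. This is why they are eliminated first: what is transformed are finite sums. The equation
    holds only almost everywhere; it is therefore evaluated at points where it holds at all
    translates by the countable lattice [lambda L], and [x0] is such a point with [phi' x0 > 0], so
    that the first exponential sum does not vanish. The limit of [J] alone gives no contradiction:
    it is [N] along [t] and along [lambda t]. The decision falls in the second-order term. The gain
    [t rho_e e^(- e t)] is available for every [e > 0], hence also for an [e] below both the unknown
    rate [c] and the rate 1 of the prism. For the cubic cell of [Z^n] the cell is the prism itself
    and [J(t) = N (1 - e^(- t))], so nothing sticks out. Geometrically, [<u, v> > 0] makes the facet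
    of [v] lean outwards over the edge of the facet of [u], and [<u, v> < |u|^2] makes it leave the
    hyperplane of that facet. *)

Section affine_change.
Context (R : realType).
Local Notation T := (measurableTypeR R).
Local Notation mu := (@lebesgue_measure R).
Local Open Scope ereal_scope.

Lemma lebesgue_measure_affine (a b : R) (A : set T) : (0 < a)%R ->
  measurable A -> mu ((fun x : T => a * x + b : T)%R @^-1` A) = (a^-1)%:E * mu A.
Proof.
move=> a0 mA.
have a0' : (0 <= a)%R by exact: ltW.
have mf : measurable_fun [set: T] (fun x : T => a * x + b : T)%R.
  by apply: measurable_funD => //; apply: measurable_funM.
pose f := (fun x : T => a * x + b : T)%R.
(* The measure [m] is known only through its values. Scaled by [a] it gives every half-open interval
   its length, so uniqueness of Lebesgue measure applies. *)
have H (m : {measure set T -> \bar R}) : (forall B, m B = mu (f @^-1` B)) ->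
    mu A = mscale (NngNum a0') m A.
  move=> mE; apply: lebesgue_measure_unique => // _ [[x y]] _ <-.
  rewrite /= /mscale mE /=.
  have -> : f @^-1` `]x, y] = `]((x - b) / a)%R, ((y - b) / a)%R]%classic :> set R.
    apply/seteqP; split=> z /=; rewrite !in_itv/=
      ltr_pdivrMr// ler_pdivlMr// ltrBlDr lerBrDr mulrC//.
  rewrite !lebesgue_measure_itv/= !lte_fin ltr_pM2r ?invr_gt0// ltrD2r.
  case: ifP => _; last by rewrite mule0.
  by rewrite -!EFinD -EFinM; congr EFin; field; rewrite gt_eqF.
have [m mE] : {m : {measure set T -> \bar R} | forall B, m B = mu (f @^-1` B)}.
  by unshelve eexists (pushforward mu f) => //.
by rewrite (H m mE) /mscale mE /= muleA -EFinM mulVf ?gt_eqF// mul1e.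
Qed.

Lemma ge0_integral_affine (a b : R) (f : T -> \bar R) : (0 < a)%R ->
  measurable_fun setT f -> (forall x, 0 <= f x) ->
  \int[mu]_x f (a * x + b)%R = (a^-1)%:E * \int[mu]_x f x.
Proof.
move=> a0 mf f0.
have mg : measurable_fun [set: T] (fun x : T => a * x + b : T)%R.
  by apply: measurable_funD => //; apply: measurable_funM.
have ia0 : (0 <= a^-1)%R by rewrite invr_ge0 ltW.
have [m mE] : {m : {measure set T -> \bar R} |
    (m : set T -> \bar R) = pushforward mu (fun x : T => a * x + b : T)%R}.
  by unshelve eexists (pushforward mu (fun x : T => a * x + b : T)%R).
transitivity (\int[mscale (NngNum ia0) mu]_x f x).
  rewrite [RHS](eq_measure_integral m); last first.
    by move=> A mA _; rewrite mE /mscale/= /pushforward lebesgue_measure_affine.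
  by rewrite mE ge0_integral_pushforward.
exact: ge0_integral_mscale.
Qed.

End affine_change.

Section tuple.
Context (R : realType).
Local Notation T := (measurableTypeR R).
Local Notation mu := (lebesgue_tuple R).

Definition tadd n (s t : n.-tuple T) : n.-tuple T :=
  [tuple tnth s i + tnth t i | i < n].
Definition tsub n (s t : n.-tuple T) : n.-tuple T :=
  [tuple tnth s i - tnth t i | i < n].
Definition tscale n (a : R) (t : n.-tuple T) : n.-tuple T :=
  [tuple a * tnth t i | i < n].

Lemma measurable_mktuple d (U : measurableType d) n (f : 'I_n -> U -> T) :
  (forall i, measurable_fun [set: U] (f i)) ->
  measurable_fun [set: U] (fun u => [tuple f i u | i < n] : n.-tuple T).
Proof.
move=> mf; apply/measurable_fun_tnthP => i.
by rewrite (_ : _ \o _ = f i)//; apply/funext => u /=; rewrite tnth_mktuple.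
Qed.

Local Open Scope ereal_scope.

Lemma ge0_integral_lebesgue_cons n (f : n.+1.-tuple T -> \bar R) :
  measurable_fun setT f -> (forall t, 0 <= f t) ->
  \int[mu n.+1]_t f t = \int[@lebesgue_measure R]_x \int[mu n]_t f (tuple_cons (x, t)).
Proof.
move=> mf f0.
have mc : measurable_fun setT (@tuple_cons R n) by exact: measurable_cons.
transitivity (\int[pushforward (@lebesgue_measure R \x mu n) (@tuple_cons R n)]_t f t) => //.
rewrite ge0_integral_pushforward// preimage_setT.
rewrite fubini_tonelli1//; first exact: measurableT_comp.
by move=> x; exact: f0.
Qed.

(** Tonelli splits off the first coordinate, and each of the [n] coordinates contributes one factor
    [a^-1]. *)
Lemma ge0_integral_tuple_affine n (a : R) (b : n.-tuple T) (f : n.-tuple T -> \bar R) :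
  (0 < a)%R -> measurable_fun setT f -> (forall t, 0 <= f t) ->
  \int[mu n]_t f (tadd (tscale a t) b) = (a ^- n)%:E * \int[mu n]_t f t.
Proof.
move=> a0; elim: n b f => [|n IH] b f mf f0.
  rewrite expr0 invr1 mul1e; apply: eq_integral => t _.
  by rewrite (tuple0 t) [tadd _ _]tuple0.
have mtadd k (c : k.-tuple T) : measurable_fun setT (fun t : k.-tuple T => tadd (tscale a t) c).
  apply: measurable_mktuple => i; apply: measurable_funD => //.
  rewrite (_ : (fun x => _) = (fun x => a * tnth x i)%R); last first.
    by apply/funext => x; rewrite tnth_mktuple.
  by apply: measurable_funM => //; exact: measurable_tnth.
rewrite ge0_integral_lebesgue_cons//; last exact: (measurableT_comp mf (mtadd _ b)).
rewrite [in RHS]ge0_integral_lebesgue_cons//.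
pose g x t := f (tuple_cons (x, t)).
have mg : measurable_fun setT (fun p : T * n.-tuple T => g p.1 p.2).
  rewrite (_ : (fun p => _) = f \o (@tuple_cons R n)).
    by apply: measurableT_comp => //; exact: measurable_cons.
  by apply/funext => -[].
have mgx x : measurable_fun setT (g x).
  exact: (measurableT_comp mg (pair1_measurable _)).
transitivity (\int[@lebesgue_measure R]_x
   ((a ^- n)%:E * \int[mu n]_t g (a * x + tnth b ord0)%R t)).
  apply: eq_integral => x _.
  pose b' : n.-tuple T := [tuple of behead b].
  rewrite -(IH b' (g (a * x + tnth b ord0)%R))//; last by move=> t; exact: f0.
  apply: eq_integral => t _.
  rewrite /g; congr f; apply: eq_from_tnth => i; rewrite !tnth_mktuple.
  case: (unliftP ord0 i) => [j ->|->].
    rewrite !tnthS /= tnth_mktuple tnth_mktuple; congr (_ + _)%R.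
    rewrite /b' (tnth_behead b j); congr (tnth b _); apply/val_inj => /=.
    by rewrite inordK// ltnS ltn_ord.
  by rewrite !tnth0.
have mG : measurable_fun setT (fun x => \int[mu n]_t g x t).
  exact: (@measurable_fun_fubini_tonelli_F _ _ _ _ _ (mu n) (fun p => g p.1 p.2) mg (fun p => f0 _)).
rewrite ge0_integralZl//.
- rewrite (@ge0_integral_affine _ _ _ (fun x => \int[mu n]_t g x t))//.
    by rewrite muleA -EFinM exprS invfM mulrC.
  by move=> x; apply: integral_ge0 => t _; exact: f0.
- apply: (measurableT_comp mG).
  by apply: measurable_funD => //; apply: measurable_funM.
- by move=> x _; apply: integral_ge0 => t _; exact: f0.
- by rewrite lee_fin invr_ge0 exprn_ge0// ltW.
Qed.

End tuple.

Section tuple_box.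
Context (R : realType).
Local Notation T := (measurableTypeR R).
Local Notation mu := (lebesgue_tuple R).

Lemma measurable_tadd n : measurable_fun setT (fun p : n.-tuple T * n.-tuple T => tadd p.1 p.2).
Proof.
apply: measurable_mktuple => i; apply: measurable_funD.
  exact: (measurableT_comp (measurable_tnth i) measurable_fst).
exact: (measurableT_comp (measurable_tnth i) measurable_snd).
Qed.

Lemma measurable_tsub n : measurable_fun setT (fun p : n.-tuple T * n.-tuple T => tsub p.1 p.2).
Proof.
apply: measurable_mktuple => i; apply: measurable_funB.
  exact: (measurableT_comp (measurable_tnth i) measurable_fst).
exact: (measurableT_comp (measurable_tnth i) measurable_snd).
Qed.

Lemma measurable_tscale n (a : R) : measurable_fun setT (fun t : n.-tuple T => tscale a t).
Proof.
apply: measurable_mktuple => i; apply: measurable_funM => //.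
exact: measurable_tnth.
Qed.

Lemma taddK n (t b : n.-tuple T) : tsub (tadd t b) b = t.
Proof. by apply: eq_from_tnth => i; rewrite !tnth_mktuple addrK. Qed.

Local Open Scope ereal_scope.

Lemma ge0_integral_tadd n (b : n.-tuple T) (f : n.-tuple T -> \bar R) :
  measurable_fun setT f -> (forall t, 0 <= f t) ->
  \int[mu n]_t f (tadd t b) = \int[mu n]_t f t.
Proof.
move=> mf f0.
have := @ge0_integral_tuple_affine R n 1 b f ltr01 mf f0.
rewrite expr1n invr1 mul1e => <-; apply: eq_integral => t _; congr f.
by apply: eq_from_tnth => i; rewrite !tnth_mktuple mul1r.
Qed.

Lemma ge0_integral_tscale n (a : R) (f : n.-tuple T -> \bar R) :
  (0 < a)%R -> measurable_fun setT f -> (forall t, 0 <= f t) ->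
  \int[mu n]_t f (tscale a t) = (a ^- n)%:E * \int[mu n]_t f t.
Proof.
move=> a0 mf f0.
rewrite -(@ge0_integral_tuple_affine R n a [tuple 0%R | i < n] f a0 mf f0).
apply: eq_integral => t _; congr f.
by apply: eq_from_tnth => i; rewrite !tnth_mktuple addr0.
Qed.

Definition tbox n (a : n.-tuple T) (r : R) : set (n.-tuple T) :=
  [set t | forall i, (`|tnth t i - tnth a i| <= r)%R].

Lemma measurable_tbox n (a : n.-tuple T) r : measurable (tbox a r).
Proof.
rewrite (_ : tbox a r = \bigcap_(i in [set: 'I_n])
   [set t | (`|tnth t i - tnth a i| <= r)%R]); last first.
  by apply/seteqP; split => t /= h i; [move=> _; exact: h | exact: h].
apply: fin_bigcap_measurable => // i _.
rewrite -[X in measurable X]setTI.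
apply: measurable_fun_ler => //.
apply: measurableT_comp => //; apply: measurable_funB => //.
exact: measurable_tnth.
Qed.

Lemma lebesgue_tbox n (a : n.-tuple T) (r : R) : (0 <= r)%R ->
  mu n (tbox a r) = ((r *+ 2) ^+ n)%:E.
Proof.
move=> r0; elim: n a => [|n IH] a.
  by rewrite expr0 /= diracE mem_set// => -[].
pose a' : n.-tuple T := [tuple of behead a].
rewrite /= /lebesgue_cons /pushforward.
rewrite (_ : _ @^-1` _ = `[tnth a ord0 - r, tnth a ord0 + r]%classic%R `*` tbox a' r).
  rewrite product_measure1E//; last exact: measurable_tbox.
  rewrite [X in _ * X]IH.
  rewrite [X in X * _](_ : _ = (r *+ 2)%:E); first by rewrite -EFinM exprS.
  apply: etrans (lebesgue_measure_itv `[tnth a ord0 - r, tnth a ord0 + r]%R) _.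
  rewrite /= lte_fin -EFinD.
  have -> : (tnth a ord0 + r - (tnth a ord0 - r) = r *+ 2)%R by ring.
  case: ifPn => //; rewrite -leNgt => h; congr EFin; lra.
apply/seteqP; split=> -[x t] /=.
  move=> h; split => /=.
    by rewrite in_itv /= -ler_distlC distrC; have := h ord0; rewrite tnth0.
  move=> i; have := h (lift ord0 i); rewrite tnthS /a' (tnth_behead a i).
  by congr ((`|_ - tnth a _| <= _)%R); apply/val_inj => /=; rewrite inordK// ltnS.
rewrite in_itv /= -ler_distlC distrC => -[h0 h] i.
case: (unliftP ord0 i) => [j ->|->]; last by rewrite tnth0.
have := h j; rewrite tnthS /a' (tnth_behead a j).
by congr ((`|_ - tnth a _| <= _)%R); apply/val_inj => /=; rewrite inordK// ltnS.
Qed.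

End tuple_box.

(** * Iterated convolutions on tuples *)

Lemma ge0_integralZl_setT d (Y : measurableType d) (R : realType)
    (mu : {measure set Y -> \bar R}) (f : Y -> \bar R) (k : R) :
  measurable_fun setT f -> (forall x, 0 <= f x)%E -> 0 <= k ->
  (\int[mu]_x (k%:E * f x) = k%:E * \int[mu]_x f x)%E.
Proof. by move=> mf f0 k0; rewrite ge0_integralZl. Qed.

Section tuple_spline.
Context (R : realType) (n : nat).
Local Notation T := (measurableTypeR R).
Local Notation X := (n.-tuple T).
Local Notation mu := (lebesgue_tuple R n).
Variables (W : set X) (M : R).
Hypotheses (mW : measurable W) (M0 : 0 <= M) (WM : W `<=` tbox [tuple 0 | i < n] M).

Definition tconv (f g : X -> R) : X -> R :=
  fun t => \int[mu]_s (f s * g (tsub t s)).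

(** Index [k] is the spline of order [k.+1]; this is the origin of [m.-1] and of the exponents
    [k.+1] below. *)
Definition tspline k : X -> R := iter k (fun f => tconv f \1_W) \1_W.

Local Notation box r := (tbox ([tuple 0 | i < n] : X) r).

Lemma integral_tbox (C r : R) : 0 <= C -> 0 <= r ->
  (\int[mu]_s (C%:E * (\1_(box r) s)%:E) = (C * (r *+ 2) ^+ n)%:E)%E.
Proof.
move=> C0 r0; have mB := @measurable_tbox R n [tuple 0 | i < n] r.
rewrite ge0_integralZl_setT//.
- by rewrite integral_indic// setIT EFinM; congr (_ * _)%E; exact: lebesgue_tbox.
- by apply/measurable_EFinP; exact: measurable_indic.
Qed.

Lemma measurable_tspline_kernel (f : X -> R) : measurable_fun setT f ->
  measurable_fun setT (fun p : X * X => (f p.2 * \1_W (tsub p.1 p.2))%:E).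
Proof.
move=> mf; apply/measurable_EFinP; apply: measurable_funM.
  exact: (measurableT_comp mf measurable_snd).
exact: (measurableT_comp (measurable_indic mW) (measurable_tsub (n:=n))).
Qed.

(** The four properties go through one induction because the next convolution is finite only thanks
    to both the bound and the bounded support of the previous one. Each convolution with [W]
    enlarges the support by [M]. *)
Lemma tspline_facts k :
  [/\ measurable_fun setT (tspline k), forall t, 0 <= tspline k t,
      (exists C, forall t, tspline k t <= C) &
      forall t, tspline k t != 0 -> box (M *+ k.+1) t].
Proof.
elim: k => [|k IH].
  split => [||| t].
  - exact: measurable_indic.
  - by move=> t; rewrite /= indicE.
  - by exists 1 => t /=; rewrite indicE; case: (_ \in _) => //=; rewrite ler01.
  - rewrite /= indicE; case: (boolP (t \in W)) => [|_]; last by rewrite eqxx.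
    by rewrite inE => /WM.
have [mf f0 [C fC] fs] := IH.
pose F := fun p : X * X => (tspline k p.2 * \1_W (tsub p.1 p.2))%:E.
have mF : measurable_fun setT F by exact: measurable_tspline_kernel.
have F0 p : (0 <= F p)%E by rewrite lee_fin mulr_ge0// indicE.
have C0 : 0 <= C by exact: le_trans (f0 [tuple 0 | i < n]) (fC _).
have Mk0 : 0 <= M *+ k.+1 by rewrite mulrn_wge0.
have bnd t : (\int[mu]_s F (t, s) <= (C * (M *+ k.+1 *+ 2) ^+ n)%:E)%E.
  apply: (@le_trans _ _ (\int[mu]_s (C%:E * (\1_(box (M *+ k.+1)) s)%:E))%E).
    apply: ge0_le_integral => //.
    - exact: (measurableT_comp mF (pair1_measurable _)).
    - apply/measurable_EFinP/measurable_funM => //.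
      by apply: measurable_indic; exact: measurable_tbox.
    move=> s _; rewrite -EFinM lee_fin /F /=.
    have [->|/fs sB] := eqVneq (tspline k s) 0.
      by rewrite mul0r mulr_ge0// indicE.
    rewrite [in leRHS]indicE mem_set// mulr1.
    apply: (@le_trans _ _ (C * 1)); last by rewrite mulr1.
    by apply: ler_pM => //; rewrite indicE; case: (_ \in _).
  by rewrite integral_tbox.
split => [||| t].
- apply: (@measurableT_comp _ _ _ _ _ _ fine).
    exact: fine_measurable.
  exact: (@measurable_fun_fubini_tonelli_F _ _ _ _ _ mu F mF F0).
- by move=> t; apply: Rintegral_ge0 => s _; rewrite mulr_ge0// indicE.
- exists (C * (M *+ k.+1 *+ 2) ^+ n) => t.
  rewrite -lee_fin /= /tconv /Rintegral fineK; first exact: bnd.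
  rewrite ge0_fin_numE; first exact: le_lt_trans (bnd t) (ltry _).
  by apply: integral_ge0 => s _; exact: F0 (t, s).
- apply: contra_neqP => tB; rewrite /= /tconv /Rintegral.
  rewrite (_ : (fun s => _) = cst 0%E) ?integral0//; apply/funext => s /=.
  congr EFin; have [->|/fs sB] := eqVneq (tspline k s) 0; first by rewrite mul0r.
  rewrite indicE; case: (boolP (_ \in _)) => [|_]; last by rewrite mulr0.
  rewrite inE => /WM tsB; exfalso; apply: tB => i.
  have := tsB i; have := sB i; rewrite !tnth_mktuple !subr0 => h1 h2.
  rewrite mulrSr (le_trans _ (lerD h1 h2))//.
  by rewrite (le_trans _ (ler_normD _ _))// addrC subrK.
Qed.

Lemma measurable_tspline k : measurable_fun setT (tspline k).
Proof. by have [] := tspline_facts k. Qed.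

Lemma tspline_ge0 k t : 0 <= tspline k t.
Proof. by have [] := tspline_facts k. Qed.

Lemma tspline_support k t : tspline k t != 0 -> box (M *+ k.+1) t.
Proof. by have [] := tspline_facts k; auto. Qed.

Local Open Scope ereal_scope.

(** [tconv] takes the finite part of an extended integral, which would silently be 0 if that
    integral were infinite. Finiteness, by domination on a box, restores the extended form to which
    Tonelli applies. *)
Lemma tsplineSE k t :
  (tspline k.+1 t)%:E = \int[mu]_s (tspline k s * \1_W (tsub t s))%:E.
Proof.
have [mf f0 [C fC] fs] := tspline_facts k.
rewrite /= /tconv /Rintegral fineK// ge0_fin_numE; last first.
  by apply: integral_ge0 => s _; rewrite lee_fin mulr_ge0// indicE.
have C0 : (0 <= C)%R by exact: le_trans (f0 [tuple 0%R | i < n]) (fC _).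
apply: (@le_lt_trans _ _ (\int[mu]_s (C%:E * (\1_(box (M *+ k.+1)%R) s)%:E))).
  apply: ge0_le_integral => //.
  - by move=> s _; rewrite lee_fin mulr_ge0// indicE.
  - exact: (measurableT_comp (measurable_tspline_kernel mf) (pair1_measurable t)).
  - apply/measurable_EFinP/measurable_funM => //.
    by apply: measurable_indic; exact: measurable_tbox.
  move=> s _; rewrite -EFinM lee_fin /=.
  have [->|/fs sB] := eqVneq (tspline k s) 0%R.
    by rewrite mul0r mulr_ge0// indicE.
  rewrite [in leRHS]indicE mem_set// mulr1.
  apply: (@le_trans _ _ (C * 1)%R); last by rewrite mulr1.
  by apply: ler_pM => //; rewrite indicE; case: (_ \in _).
by rewrite integral_tbox ?mulrn_wge0// ltry.
Qed.

(** A multiplicative weight turns convolution into multiplication: after Tonelli and a translation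
    of the inner variable by [s], the weight splits off the factor [w s]. Exponentials of linear
    forms are the intended weights. *)
Lemma integral_tspline k (w : X -> R) : measurable_fun setT w ->
  (forall t, 0 <= w t)%R -> (forall s t, w (tadd s t) = w s * w t)%R ->
  \int[mu]_t (w t * tspline k t)%:E = (\int[mu]_t (w t * \1_W t)%:E) ^+ k.+1.
Proof.
move=> mw w0 wD; elim: k => [|k IH]; first by [].
have mf := measurable_tspline k; have f0 := tspline_ge0 k.
have mwf g : measurable_fun setT g -> measurable_fun setT (fun t => (w t * g t)%:E).
  by move=> mg; apply/measurable_EFinP; exact: measurable_funM.
transitivity (\int[mu]_t \int[mu]_s (w t * (tspline k s * \1_W (tsub t s)))%:E).
  apply: eq_integral => t _; rewrite EFinM tsplineSE -ge0_integralZl_setT//.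
  - exact: (measurableT_comp (measurable_tspline_kernel mf) (pair1_measurable t)).
  - by move=> s; rewrite lee_fin mulr_ge0// indicE.
pose F := fun p : X * X => (w p.1 * (tspline k p.2 * \1_W (tsub p.1 p.2)))%:E.
have mF : measurable_fun setT F.
  apply/measurable_EFinP; apply: measurable_funM.
    exact: (measurableT_comp mw measurable_fst).
  by apply/measurable_EFinP; exact: measurable_tspline_kernel.
have F0 p : 0 <= F p by rewrite lee_fin !mulr_ge0// indicE.
transitivity (\int[mu]_s \int[mu]_t F (t, s)).
  exact: (@fubini_tonelli _ _ _ _ _ mu mu F mF F0).
set I := \int[mu]_t (w t * \1_W t)%:E.
have I0 : 0 <= I.
  by apply: integral_ge0 => t _; rewrite lee_fin mulr_ge0// indicE.
transitivity (\int[mu]_s ((w s * tspline k s)%:E * I)); last first.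
  rewrite expeS -IH; have -> : I * \int[mu]_t (w t * tspline k t)%:E =
    \int[mu]_t (w t * tspline k t)%:E * I by rewrite muleC.
  rewrite (@ge0_integralZr _ _ _ mu _ measurableT)//; first exact: mwf.
  by move=> s _; rewrite lee_fin mulr_ge0.
apply: eq_integral => s _.
rewrite -(@ge0_integral_tadd _ _ s).
- rewrite -ge0_integralZl_setT//.
  + by apply: eq_integral => t _; rewrite /F /= taddK wD -EFinM; congr EFin; ring.
  + exact: mwf.
  + by move=> t; rewrite lee_fin mulr_ge0// indicE.
  + by rewrite mulr_ge0.
- exact: (measurableT_comp mF (pair2_measurable s)).
- by move=> t; rewrite lee_fin !mulr_ge0// indicE.
Qed.

End tuple_spline.

(** * Elimination of the coefficients of a refinement equation *)

Section swap.
Context (R : realType) (V : zmodType).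
Variables (K : set V) (f g c : V -> R) (x0 x : V).
Hypotheses (KB : forall k l, K k -> K l -> K (k - l)).

Let rep y := f y = \sum_(k \in K) c k * g (y - k).

(* Both sides equal [sum_(j, l) c (l - j) g (x0 + j) g (x - l)]. *)
Lemma refinement_swap : K 0 ->
  (forall l, K l -> rep (x0 + l)) -> (forall j, K j -> rep (x - j)) ->
  finite_set (K `&` [set k | g (x0 + k) != 0]) ->
  finite_set (K `&` [set k | g (x - k) != 0]) ->
  \sum_(j \in K `&` [set k | g (x0 + k) != 0]) g (x0 + j) * f (x - j) =
  \sum_(l \in K) f (x0 + l) * g (x - l).
Proof.
move=> K0 r0 r1; set S1 := K `&` _; set S2 := K `&` _ => fS1 fS2.
have KN k : K k -> K (- k) by move=> Kk; rewrite -sub0r; exact: KB.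
have KD k l : K k -> K l -> K (k + l).
  by move=> Kk Kl; rewrite -[l]opprK; apply: KB => //; exact: KN.
(* Reindexing by [l - j] makes the support of the summand independent of [j]. In [E2] it becomes
   independent of [l] likewise, so the double sum runs over the finite set [S1 * S2] and may be
   exchanged. *)
have E1 j : K j -> f (x - j) = \sum_(l \in S2) c (l - j) * g (x - l).
  move=> Kj; rewrite (r1 j Kj) (@reindex_fsbig _ _ _ _ _ (fun l => l - j) K K).
    rewrite (@fsbig_widen _ _ _ _ S2 K).
    - by apply: eq_fsbigr => l _; congr (_ * g _); rewrite opprB addrA subrK.
    - by move=> l [].
    - move=> l [Kl] /=; rewrite /S2 /= => /not_andP[//|/negP]; rewrite negbK => /eqP ->.
      by rewrite mulr0.
  split.
  - by move=> l /= Kl; exact: KB.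
  - by move=> l l' _ _ /addIr.
  - by move=> l /= Kl; exists (l + j); rewrite ?addrK//; exact: KD.
have E2 l : K l -> f (x0 + l) = \sum_(j \in S1) c (l - j) * g (x0 + j).
  move=> Kl; rewrite (r0 l Kl) (@reindex_fsbig _ _ _ _ _ (fun j => l - j) K K).
    rewrite (@fsbig_widen _ _ _ _ S1 K).
    - apply: eq_fsbigr => j _; congr (_ * g _).
      by rewrite opprB addrACA subrr addr0.
    - by move=> j [].
    - move=> j [Kj] /=; rewrite /S1 /= => /not_andP[//|/negP]; rewrite negbK => /eqP ->.
      by rewrite mulr0.
  split.
  - by move=> j /= Kj; exact: KB.
  - by move=> j j' _ _ /addrI/oppr_inj.
  - by move=> j /= Kj; exists (l - j); [exact: KB | rewrite opprB addrC subrK].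
transitivity (\sum_(j \in S1) \sum_(l \in S2) c (l - j) * g (x0 + j) * g (x - l)).
  apply: eq_fsbigr => j; rewrite inE => -[Kj _]; rewrite E1// mulr_fsumr.
  by apply: eq_fsbigr => l _; ring.
rewrite exchange_fsbig//.
transitivity (\sum_(l \in S2) f (x0 + l) * g (x - l)).
  apply: eq_fsbigr => l; rewrite inE => -[Kl _]; rewrite E2// mulr_fsuml.
  by apply: eq_fsbigr.
apply: fsbig_widen => [l []//|l [Kl]] /=.
by rewrite /S2 /= => /not_andP[//|/negP]; rewrite negbK => /eqP ->; rewrite mulr0.
Qed.

End swap.

(** * Coordinates, lattices and Voronoi cells *)

Section dot_theory.
Context (R : realType) (N : nat).
Implicit Types x y z : 'rV[R]_N.

Lemma dotE x y : dot x y = (x *m y^T) 0 0.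
Proof. by rewrite mxE; apply: eq_bigr => i _; rewrite mxE. Qed.

Lemma dotC x y : dot x y = dot y x.
Proof. by apply: eq_bigr => i _; rewrite mulrC. Qed.

Lemma dotDl x y z : dot (x + y) z = dot x z + dot y z.
Proof. by rewrite !dotE mulmxDl mxE. Qed.

Lemma dotDr x y z : dot x (y + z) = dot x y + dot x z.
Proof. by rewrite dotC dotDl !(dotC x). Qed.

Lemma dotZl a x y : dot (a *: x) y = a * dot x y.
Proof. by rewrite !dotE -scalemxAl mxE. Qed.

Lemma dotZr a x y : dot x (a *: y) = a * dot x y.
Proof. by rewrite dotC dotZl dotC. Qed.

Lemma dotNl x y : dot (- x) y = - dot x y.
Proof. by rewrite -scaleN1r dotZl mulN1r. Qed.

Lemma dotNr x y : dot x (- y) = - dot x y.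
Proof. by rewrite dotC dotNl dotC. Qed.

Lemma dotBl x y z : dot (x - y) z = dot x z - dot y z.
Proof. by rewrite dotDl dotNl. Qed.

Lemma dotBr x y z : dot x (y - z) = dot x y - dot x z.
Proof. by rewrite dotDr dotNr. Qed.

Lemma dot0l x : dot 0 x = 0.
Proof. by rewrite -(scale0r 0) dotZl mul0r. Qed.

Lemma dot0r x : dot x 0 = 0.
Proof. by rewrite dotC dot0l. Qed.

Lemma dot_ge0 x : 0 <= dot x x.
Proof. by apply: sumr_ge0 => i _; rewrite -expr2 sqr_ge0. Qed.

Lemma dot_eq0 x : dot x x = 0 -> x = 0.
Proof.
move=> /eqP; rewrite psumr_eq0; last by move=> i _; rewrite -expr2 sqr_ge0.
move=> /allP h; apply/rowP => i; rewrite mxE.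
by have := h i (mem_index_enum _); rewrite -expr2 sqrf_eq0 => /eqP.
Qed.

Lemma dot_gt0 x : x != 0 -> 0 < dot x x.
Proof.
by move=> x0; rewrite lt_neqAle dot_ge0 andbT eq_sym; apply: contra_neq x0 => /dot_eq0.
Qed.

Lemma dot_suml (I : Type) (r : seq I) (P : pred I) (F : I -> 'rV[R]_N) y :
  dot (\sum_(i <- r | P i) F i) y = \sum_(i <- r | P i) dot (F i) y.
Proof.
apply: (big_morph (fun x => dot x y)); last exact: dot0l.
by move=> a b; rewrite dotDl.
Qed.

Lemma dot_CS x y : dot x y ^+ 2 <= dot x x * dot y y.
Proof.
have [->|y0] := eqVneq y 0; first by rewrite !dot0r expr0n mulr0.
have yy := dot_gt0 y0.
have := dot_ge0 (dot y y *: x - dot x y *: y).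
rewrite !(dotBl, dotBr, dotZl, dotZr) (dotC y x).
rewrite (_ : _ - _ = dot y y * (dot x x * dot y y - dot x y ^+ 2)); last by ring.
by rewrite pmulr_rge0// subr_ge0.
Qed.

(** Expanding the square of [x - l] cancels [dot x x] and leaves a linear condition in [x]. *)
Lemma voronoiP (L : set 'rV[R]_N) x : voronoi L x <->
  linspan L x /\ forall l, L l -> 2 * dot x l <= dot l l.
Proof.
suff H l : (enorm x <= enorm (x - l)) = (2 * dot x l <= dot l l).
  by split=> -[? h]; split=> // l /h; rewrite H.
rewrite /enorm ler_sqrt ?dot_ge0// !(dotBl, dotBr) (dotC l x).
by apply/idP/idP; lra.
Qed.

Lemma linspan_scale (L : set 'rV[R]_N) a : a != 0 -> linspan (scale a L) = linspan L.
Proof.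
move=> a0; apply/seteqP; split => x [k [B [LB xB]]].
  exists k, (a^-1 *: B); split.
    move=> i; have [l Ll e] := LB i.
    by rewrite linearZ /= -e scalerA mulVf// scale1r.
  by rewrite (eqmx_scale _ (invr_neq0 a0)).
exists k, (a *: B); split; last by rewrite (eqmx_scale _ a0).
by move=> i; exists (row i B) => //; rewrite linearZ.
Qed.

Lemma linspanZ (L : set 'rV[R]_N) a x : linspan L x -> linspan L (a *: x).
Proof. by move=> [k [B [LB xB]]]; exists k, B; split=> //; exact: scalemx_sub. Qed.

Lemma voronoi_scale (L : set 'rV[R]_N) a x : 0 < a ->
  voronoi (scale a L) x <-> voronoi L (a^-1 *: x).
Proof.
move=> a0; have a0' : a != 0 by rewrite gt_eqF.
rewrite !voronoiP linspan_scale//; split=> -[xL h]; split.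
- exact: linspanZ.
- move=> l Ll; have : scale a L (a *: l) by exists l.
  move=> /h; rewrite !(dotZl, dotZr) => h'.
  rewrite -(ler_pM2l (exprn_gt0 2 a0)).
  by rewrite (le_trans _ (le_trans h' _))//; [|rewrite mulrA expr2];
     rewrite le_eqVlt; apply/orP; left; apply/eqP; field.
- by move: (linspanZ a xL); rewrite scalerA mulfV// scale1r.
- move=> _ [l Ll <-]; have := h l Ll.
  rewrite !(dotZl, dotZr) => h'.
  rewrite -(ler_pM2l (exprn_gt0 2 a0)) in h'.
  by rewrite (le_trans _ (le_trans h' _))//; [|rewrite mulrA expr2];
     rewrite le_eqVlt; apply/orP; left; apply/eqP; field.
Qed.

End dot_theory.

Section coordinates.
Context (R : realType) (N d : nat) (Q : 'M[R]_(d, N)).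
Hypothesis QQ : Q *m Q^T = 1%:M.
Local Notation T := (measurableTypeR R).
Local Notation X := (d.-tuple T).
Local Notation p := (from_coord Q).

Definition coord (x : 'rV[R]_N) : X := [tuple (x *m Q^T) 0 i | i < d].

Lemma from_coordD (s t : X) : p (tadd s t) = p s + p t.
Proof.
rewrite /from_coord -mulmxDl; congr (_ *m _).
by apply/rowP => i; rewrite !mxE tnth_mktuple.
Qed.

Lemma from_coordB (s t : X) : p (tsub s t) = p s - p t.
Proof.
rewrite /from_coord -mulmxBl; congr (_ *m _).
by apply/rowP => i; rewrite !mxE tnth_mktuple.
Qed.

Lemma from_coordZ a (t : X) : p (tscale a t) = a *: p t.
Proof.
rewrite /from_coord scalemxAl; congr (_ *m _).
by apply/rowP => i; rewrite !mxE tnth_mktuple.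
Qed.

Lemma from_coord_sub (t : X) : (p t <= Q)%MS.
Proof. exact: submxMl. Qed.

Lemma coordK x : (x <= Q)%MS -> p (coord x) = x.
Proof.
move=> /submxP[D ->]; rewrite /from_coord /coord; congr (_ *m _).
by apply/rowP => i; rewrite mxE tnth_mktuple -mulmxA QQ mulmx1.
Qed.

Lemma tnth_from_coord (t : X) i : dot (p t) (row i Q) = tnth t i.
Proof.
transitivity ((p t *m Q^T) 0 i).
  by rewrite mxE; apply: eq_bigr => k _; rewrite !mxE.
by rewrite /from_coord -mulmxA QQ mulmx1 mxE.
Qed.

Lemma measurable_dot_from_coord y : measurable_fun setT (fun t : X => dot (p t) y).
Proof.
rewrite (_ : (fun t => _) = fun t : X => \sum_(i < d) dot (row i Q) y * tnth t i).
  apply: measurable_sum => i; apply: measurable_funM => //.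
  exact: measurable_tnth.
apply/funext => t; rewrite /from_coord mulmx_sum_row dot_suml.
by apply: eq_bigr => i _; rewrite dotZl mxE mulrC.
Qed.

Lemma dot_from_coord (s t : X) : dot (p s) (p t) = \sum_i tnth s i * tnth t i.
Proof.
rewrite dotE /from_coord trmx_mul mulmxA -(mulmxA _ Q) QQ mulmx1 mxE.
by apply: eq_bigr => i _; rewrite !mxE.
Qed.

End coordinates.

Section lattice.
Context (R : realType) (N : nat) (L : set 'rV[R]_N) (K : nat).
Hypotheses (K0 : (0 < K)%N) (LK : forall l, L l -> integral_vec (K%:R *: l)).

(** The common denominator [K] of the coordinates is the form in which discreteness of the lattice
    is carried through the development. *)
Lemma lattice_finite (B : R) : finite_set (L `&` [set l | forall i, `|l 0 i| <= B]).
Proof.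
pose C := (Num.truncn (K%:R * B)).+1.
(* The entries of [K%:R *: l] are integers between [- C] and [C]; adding [C] makes them ordinals
   below [C.*2.+1]. *)
pose h (k : {ffun 'I_N -> 'I_(C.*2).+1}) : 'rV[R]_N :=
  \row_i (K%:R^-1 * ((k i)%:R - C%:R)).
apply: (@sub_finite_set _ _ (h @` [set: {ffun 'I_N -> 'I_(C.*2).+1}])); last first.
  by apply: finite_image; exact: finite_finset.
move=> l [/LK lK lB] /=.
have KR : 0 < K%:R :> R by rewrite ltr0n.
have H i : {k : 'I_(C.*2).+1 | (K%:R * l 0 i = k%:R - C%:R)}.
  have /intrP/cid[z zE] : K%:R * l 0 i \is a Num.int by have := lK i; rewrite mxE.
  have zC : `|z%:~R| <= C%:R :> R.
    rewrite -zE normrM (ger0_norm (ltW KR)).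
    apply: (@le_trans _ _ (K%:R * B)); first by rewrite ler_pM2l.
    by rewrite ltW// /C; exact: truncnS_gt.
  have zC' : (`|z| <= C%:Z) by rewrite -(ler_int R) intr_norm.
  have z0 : 0 <= z + C by move: zC'; rewrite ler_norml; lia.
  have zlt : (absz (z + C%:Z)%R < (C.*2).+1)%N by move: zC'; rewrite ler_norml; lia.
  exists (Ordinal zlt) => /=; rewrite zE.
  by rewrite pmulrn gez0_abs// intrD addrK.
exists [ffun i => sval (H i)] => //; apply/rowP => i; rewrite mxE ffunE -(svalP (H i)).
by rewrite mulKf// gt_eqF.
Qed.

Lemma lattice_countable : countable L.
Proof.
rewrite (_ : L = \bigcup_n (L `&` [set l | forall i, `|l 0 i| <= n%:R])).
  apply: bigcup_countable => // n _.
  exact/finite_set_countable/lattice_finite.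
apply/seteqP; split => [l Ll|l [n _ []]//].
exists (Num.truncn (\sum_i `|l 0 i|)).+1 => //; split => // i.
apply: (le_trans _ (ltW (truncnS_gt _))).
by rewrite (bigD1 i)//= lerDl sumr_ge0.
Qed.

Context (d : nat) (Q : 'M[R]_(d, N)).
Hypothesis (hQ : orthonormal_basis (linspan L) Q).
Local Notation T := (measurableTypeR R).
Local Notation X := (d.-tuple T).
Local Notation p := (from_coord Q).

Let QQ : Q *m Q^T = 1%:M. Proof. by case: hQ. Qed.

Lemma voronoi_coordP (t : X) : voronoi L (p t) <-> forall l, L l -> 2 * dot (p t) l <= dot l l.
Proof.
rewrite voronoiP; split => [[]//|h]; split=> //.
by apply/hQ.2; exact: from_coord_sub.
Qed.

(** The cell is a countable intersection of half-spaces. They are numbered by an injection of [L]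
    into the naturals, and a number that is not attained contributes the whole space. *)
Lemma measurable_voronoi : measurable [set t : X | voronoi L (p t)].
Proof.
have /countable_injP[f fI] := lattice_countable.
rewrite (_ : [set t | _] = \bigcap_n [set t : X | forall l, L l -> f l = n -> 2 * dot (p t) l <= dot l l]).
  apply: bigcap_measurableType => n _.
  have [[l [Ll ln]]|hn] := pselect (exists l, L l /\ f l = n).
    rewrite (_ : [set t | _] = [set t : X | 2 * dot (p t) l <= dot l l]).
      rewrite -[X in measurable X]setTI; apply: measurable_fun_ler => //.
      apply: measurable_funM => //; exact: measurable_dot_from_coord.
    apply/seteqP; split=> t /=; first by apply.
    by move=> h l' Ll' l'n; rewrite (fI l' l) ?inE// l'n.
  rewrite (_ : [set t | _] = setT)//.
  by apply/seteqP; split=> t //= _ l Ll ln; exfalso; apply: hn; exists l.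
apply/seteqP; split=> t /=.
  by move=> /voronoi_coordP h n _ l Ll _; exact: h.
by move=> h; apply/voronoi_coordP => l Ll; exact: (h (f l)).
Qed.

Hypothesis (LN : forall l, L l -> L (- l)).

Lemma voronoi_dot_abs x l : voronoi L x -> L l -> 2 * `|dot x l| <= dot l l.
Proof.
move=> /voronoiP[_ h] Ll.
have := h _ (LN Ll); have := h _ Ll; rewrite !(dotNl, dotNr) opprK => h1 h2.
by rewrite -ler_pdivlMl// ler_norml; apply/andP; split; lra.
Qed.

(** Each coordinate is the dot product with a row of [Q], which is a linear combination of lattice
    vectors, and the cell bounds the dot product with each of these. *)
Lemma voronoi_bounded : exists2 M : R, 0 <= M &
  [set t : X | voronoi L (p t)] `<=` tbox [tuple 0 | i < d] M.
Proof.
have H i : {M : R | 0 <= M & forall t, voronoi L (p t) -> `|tnth t i| <= M}.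
  have : linspan L (row i Q) by apply/hQ.2; exact: row_sub.
  move=> /cid[k /cid[B [LB /submxP/cid[D rE]]]].
  exists (\sum_j `|D 0 j| * dot (row j B) (row j B)).
    by apply: sumr_ge0 => j _; rewrite mulr_ge0// dot_ge0.
  move=> t Vt; rewrite -(tnth_from_coord QQ) rE mulmx_sum_row dotC dot_suml.
  apply: le_trans (ler_norm_sum _ _ _) _; apply: ler_sum => j _.
  rewrite dotZl normrM ler_wpM2l// dotC.
  apply: le_trans _ (voronoi_dot_abs Vt (LB j)).
  by rewrite ler_peMl// ler1n.
exists (\sum_i s2val (H i)); first by apply: sumr_ge0 => i _; exact: (s2valP (H i)).
move=> t Vt i; rewrite tnth_mktuple subr0.
apply: le_trans (s2valP' (H i) t Vt) _.
by rewrite (bigD1 i)//= lerDl sumr_ge0// => j _; exact: (s2valP (H j)).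
Qed.

End lattice.

(** * Exponential sums and self-similarity *)

Section exponential_sums.
Context (R : realType).
Implicit Types (r : seq (R * R)) (t : R).

Lemma expRN_small (c e : R) : 0 < c -> 0 < e ->
  exists2 T : R, 0 < T & forall t, T <= t -> expR (- (c * t)) <= e.
Proof.
(* From here on [c * t >= e^-1], and [expR (c * t)] is at least [c * t]. *)
move=> c0 e0; exists (e^-1 / c); first by rewrite divr_gt0// invr_gt0.
move=> t Tt; rewrite expRN -[leRHS]invrK lef_pV2 ?posrE ?expR_gt0 ?invr_gt0//.
apply: le_trans (expR_ge1Dx _); rewrite ler_wpDl//.
by rewrite mulrC -ler_pdivrMr.
Qed.

Definition expsum r t : R := \sum_(a <- r) a.1 * expR (a.2 * t).

(** Nonnegative coefficients exclude cancellation: the leading exponential is itself a lower bound,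
    and the others are smaller by an exponentially decaying factor. Nonvanishing at one point
    excludes that all coefficients are zero. *)
Lemma expsum_bounds r : (forall a, a \in r -> 0 <= a.1) -> (exists2 t, 0 <= t & expsum r t != 0) ->
  exists A a C c, [/\ 0 < A, 0 <= C, 0 < c &
    forall t, 0 <= t -> A * expR (a * t) <= expsum r t <=
      A * expR (a * t) * (1 + C * expR (- (c * t)))].
Proof.
suff H : (forall a, a \in r -> 0 <= a.1) -> (forall t, expsum r t = 0) \/
  exists A a C c, [/\ 0 < A, 0 <= C, 0 < c &
    forall t, 0 <= t -> A * expR (a * t) <= expsum r t <=
      A * expR (a * t) * (1 + C * expR (- (c * t)))].
  by move=> /H [h [t _]|//]; rewrite h eqxx.
elim: r => [|[B b] r IH] h; first by left => t; rewrite /expsum big_nil.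
have {}IH := IH (fun a ar => h a (mem_behead (s := _ :: _) ar)).
have B0 : 0 <= B by have := h (B, b) (mem_head _ _).
have eE t : expsum ((B, b) :: r) t = B * expR (b * t) + expsum r t.
  by rewrite /expsum big_cons.
have [BE|Bn0] := eqVneq B 0.
  have {}eE : expsum ((B, b) :: r) = expsum r.
    by apply/funext => t; rewrite eE BE mul0r add0r.
  by rewrite eE.
have {Bn0}B0 : 0 < B by rewrite lt_neqAle eq_sym Bn0.
right; case: IH => [r0|[A [a [C [c [A0 C0 c0 rb]]]]]].
  exists B, b, 0, 1; split=> // t _; rewrite eE r0 addr0 mul0r addr0 mulr1.
  by rewrite lexx.
(* The new term joins the error, takes over as leading term, or merges with the leading term. *)
have [ba|ab|ba] := ltgtP b a.
- exists A, a, (C + B / A), (Num.min c (a - b)); split=> //.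
  + by rewrite addr_ge0// divr_ge0// ltW.
  + by rewrite lt_min c0 subr_gt0.
  move=> t t0; have /andP[l u] := rb t t0; rewrite eE; apply/andP; split.
    by rewrite (le_trans l)// lerDr mulr_ge0// ?expR_ge0// ltW.
  rewrite mulrDl addrA mulrDr [B * _ + _]addrC lerD//.
        apply: (le_trans u); rewrite ler_pM2l ?mulr_gt0 ?expR_gt0// lerD2l ler_wpM2l//.
    by rewrite ler_expR lerN2 ler_wpM2r// ge_min lexx.
  rewrite (_ : _ * _ * _ = B * (expR (a * t) * expR (- (Num.min c (a - b) * t)))); last first.
    by field; rewrite gt_eqF.
  rewrite ler_pM2l// -expRD ler_expR.
  have : Num.min c (a - b) * t <= (a - b) * t by rewrite ler_wpM2r// ge_min lexx orbT.
  by lra.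
- exists B, b, (A * (1 + C) / B), (b - a); split=> //.
  + by rewrite divr_ge0// ?mulr_ge0// ?addr_ge0// ltW.
  + by rewrite subr_gt0.
  move=> t t0; have /andP[l u] := rb t t0; rewrite eE; apply/andP; split.
    rewrite lerDl; apply: le_trans l; by rewrite mulr_ge0// ?expR_ge0// ltW.
  rewrite mulrDr mulr1 lerD2l; apply: (le_trans u).
  rewrite [leRHS](_ : _ = A * (expR (b * t) * expR (- ((b - a) * t))) * (1 + C)); last first.
    by field; rewrite gt_eqF.
  rewrite -expRD (_ : b * t + - ((b - a) * t) = a * t); last by ring.
  rewrite ler_pM2l ?mulr_gt0 ?expR_gt0// lerD2l ler_piMr//.
  by rewrite -expR0 ler_expR oppr_le0 mulr_ge0// ltW.
- exists (A + B), a, C, c; split=> //; first by rewrite addr_gt0.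
  move=> t t0; have /andP[l u] := rb t t0; rewrite eE ba; apply/andP; split.
    by rewrite mulrDl [B * _ + _]addrC lerD2r.
  rewrite (mulrDl A B) (mulrDl (A * _)) [B * _ + _]addrC lerD//.
  by rewrite ler_peMr ?mulr_ge0 ?expR_ge0 ?(ltW B0)// lerDl mulr_ge0// expR_ge0.
Qed.

(** * Contradiction from an approximate self-similarity *)

Variables (J : R -> R) (N : R).
Hypothesis N0 : 0 < N.
Hypothesis Jlim : J t @[t --> +oo] --> N.

(** Both [J t] and [J (la * t)] tend to [N > 0], so the first inequality forces
    [A * expR (a * t) <= B * expR (b * t)] for large [t]. The second one then compares the powers,
    and the root is harmless because [1 + x <= (1 + x) ^+ m] for [x >= 0]. *)
Lemma laplace_ratio_bound (m : nat) (la A a B b C c C' c' : R) :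
  0 < la < 1 -> 0 < A -> 0 < B -> 0 <= C -> 0 < c -> 0 <= C' -> 0 < c' ->
  (0 < m)%N -> (forall t, 0 < t -> 0 <= J t) ->
  (forall t, 0 < t -> A * expR (a * t) * J t ^+ m <=
     B * expR (b * t) * (1 + C * expR (- (c * t))) * J (la * t) ^+ m) ->
  (forall t, 0 < t -> B * expR (b * t) * J (la * t) ^+ m <=
     A * expR (a * t) * (1 + C' * expR (- (c' * t))) * J t ^+ m) ->
  exists2 T : R, 0 < T & forall t, T <= t -> J (la * t) <= (1 + C' * expR (- (c' * t))) * J t.
Proof.
move=> /andP[la0 la1] A0 B0 C0 c0 C0' c0' m0 J0 h1 h2.
suff [T T0 hT] : exists2 T : R, 0 < T & forall t, T <= t -> A * expR (a * t) <= B * expR (b * t).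
  exists T => // t Tt; have t0 : 0 < t by exact: lt_le_trans Tt.
  have E0 : 0 <= C' * expR (- (c' * t)) by rewrite mulr_ge0// expR_ge0.
  have Jt := J0 t t0; have Jlt := J0 _ (mulr_gt0 la0 t0).
  rewrite -(@ler_pXn2r _ m)// ?nnegrE//; last by rewrite mulr_ge0// addr_ge0.
  have Bb : 0 < B * expR (b * t) by rewrite mulr_gt0// expR_gt0.
  rewrite -(ler_pM2l Bb) (le_trans (h2 t t0))// exprMn mulrA ler_wpM2r ?exprn_ge0//.
  apply: ler_pM; rewrite ?mulr_ge0 ?(ltW A0) ?expR_ge0 ?addr_ge0//; first exact: hT.
  by rewrite -[leLHS]expr1 ler_weXn2l// lerDl.
(* Otherwise the left exponential exceeds the right one by a fixed factor [1 + d] for all large [t],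
   and this factor survives in the limit. *)
apply: contrapT => hn.
have [d d0 [T1 hd]] : exists2 d : R, 0 < d & exists T1 : R, forall t, T1 <= t ->
    (1 + d) * (B * expR (b * t)) <= A * expR (a * t).
  have [ab|ba|ab] := ltgtP a b.
  - exfalso; apply: hn; have ba0 : 0 < b - a by rewrite subr_gt0.
    have [T T0 hT] := expRN_small ba0 (divr_gt0 B0 A0).
    exists T => // t /hT; rewrite ler_pdivlMr// => h.
    rewrite (_ : a * t = b * t + - ((b - a) * t)); last by ring.
    by rewrite expRD mulrCA mulrC ler_pM2r ?expR_gt0// mulrC.
  - have ba0 : 0 < a - b by rewrite subr_gt0.
    have [T T0 hT] := expRN_small ba0 (divr_gt0 A0 (mulr_gt0 (ltr0n _ 2) B0)).
    exists 1 => //; exists T => t /hT; rewrite ler_pdivlMr ?mulr_gt0// => h.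
    rewrite (_ : b * t = a * t + - ((a - b) * t)); last by ring.
    rewrite expRD 2!mulrA mulrAC ler_pM2r ?expR_gt0//.
    by apply: le_trans h; rewrite mulrC.
  - have BA : B < A.
      rewrite ltNge; apply/negP => AB; apply: hn; exists 1 => // t _.
      by rewrite ab ler_pM2r ?expR_gt0.
    exists ((A - B) / B); first by rewrite divr_gt0// subr_gt0.
    exists 0 => t _; rewrite mulrA -ab ler_pM2r ?expR_gt0//.
    by rewrite le_eqVlt; apply/orP; left; apply/eqP; field; rewrite gt_eqF.
have limla : J (la * t) @[t --> +oo] --> N.
  apply: (cvg_comp (fun t => la * t) J _ Jlim).
  by apply: gt0_cvgMry => //; exact: cvg_id.
have lime : expR (- (c * t)) @[t --> +oo] --> (0 : R).
  apply/cvgr0Pnorm_le => e e0; have [T _ hT] := expRN_small c0 e0.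
  near=> t; rewrite ger0_norm ?expR_ge0// hT//; near: t; exact: nbhs_pinfty_ge.
have : (1 + d) * N ^+ m <= (1 + C * 0) * N ^+ m.
  have cX (f : R -> R) : f t @[t --> +oo] --> N -> f t ^+ m @[t --> +oo] --> N ^+ m.
    by move=> fN; exact: (cvg_comp f _ fN (@exprn_continuous R m N)).
  have l1 : (1 + d) * J t ^+ m @[t --> +oo] --> (1 + d) * N ^+ m.
    by apply: (cvgM (cvg_cst (1 + d)) (cX _ Jlim)).
  have l2 : (1 + C * expR (- (c * t))) * J (la * t) ^+ m @[t --> +oo] -->
      (1 + C * 0) * N ^+ m.
    have l3 : 1 + C * expR (- (c * t)) @[t --> +oo] --> 1 + C * 0.
      by apply: cvgD; [exact: cvg_cst | apply: cvgM; [exact: cvg_cst | exact: lime]].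
    exact: (cvgM l3 (cX (fun t => J (la * t)) limla)).
  apply: (ler_cvg_to l1 l2).
  near=> t; have t0 : 0 < t by near: t; exact: nbhs_pinfty_gt.
  have Bb : 0 < B * expR (b * t) by rewrite mulr_gt0// expR_gt0.
  rewrite -(ler_pM2l Bb) mulrCA mulrA [leRHS]mulrA.
  apply: le_trans (h1 t t0); rewrite ler_wpM2r ?exprn_ge0 ?J0//.
  apply: hd; near: t; apply: nbhs_pinfty_ge; exact: num_real.
rewrite mulr0 addr0 ler_pM2r ?exprn_gt0//; lra.
Unshelve. all: by end_near. Qed.

Hypothesis Jlow : forall e, 0 < e -> exists2 rho : R, 0 < rho &
  forall t, 0 < t -> N * (1 - expR (- t)) + t * rho * expR (- (e * t)) <= J t.

Lemma laplace_scaling_contra (m : nat) (la Lam al be : R) r r' : 0 < la < 1 -> 0 < Lam ->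
  (0 < m)%N ->
  (forall a, a \in r -> 0 <= a.1) -> (forall a, a \in r' -> 0 <= a.1) ->
  expsum r 0 != 0 ->
  (forall t, 0 < t -> expsum r t * expR (al * t) * J t ^+ m =
     Lam * expsum r' t * expR (be * t) * J (la * t) ^+ m) -> False.
Proof.
move=> la01 Lam0 m0 r0 r0' rn0 rel; have /andP[la0 la1] := la01.
have Jpos t : 0 < t -> 0 < J t.
  move=> t0; have [rho rho0 h] := Jlow ltr01.
  apply: lt_le_trans (h t t0); rewrite ltr_wpDl ?mulr_gt0 ?expR_gt0//.
  rewrite mulr_ge0 ?(ltW N0)// subr_ge0 -expR0 ler_expR oppr_le0; exact: ltW.
have [A [a [C [c [A0 C0 c0 rb]]]]] : exists A a C c, [/\ 0 < A, 0 <= C, 0 < c &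
    forall t, 0 <= t -> A * expR (a * t) <= expsum r t <=
      A * expR (a * t) * (1 + C * expR (- (c * t)))].
  by apply: expsum_bounds => //; exists 0.
have [B [b [D [e [B0 D0 e0 rb']]]]] : exists A a C c, [/\ 0 < A, 0 <= C, 0 < c &
    forall t, 0 <= t -> A * expR (a * t) <= expsum r' t <=
      A * expR (a * t) * (1 + C * expR (- (c * t)))].
  (* Nonvanishing is assumed for the first sum; the relation at [t = 1] transfers it to the
     second. *)
  apply: expsum_bounds => //; exists 1 => //; apply/eqP => E.
  have := rel 1 ltr01; rewrite E mulr0 !mul0r => /eqP.
  rewrite !mulf_eq0 (gt_eqF (expR_gt0 _)) expf_eq0 m0 /= (gt_eqF (Jpos _ ltr01)) !orbF.
  have /andP[h _] := rb 1 ler01; apply/negP; rewrite gt_eqF//.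
  by apply: lt_le_trans h; rewrite mulr_gt0// expR_gt0.
have [T T0 hT] : exists2 T : R, 0 < T & forall t, T <= t ->
    J (la * t) <= (1 + C * expR (- (c * t))) * J t.
  apply: (@laplace_ratio_bound m la A (a + al) (Lam * B) (b + be) D e) => //.
  - exact: mulr_gt0.
  - by move=> t /Jpos/ltW.
  - move=> t t0; have Jm : 0 <= J t ^+ m by rewrite exprn_ge0// ltW// Jpos.
    have Jlm : 0 <= J (la * t) ^+ m by rewrite exprn_ge0// ltW// Jpos// mulr_gt0.
    have /andP[h1 _] := rb t (ltW t0); have /andP[_ h2] := rb' t (ltW t0).
    apply: (@le_trans _ _ (expsum r t * expR (al * t) * J t ^+ m)).
      by rewrite ler_wpM2r// mulrDl expRD mulrA ler_wpM2r// expR_ge0.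
    rewrite rel// ler_wpM2r// [leRHS](_ : _ =
      Lam * (B * expR (b * t) * (1 + D * expR (- (e * t)))) * expR (be * t)); last first.
      by rewrite mulrDl expRD; ring.
    by rewrite ler_wpM2r ?expR_ge0// ler_pM2l.
  - move=> t t0; have Jm : 0 <= J t ^+ m by rewrite exprn_ge0// ltW// Jpos.
    have Jlm : 0 <= J (la * t) ^+ m by rewrite exprn_ge0// ltW// Jpos// mulr_gt0.
    have /andP[_ h1] := rb t (ltW t0); have /andP[h2 _] := rb' t (ltW t0).
    apply: (@le_trans _ _ (expsum r t * expR (al * t) * J t ^+ m)).
      rewrite rel// ler_wpM2r// mulrDl expRD -!mulrA ler_pM2l// mulrA.
      by rewrite ler_wpM2r// expR_ge0.
    rewrite ler_wpM2r// mulrDl expRD mulrA mulrAC ler_wpM2r ?expR_ge0//.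
have cl0 : 0 < c * (1 - la) by rewrite mulr_gt0// subr_gt0.
have C1 : 0 < C + 1 by rewrite ltr_wpDl.
have [T' T0' hT'] : exists2 T' : R, 0 < T' & forall t, T' <= t ->
    expR (- (c * (1 - la) * t)) <= (C + 1)^-1.
  by apply: expRN_small => //; rewrite invr_gt0.
(* The correction factor absorbs the error term: [F (la * t) <= F t] follows as soon as
   [(C + 1) * E <= El], which holds once [expR (- (c * (1 - la) * t))] is at most [(C + 1)^-1]. *)
pose F t := J t * (1 - expR (- (c * t))).
pose T1 := Num.max T T'.
have T10 : 0 < T1 by rewrite lt_max T0.
have Fmono t : T1 <= t -> F (la * t) <= F t.
  rewrite ge_max => /andP[Tt Tt']; have t0 : 0 < t by exact: lt_le_trans Tt.
  have hla := hT' t Tt'.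
  set E := expR (- (c * t)); set El := expR (- (c * (la * t))).
  have EE : E = El * expR (- (c * (1 - la) * t)).
    by rewrite /E /El -expRD; congr expR; ring.
  have El1 : El <= 1.
    by rewrite -expR0 ler_expR oppr_le0 !mulr_ge0// ltW.
  have hE : (C + 1) * E <= El.
    rewrite EE mulrCA -[leRHS]mulr1 ler_wpM2l ?expR_ge0//.
    by rewrite -ler_pdivlMl// mulr1.
  rewrite /F -/E -/El.
  apply: (@le_trans _ _ ((1 + C * E) * J t * (1 - El))).
    by rewrite ler_wpM2r ?subr_ge0// hT.
  rewrite [_ * J t]mulrC -mulrA ler_wpM2l ?(ltW (Jpos _ t0))//.
  have : 0 <= C * E * El by rewrite !mulr_ge0// expR_ge0.
  move: hE; rewrite mulrDl mul1r; nra.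
have FN t : T1 <= t -> F t <= N.
  move=> Tt; apply/ler_addgt0Pr => eps eps0.
  have [M [_ hM]] : \forall x \near +oo, J x <= N + eps.
    near=> x; have : `|N - J x| < eps by near: x; move/cvgrPdist_lt : Jlim; exact.
    by rewrite distrC ltr_norml => /andP[_ h]; lra.
  have t0 : 0 < t by exact: lt_le_trans Tt.
  (* Monotonicity is iterated outwards, to arguments where [F <= J] and [J] is close to its limit
     [N]. *)
  have Fk k : F t <= F (t / la ^+ k) /\ t <= t / la ^+ k.
    elim: k => [|k [IH1 IH2]]; first by rewrite expr0 divr1.
    have E : t / la ^+ k = la * (t / la ^+ k.+1).
      by rewrite exprS; field; rewrite (gt_eqF la0) expf_eq0 (gt_eqF la0) andbF.
    have P0 : 0 < t / la ^+ k.+1 by rewrite divr_gt0// exprn_gt0.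
    have le : t / la ^+ k <= t / la ^+ k.+1.
      by rewrite E ler_piMl ?ltW.
    split; last exact: le_trans le.
    apply: (le_trans IH1); rewrite {1}E; apply: Fmono.
    exact: le_trans Tt (le_trans IH2 le).
  have [k hk] : exists k, M < t / la ^+ k.
    have gN : la ^+ k @[k --> \oo] --> (0 : R) by apply: cvg_expr; rewrite ger0_norm ?ltW.
    have [M0|M0] := lerP M 0; first by exists 0%N; rewrite expr0 divr1 (le_lt_trans M0).
    have tM : 0 < t / M by rewrite divr_gt0.
    have /cvgr0Pnorm_lt/(_ _ tM)[k _ hk] := gN.
    exists k; have := hk k (leqnn k); rewrite /= ger0_norm ?exprn_ge0 ?ltW//.
    by rewrite ltr_pdivlMr// ltr_pdivlMr ?exprn_gt0// mulrC.
  have [Fk1 Fk2] := Fk k.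
  apply: (le_trans Fk1); apply: le_trans (hM _ hk).
  have Jk := Jpos _ (lt_le_trans t0 Fk2).
  by rewrite /F ler_piMr ?(ltW Jk)// lerBlDr lerDl expR_ge0.
(* With [x = expR (- (ep * t))], both [expR (- (c * t))] and [expR (- t)] are at most [x * x <= x].
   The loss is then at most [2 * N * x] while the gain is at least [t * rho * x / 2], whence the
   threshold [4 * N / rho] for [t]. *)
pose ep := Num.min c 1 / 2.
have ep0 : 0 < ep by rewrite divr_gt0// lt_min c0 ltr01.
have [rho rho0 hrho] := Jlow ep0.
have [T2 T20 hT2] := expRN_small c0 (divr_gt0 ltr01 (ltr0n R 2)).
pose t := Num.max (Num.max T1 T2) (4 * N / rho + 1).
have tT1 : T1 <= t by rewrite /t le_max; apply/orP; left; rewrite le_max lexx.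
have tT2 : T2 <= t by rewrite /t le_max; apply/orP; left; rewrite le_max lexx orbT.
have tN : 4 * N / rho + 1 <= t by rewrite /t le_max lexx orbT.
have t0 : 0 < t by exact: lt_le_trans tT1.
have h1 := FN t tT1; have h2 := hrho t t0; have h3 := hT2 t tT2.
have epE : ep + ep = Num.min c 1 by rewrite /ep; field.
have ec : expR (- (c * t)) <= expR (- (ep * t)) * expR (- (ep * t)).
  rewrite -expRD ler_expR -opprD lerN2 -mulrDl ler_pM2r//.
  by rewrite epE ge_min lexx.
have e1 : expR (- t) <= expR (- (ep * t)) * expR (- (ep * t)).
  rewrite -expRD ler_expR -opprD lerN2 -mulrDl -[leRHS]mul1r ler_pM2r//.
  by rewrite epE ge_min lexx orbT.
have ep1 : expR (- (ep * t)) <= 1 by rewrite -expR0 ler_expR oppr_le0 mulr_ge0// ltW.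
have epp := expR_gt0 (- (ep * t)); have cp := expR_gt0 (- (c * t)).
have tp := expR_gt0 (- t).
move: h1 h2 h3 ec e1 ep1 epp cp tp; rewrite /F.
set x := expR (- (ep * t)); set y := expR (- (c * t)); set z := expR (- t).
move=> h1 h2 h3 yx zx x1 x0 y0 z0.
have k1 : (N * (1 - z) + t * rho * x) * (1 - y) <= N.
  by apply: le_trans h1; rewrite ler_wpM2r//; lra.
have trho : 4 * N < t * rho.
  by rewrite -ltr_pdivrMr//; lra.
have k2 : N * (1 - z) * (1 - y) >= N * (1 - z - y).
  by rewrite -mulrA ler_pM2l//; nra.
have k3 : t * rho * x * (1 - y) >= t * rho * x / 2.
  by rewrite ler_pM2l ?mulr_gt0//; lra.
have k5 : N * (z + y) <= N * (2 * x).
  rewrite ler_pM2l//; nra.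
have : t * rho * x <= 4 * N * x by lra.
by rewrite ler_pM2r// leNgt trho.
Unshelve. all: by end_near. Qed.

End exponential_sums.

(** * Laplace integrals along a direction *)

Section laplace_integral.
Context (R : realType) (n : nat).
Local Notation T := (measurableTypeR R).
Local Notation X := (n.-tuple T).
Local Notation mu := (lebesgue_tuple R n).
Variables (s : X -> R) (ms : measurable_fun setT s).
Local Open Scope ereal_scope.

Definition lapl (t : R) (A : set X) : \bar R :=
  \int[mu]_x (expR (- (t * s x)) * \1_A x)%:E.

Lemma lapl_ge0 t A : 0 <= lapl t A.
Proof. by apply: integral_ge0 => x _; rewrite lee_fin mulr_ge0// ?expR_ge0// indicE. Qed.

Lemma measurable_lapl t A : measurable A ->
  measurable_fun setT (fun x => (expR (- (t * s x)) * \1_A x)%:E).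
Proof.
move=> mA; apply/measurable_EFinP; apply: measurable_funM; last exact: measurable_indic.
apply: measurableT_comp => //; apply: measurableT_comp => //.
by apply: measurable_funM.
Qed.

Lemma lapl0 A : measurable A -> lapl 0 A = mu A.
Proof.
move=> mA; transitivity (\int[mu]_x (\1_A x)%:E); last by rewrite integral_indic// setIT.
by apply: eq_integral => x _; rewrite mul0r oppr0 expR0 mul1r.
Qed.

Lemma lapl_setU t A B : measurable A -> measurable B -> A `&` B = set0 ->
  lapl t (A `|` B) = lapl t A + lapl t B.
Proof.
move=> mA mB AB; rewrite /lapl -ge0_integralD//; try exact: measurable_lapl;
  try by move=> x _; rewrite lee_fin mulr_ge0// ?expR_ge0// indicE.
apply: eq_integral => x _; rewrite -EFinD -mulrDr !indicE in_setU.
have := in_setI x A B; rewrite AB in_set0.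
by case: (x \in A); case: (x \in B) => //= _; rewrite ?addr0 ?add0r.
Qed.

Lemma lapl_le t A B : measurable A -> measurable B -> A `<=` B -> lapl t A <= lapl t B.
Proof.
move=> mA mB AB; apply: ge0_le_integral => //; try exact: measurable_lapl;
  try by move=> x _; rewrite lee_fin mulr_ge0// ?expR_ge0// indicE.
move=> x _; rewrite lee_fin ler_wpM2l// ?expR_ge0// !indicE ler_nat.
by case: (boolP (x \in A)) => //; rewrite inE => /AB/mem_set ->.
Qed.

Lemma lapl_ub t (A : set X) (a : R) : (0 <= t)%R -> measurable A ->
  (forall x, A x -> a <= s x)%R -> lapl t A <= (expR (- (t * a)))%:E * mu A.
Proof.
move=> t0 mA h; rewrite -lapl0// /lapl -ge0_integralZl_setT ?expR_ge0//;
  try exact: measurable_lapl;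
  try by move=> x; rewrite lee_fin mulr_ge0// ?expR_ge0// indicE.
apply: ge0_le_integral; first exact: measurableT.
- by move=> x _; rewrite lee_fin !mulr_ge0// ?expR_ge0// indicE.
- exact: measurable_lapl.
- by apply: measurable_funeM; exact: measurable_lapl.
move=> x _; rewrite -EFinM lee_fin mul0r oppr0 expR0 mul1r indicE.
case: (boolP (x \in A)) => [|_]; last by rewrite !mulr0.
by rewrite inE => /h sx; rewrite !mulr1 ler_expR lerN2 ler_wpM2l.
Qed.

Lemma lapl_lb t (A : set X) (b : R) : (0 <= t)%R -> measurable A ->
  (forall x, A x -> s x <= b)%R -> (expR (- (t * b)))%:E * mu A <= lapl t A.
Proof.
move=> t0 mA h; rewrite -lapl0// {1}/lapl -ge0_integralZl_setT ?expR_ge0//;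
  try exact: measurable_lapl;
  try by move=> x; rewrite lee_fin mulr_ge0// ?expR_ge0// indicE.
apply: ge0_le_integral; first exact: measurableT.
- by move=> x _; rewrite -EFinM lee_fin !mulr_ge0// ?expR_ge0// indicE.
- by apply: measurable_funeM; exact: measurable_lapl.
- exact: measurable_lapl.
move=> x _; rewrite -EFinM lee_fin mul0r oppr0 expR0 mul1r indicE.
case: (boolP (x \in A)) => [|_]; last by rewrite !mulr0.
by rewrite inE => /h sx; rewrite !mulr1 ler_expR lerN2 ler_wpM2l.
Qed.

Variable e : X.
Hypothesis se : forall x tau, (s (tadd x (tscale tau e)) = s x + tau)%R.
Variables (G : set X) (mG : measurable G).
Hypothesis Ge : forall x tau, G (tadd x (tscale tau e)) <-> G x.

Definition slab (a b : R) : set X := G `&` [set x | a <= s x < b]%R.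

Lemma measurable_slab a b : measurable (slab a b).
Proof.
apply: measurableI => //; rewrite -[X in measurable X]setTI.
have -> : [set x | (a <= s x < b)%R] = s @^-1` `[a, b[%classic.
  by apply/seteqP; split=> x /=; rewrite in_itv.
exact: ms.
Qed.

Lemma lapl_slab_shift t a b : lapl t (slab a b) = (expR (- (t * a)))%:E * lapl t (slab 0 (b - a)).
Proof.
rewrite {1}/lapl -(@ge0_integral_tadd _ _ (tscale a e)).
- rewrite /lapl -ge0_integralZl_setT ?expR_ge0//.
  + apply: eq_integral => x _; rewrite -EFinM; congr EFin.
    rewrite mulrA -expRD se; congr (expR _ * _)%R; first by ring.
    rewrite !indicE; congr (_ %:R)%R; congr nat_of_bool.
    have E : slab a b (tadd x (tscale a e)) <-> slab 0 (b - a) x.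
      rewrite /slab /= se; split=> -[Gx sx]; split; try lra.
        by have [h _] := Ge x a; exact: h.
      by have [_ h] := Ge x a; exact: h.
    by apply/idP/idP; rewrite !inE => /E.
  + by apply: measurable_lapl; exact: measurable_slab.
- by apply: measurable_lapl; exact: measurable_slab.
- by move=> x; rewrite lee_fin mulr_ge0// ?expR_ge0// indicE.
Qed.

(** The [k] layers of thickness [w] are translates of the first one, and each step down multiplies
    the integral by [expR (- (t * w))]. *)
Lemma lapl_slabn t (w : R) k : (0 <= w)%R ->
  lapl t (slab 0 (k%:R * w)) = (\sum_(i < k) expR (- (t * w)) ^+ i)%:E * lapl t (slab 0 w).
Proof.
move=> w0; elim: k => [|k IH].
  rewrite big_ord0 mul0r mul0e /lapl.
  rewrite (_ : slab 0 0 = set0); first by under eq_integral do rewrite indic0 mulr0; rewrite integral0.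
  by apply/seteqP; split=> x //= -[_ /=]; lra.
have -> : slab 0 (k.+1%:R * w) = slab 0 (k%:R * w) `|` slab (k%:R * w) (k.+1%:R * w).
  have kw : (0 <= k%:R * w)%R by rewrite mulr_ge0.
  apply/seteqP; split=> x; rewrite /slab /= -natr1 mulrDl mul1r.
    by move=> [Gx sx]; case: (ltP (s x) (k%:R * w)%R) => h; [left|right]; split => //; lra.
  by move=> [] [Gx sx]; split=> //; lra.
rewrite lapl_setU; [|exact: measurable_slab|exact: measurable_slab|]; last first.
  by apply/seteqP; split=> x //; rewrite /slab /= => -[[_ h] [_ h']]; lra.
rewrite IH (lapl_slab_shift t (k%:R * w)%R) (_ : k.+1%:R * w - k%:R * w = w)%R; last by rewrite -natr1; ring.
rewrite big_ord_recr /= EFinD ge0_muleDl ?lee_fin ?exprn_ge0 ?expR_ge0//; last first.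
  by apply: sumr_ge0 => i _; rewrite exprn_ge0 ?expR_ge0.
congr (_ + _ * _); congr EFin; rewrite -expRM_natl; congr expR; ring.
Qed.

(** Cutting into [k] equal layers replaces Fubini along [e], which need not be a coordinate axis. In
    one layer the weight lies between [expR (- (t / k))] and 1 times its largest value; the
    geometric sum and the linear bounds on [expR] give a sandwich with relative error [t / k],
    closed by letting [k] grow. *)
Lemma lapl_slab1 t : (0 < t)%R -> mu (slab 0 1) < +oo ->
  t%:E * lapl t (slab 0 1) = (1 - expR (- t))%:E * mu (slab 0 1).
Proof.
move=> t0 fin; have m01 := measurable_slab 0 1.
have fN : mu (slab 0 1) \is a fin_num by rewrite ge0_fin_numE// measure_ge0.
have fW : lapl t (slab 0 1) \is a fin_num.
  rewrite ge0_fin_numE ?lapl_ge0//.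
  apply: le_lt_trans (lapl_ub (a := 0) (ltW t0) m01 _) _; first by move=> x [_ /= /andP[]].
  by rewrite mulr0 oppr0 expR0 mul1e.
set W := fine (lapl t (slab 0 1)); set N := fine (mu (slab 0 1)).
have W0 : (0 <= W)%R by rewrite fine_ge0// lapl_ge0.
have N0 : (0 <= N)%R by rewrite fine_ge0// measure_ge0.
have key k : (0 < k)%N -> (t * W * (1 - t / k%:R) <= N * (1 - expR (- t)))%R /\
   (N * (1 - expR (- t)) * (1 - t / k%:R) <= t * W)%R.
  move=> k0; have k0' : (0 < k%:R :> R)%R by rewrite ltr0n.
  set h : R := (k%:R^-1)%R; have h0 : (0 < h)%R by rewrite invr_gt0.
  have hk : (k%:R * h = 1)%R by rewrite mulfV// gt_eqF.
  have mh := measurable_slab 0 h.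
  have hle : (h <= 1)%R by rewrite /h invf_le1// ler1n.
  have sub : slab 0 h `<=` slab 0 1 by move=> x [Gx /= sx]; split => //=; lra.
  have fh : mu (slab 0 h) \is a fin_num.
    rewrite ge0_fin_numE ?measure_ge0//; apply: le_lt_trans fin.
    by apply: le_measure; rewrite ?inE.
  have fwh : lapl t (slab 0 h) \is a fin_num.
    rewrite ge0_fin_numE ?lapl_ge0//; apply: (@le_lt_trans _ _ (lapl t (slab 0 1))).
      exact: lapl_le.
    by rewrite -ge0_fin_numE ?lapl_ge0.
  have EN : (N = k%:R * fine (mu (slab 0 h)))%R.
    have := lapl_slabn 0 k (ltW h0); rewrite hk !lapl0// => E.
    rewrite /N E fineM//; congr (_ * _)%R; rewrite /=.
    rewrite (eq_bigr (fun=> 1%R)); first by rewrite sumr_const card_ord.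
    by move=> i _; rewrite mul0r oppr0 expR0 expr1n.
  set q := expR (- (t * h)).
  have EW : (W * (1 - q) = (1 - expR (- t)) * fine (lapl t (slab 0 h)))%R.
    have := lapl_slabn t k (ltW h0); rewrite hk => E.
    rewrite /W E fineM//= mulrAC; congr (_ * _)%R.
    rewrite mulrC -/q -[LHS]opprK -mulNr opprB -subrX1 opprB; congr (1 - _)%R.
    by rewrite -expRM_natl; congr expR; rewrite mulrN mulrCA hk mulr1.
  have u : (fine (lapl t (slab 0 h)) <= fine (mu (slab 0 h)))%R.
    apply: fine_le => //; apply: le_trans (lapl_ub (a := 0) (ltW t0) mh _) _.
      by move=> x [_ /= /andP[]].
    by rewrite mulr0 oppr0 expR0 mul1e.
  have l : (q * fine (mu (slab 0 h)) <= fine (lapl t (slab 0 h)))%R.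
    have -> : (q * fine (mu (slab 0 h)) = fine (q%:E * mu (slab 0 h)))%R by rewrite fineM.
    apply: fine_le => //; first by rewrite fin_numM.
    by apply: lapl_lb => //; [exact: ltW|move=> x [_ /= /andP[_ /ltW]]].
  have q1 : (1 - t * h <= q)%R by rewrite /q; exact: expR_ge1Dx.
  have q0 : (0 < q)%R by exact: expR_gt0.
  have q2 : (t * h * q <= 1 - q)%R.
    have a : ((1 + t * h) * q <= expR (t * h) * q)%R by rewrite ler_pM2r// expR_ge1Dx.
    have b : (expR (t * h) * q = 1)%R by rewrite /q -expRD subrr expR0.
    lra.
  have e0 : (0 <= 1 - expR (- t))%R.
    by rewrite subr_ge0 -expR0 ler_expR oppr_le0 ltW.
  have nh : (fine (mu (slab 0 h)) = N * h)%R by rewrite EN mulrC mulrA [(h * _)%R]mulrC hk mul1r.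
  rewrite -/h; split.
    rewrite -(ler_pM2r h0).
    have a1 : (t * W * (1 - t * h) * h <= t * W * q * h)%R.
      by rewrite ler_pM2r// ler_wpM2l// mulr_ge0// ltW.
    have a2 : (W * (t * h * q) <= W * (1 - q))%R by rewrite ler_wpM2l.
    have a3 : ((1 - expR (- t)) * fine (lapl t (slab 0 h)) <= (1 - expR (- t)) * (N * h))%R.
      by rewrite ler_wpM2l// -nh.
    by rewrite -EW in a3; lra.
  rewrite -(ler_pM2r h0).
  have a1 : (N * (1 - expR (- t)) * (1 - t * h) * h <= N * (1 - expR (- t)) * q * h)%R.
    by rewrite ler_pM2r// ler_wpM2l// mulr_ge0.
  have a2 : (W * (1 - q) <= W * (t * h))%R by rewrite ler_wpM2l//; lra.
  have a3 : ((1 - expR (- t)) * (q * (N * h)) <= (1 - expR (- t)) * fine (lapl t (slab 0 h)))%R.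
    by rewrite ler_wpM2l// -nh.
  by rewrite -EW in a3; lra.
have arch (A B : R) : (0 <= A)%R -> (forall k, (0 < k)%N -> A * (1 - t / k%:R) <= B)%R -> (A <= B)%R.
  move=> A0 hk; apply/ler_addgt0Pr => eps eps0.
  pose k := (Num.truncn (A * t / eps)).+1.
  have kR : (A * t / eps < k%:R)%R by exact: truncnS_gt.
  have k0 : (0 < k%:R :> R)%R by rewrite ltr0n.
  have := hk k isT; rewrite mulrBr mulr1 => h.
  have : (A * (t / k%:R) <= eps)%R.
    by rewrite mulrA ler_pdivrMr// ltW// -ltr_pdivrMl// mulrC.
  lra.
rewrite -(fineK fW) -(fineK fN) -!EFinM; congr EFin; apply/eqP; rewrite eq_le.
rewrite -/W -/N [((1 - _) * N)%R]mulrC; apply/andP; split; apply: arch.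
- by rewrite mulr_ge0// ltW.
- by move=> k k0; have [] := key k k0.
- by rewrite mulr_ge0// subr_ge0 -expR0 ler_expR oppr_le0 ltW.
- by move=> k k0; have [] := key k k0.
Qed.

End laplace_integral.

(** * The Voronoi cell near a facet *)

Section voronoi_laplace.
Context (R : realType) (N : nat) (L : set 'rV[R]_N) (K : nat).
Hypotheses (K0 : (0 < K)%N) (LK : forall l, L l -> integral_vec (K%:R *: l)).
Hypotheses (L0 : L 0) (LB : forall k l, L k -> L l -> L (k - l)).
Context (d : nat) (Q : 'M[R]_(d, N)).
Hypothesis (hQ : orthonormal_basis (linspan L) Q).
Local Notation T := (measurableTypeR R).
Local Notation X := (d.-tuple T).
Local Notation p := (from_coord Q).
Local Notation mu := (lebesgue_tuple R d).

Let QQ : Q *m Q^T = 1%:M. Proof. by case: hQ. Qed.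
Let LN l : L l -> L (- l). Proof. by move=> Ll; rewrite -sub0r; exact: LB. Qed.
Let LD k l : L k -> L l -> L (k + l).
Proof. by move=> Lk Ll; rewrite -[l]opprK; apply: LB => //; exact: LN. Qed.

Variable u : 'rV[R]_N.
Hypotheses (Lu : L u) (u0 : u != 0).
Hypothesis Vu : forall l, L l -> `|dot u l| <= dot l l.

Lemma linspan_mem l : L l -> linspan L l.
Proof.
move=> Ll; exists 1%N, l; split => [i|]; last exact: submx_refl.
by rewrite (_ : row i l = l)//; apply/rowP => j; rewrite mxE ord1.
Qed.

Let uu0 : 0 < dot u u. Proof. exact: dot_gt0. Qed.

Definition cell : set X := [set x | voronoi L (p x)].
(** Distances along [u] are measured in units of its length: the hyperplane of the facet of [u] has
    depth 0, the opposite one depth 1, the origin depth 1/2. *)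
Definition depth (x : X) : R := 2^-1 - dot (p x) u / dot u u.
Definition updir : X := coord Q u.
Definition downdir : X := coord Q (- u).

Lemma p_updir : p updir = u.
Proof. by apply: coordK => //; apply/hQ.2; exact: linspan_mem. Qed.

Lemma p_downdir : p downdir = - u.
Proof. by apply: coordK => //; apply/hQ.2; apply: linspan_mem; exact: LN. Qed.

Lemma measurable_depth : measurable_fun setT depth.
Proof.
apply: measurable_funB => //; apply: measurable_funM => //.
exact: measurable_dot_from_coord.
Qed.

Lemma depth_shift x tau : depth (tadd x (tscale tau downdir)) = depth x + tau.
Proof.
rewrite /depth from_coordD from_coordZ p_downdir dotDl dotZl dotNl.
by field; rewrite gt_eqF.
Qed.

Lemma measurable_cell : measurable cell.
Proof. exact: (measurable_voronoi K0 LK hQ). Qed.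

Lemma cell_depth x : cell x -> 0 <= depth x <= 1.
Proof.
move=> Vx; have := voronoi_dot_abs LN Vx Lu; rewrite -ler_pdivlMl// ler_norml.
move=> /andP[h1 h2]; rewrite /depth subr_ge0 ler_pdivrMr// h2/=.
have : - 2^-1 <= dot (p x) u / dot u u by rewrite ler_pdivlMr// mulNr.
by lra.
Qed.

Lemma cell_fin : (mu cell < +oo)%E.
Proof.
have [M M0 VM] := voronoi_bounded hQ LN.
apply: (@le_lt_trans _ _ (mu (tbox [tuple 0 | i < d] M))).
  apply: le_measure; rewrite ?inE//; [exact: measurable_cell|exact: measurable_tbox].
by rewrite lebesgue_tbox// ltry.
Qed.

(* [x] is moved along [u] to mid-height, contracted by [1 - r] and lifted to
   depth [r]; for [r = 0] this is the foot of [x] on the facet hyperplane. *)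
Definition retract (r : R) (x : X) : X :=
  tadd (tscale (1 - r) (tadd x (tscale (depth x - 2^-1) updir)))
    (tscale (2^-1 - r) updir).

(** A union of lines parallel to [u], because [retract r] forgets the component along [u]; for
    [r = 0] these are the lines through the facet. *)
Definition prism r : set X := retract r @^-1` cell.

Lemma p_retract r x : p (retract r x) =
  (1 - r) *: p x + ((1 - r) * (depth x - 2^-1) + (2^-1 - r)) *: u.
Proof.
rewrite !(from_coordD, from_coordZ) p_updir scalerDr scalerA.
by rewrite [in RHS](scalerDl u) addrA.
Qed.

Lemma measurable_prism r : measurable (prism r).
Proof.
rewrite -[X in measurable X]setTI.
have m : measurable_fun setT (retract r); last exact: (m measurableT _ measurable_cell).
apply: measurable_mktuple => i; apply: measurable_funD => //.
rewrite (_ : (fun x => _) = fun x : X => (1 - r) * (tnth x i + (depth x - 2^-1) * tnth updir i)).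
  apply: measurable_funM => //; apply: measurable_funD; first exact: measurable_tnth.
  apply: measurable_funM => //; apply: measurable_funB => //; exact: measurable_depth.
by apply/funext => x; rewrite !tnth_mktuple.
Qed.

Lemma prism_shift r x tau : prism r (tadd x (tscale tau downdir)) <-> prism r x.
Proof.
rewrite /prism /cell /=.
suff -> : p (retract r (tadd x (tscale tau downdir))) = p (retract r x) by [].
rewrite !p_retract depth_shift from_coordD from_coordZ p_downdir.
by apply/rowP => i; rewrite !mxE; ring.
Qed.

(** Convexity: the retracted point is [(1 - r) *: p x + k *: u] with [k] between [- r / 2] and
    [r / 2], a convex combination of [p x] and a point of the segment from [- u / 2] to [u / 2],
    which lies in the cell by [Vu]. *)
Lemma cell_prism r x : 0 < r < 1 -> cell x -> depth x <= r -> prism r x.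
Proof.
move=> /andP[r0 r1] Vx xr; have /andP[x0 x1] := cell_depth Vx.
apply/(voronoi_coordP hQ) => l Ll; rewrite p_retract dotDl !dotZl.
have h1 := (voronoi_coordP hQ x).1 Vx l Ll.
have := Vu Ll; rewrite ler_norml => /andP[h2 h3].
set k := (1 - r) * (depth x - 2^-1) + (2^-1 - r).
have kE : k = depth x * (1 - r) - r / 2 by rewrite /k; field.
have k1 : - (r / 2) <= k by rewrite kE lerBrDr addrC subrr mulr_ge0//; lra.
have k2 : k <= r / 2 by rewrite kE; nra.
have : 2 * (k * dot u l) <= r * dot l l.
  have : `|k * dot u l| <= r / 2 * dot l l.
    by rewrite normrM ler_pM// ?ler_norml ?k1 ?k2 ?h2 ?h3.
  by move=> /ler_normlW; lra.
have : (1 - r) * (2 * dot (p x) l) <= (1 - r) * dot l l by rewrite ler_wpM2l//; lra.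
lra.
Qed.

Lemma retract0_dot x : dot (p (retract 0 x)) u = dot u u / 2.
Proof.
rewrite p_retract dotDl !dotZl /depth; field; by rewrite gt_eqF.
Qed.

(** If [f] is the foot of [x] on the facet, then [f - u] lies in the opposite facet: its condition
    for [l] is that of [f] for [l + u]. The point [x] divides the segment from [f] to [f - u] in the
    ratio given by its depth. *)
Lemma prism_cell x : prism 0 x -> 0 <= depth x <= 1 -> cell x.
Proof.
move=> Px /andP[x0 x1]; apply/(voronoi_coordP hQ) => l Ll.
have h1 := (voronoi_coordP hQ _).1 Px l Ll.
have h2 := (voronoi_coordP hQ _).1 Px (l + u) (LD Ll Lu).
have h3 := retract0_dot x.
move: h1 h2 h3; set f := retract 0 x => h1 h2 h3.
have fE : p x = p f - depth x *: u.
  by apply/rowP => i; rewrite /f p_retract !mxE; ring.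
move: h2; rewrite fE dotBl dotZl !(dotDl, dotDr) (dotC u l) => h2.
have h4 : 2 * dot (p f) l <= dot l l + 2 * dot l u by lra.
have : (1 - depth x) * (2 * dot (p f) l) <= (1 - depth x) * dot l l by rewrite ler_wpM2l//; lra.
have : depth x * (2 * dot (p f) l) <= depth x * (dot l l + 2 * dot l u) by rewrite ler_wpM2l.
lra.
Qed.

(** For [r <= 1/2] the contraction factor [1 - r] is at least 1/2, so one box serves all these
    [r]. *)
Lemma prism_bounded : exists2 M : R, 0 <= M & forall r, 0 <= r <= 2^-1 ->
  slab depth (prism r) 0 1 `<=` tbox [tuple 0 | i < d] M.
Proof.
have [M M0 VM] := voronoi_bounded hQ LN.
pose U := \sum_i `|tnth updir i|.
have U0 : 0 <= U by apply: sumr_ge0.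
have Ui i : `|tnth updir i| <= U by rewrite /U (bigD1 i)//= lerDl sumr_ge0.
exists (2 * M + 2 * U); first by rewrite addr_ge0// mulr_ge0.
move=> r /andP[r0 r1] x [/VM Px /= /andP[x0 x1]] i; rewrite tnth_mktuple subr0.
have := Px i; set z := tnth (retract r x) i; rewrite tnth_mktuple subr0.
move: (Ui i).
have : z = (1 - r) * (tnth x i + (depth x - 2^-1) * tnth updir i) +
    (2^-1 - r) * tnth updir i by rewrite /z !tnth_mktuple.
set y := tnth x i; set a := tnth updir i => zE aU zM.
have yE : (1 - r) * y = z - ((1 - r) * (depth x - 2^-1) + (2^-1 - r)) * a by rewrite zE; ring.
have h : `|(1 - r) * y| <= M + U.
  rewrite yE (le_trans (ler_normB _ _))// lerD// normrM -[leRHS]mul1r ler_pM//.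
  by rewrite ler_norml; apply/andP; split; nra.
rewrite normrM ger0_norm in h; last lra.
have : `|y| / 2 <= (1 - r) * `|y| by rewrite mulrC ler_wpM2r//; lra.
lra.
Qed.

Lemma prism_fin r : 0 <= r <= 2^-1 -> (mu (slab depth (prism r) 0 1) < +oo)%E.
Proof.
move=> hr; have [M M0 h] := prism_bounded.
apply: (@le_lt_trans _ _ (mu (tbox [tuple 0 | i < d] M))).
  apply: le_measure; rewrite ?inE//; [|exact: measurable_tbox|exact: h].
  exact: (measurable_slab measurable_depth (measurable_prism r)).
by rewrite lebesgue_tbox// ltry.
Qed.

Lemma tbox_dot_small (del : R) : 0 < del -> exists2 r : R, 0 < r &
  forall a x : X, tbox a r x -> dot (p x - p a) (p x - p a) <= del.
Proof.
move=> del0; exists (Num.min 1 (del / d.+1%:R)).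
  by rewrite lt_min ltr01 divr_gt0.
set r := Num.min _ _ => a x ax.
have r0 : 0 <= r by rewrite le_min ler01 divr_ge0// ltW.
have r1 : r <= 1 by rewrite ge_min lexx.
have rd : r * d.+1%:R <= del by rewrite -ler_pdivlMr// ge_min lexx orbT.
rewrite -(from_coordB Q) dot_from_coord//.
apply: (@le_trans _ _ (\sum_(i < d) r)).
  apply: ler_sum => i _; rewrite tnth_mktuple -expr2 -real_normK ?num_real//.
  have := ax i; set z := `|_| => zr; have z0 : 0 <= z by exact: normr_ge0.
  nra.
by rewrite sumr_const card_ord -mulr_natr (le_trans _ rd)// ler_wpM2l// ler_nat leqnSn.
Qed.

Lemma lattice_norm l : L l -> l != 0 -> 1 <= K%:R ^+ 2 * dot l l.
Proof.
move=> Ll l0; have [i li] : exists i, l 0 i != 0.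
  apply: contrapT => h; move/eqP: l0; apply; apply/rowP => i; rewrite mxE.
  by apply/eqP/negPn/negP => li; apply: h; exists i.
have KR : 0 < K%:R :> R by rewrite ltr0n.
have Ki : K%:R * l 0 i \is a Num.int by have := LK Ll i; rewrite mxE.
have : 1 <= `|K%:R * l 0 i| by rewrite norm_intr_ge1// mulf_neq0// gt_eqF.
move=> h; have : 1 <= `|K%:R * l 0 i| ^+ 2 by rewrite exprn_ege1.
rewrite real_normK ?num_real// exprMn => h'; apply: (le_trans h').
rewrite ler_wpM2l ?sqr_ge0// /dot (bigD1 i)//= -expr2 lerDl.
by apply: sumr_ge0 => j _; rewrite -expr2 sqr_ge0.
Qed.

(** Nonzero lattice vectors have length at least [1 / K], so the ball of radius [1 / (2 K)] around 0
    lies in the cell. *)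
Lemma cell_ball : exists2 del : R, 0 < del &
  forall b, linspan L b -> dot b b <= del -> voronoi L b.
Proof.
have KR : 0 < K%:R :> R by rewrite ltr0n.
exists ((K%:R ^+ 2)^-1 / 4); first by rewrite divr_gt0// invr_gt0 exprn_gt0.
move=> b Eb bd; apply/voronoiP; split=> // l Ll.
have [->|l0] := eqVneq l 0; first by rewrite !dot0r mulr0.
have l1 := lattice_norm Ll l0; have ll := dot_gt0 l0.
have K2 : 0 < K%:R ^+ 2 :> R by rewrite exprn_gt0.
have bl : 4 * dot b b <= dot l l.
  rewrite -(ler_pM2l K2) (le_trans _ l1)//.
  apply: (@le_trans _ _ (K%:R ^+ 2 * (4 * ((K%:R ^+ 2)^-1 / 4)))).
    by rewrite ler_pM2l// ler_pM2l.
  by rewrite le_eqVlt; apply/orP; left; apply/eqP; field; rewrite gt_eqF.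
have := dot_CS b l => cs.
have : (2 * dot b l) ^+ 2 <= dot l l ^+ 2.
  by rewrite exprMn (le_trans (ler_wpM2l _ cs))//; nra.
move=> h; rewrite leNgt; apply/negP => lt; nra.
Qed.

Variables (v q : 'rV[R]_N).
Hypotheses (Lv : L v) (Vq : voronoi L q).
Hypotheses (qu : 2 * dot q u = dot u u) (qv : 2 * dot q v = dot v v).
Hypotheses (uv0 : 0 < dot u v) (uvu : dot u v < dot u u).

(* The part of the cell that sticks out of the prism over the facet. *)
Definition cap (e : R) : set X := (cell `\` prism 0) `&` [set x | depth x < e].

Lemma measurable_cap e : measurable (cap e).
Proof.
apply: measurableI.
  by apply: measurableD; [exact: measurable_cell | exact: measurable_prism].
rewrite -[X in measurable X]setTI; apply: measurable_fun_ltr => //.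
exact: measurable_depth.
Qed.

(** Starting at [q] on both facets, a short step towards [q' = v - q] stays in the facet of [v] and
    leaves the prism. A little of a ball around 0 is mixed in to obtain a set of positive measure
    inside the cell. *)
Lemma cap_pos e : 0 < e -> (0 < mu (cap e))%E.
Proof.
move=> e0; have [del del0 ball] := cell_ball.
have qu' := qu; have qv' := qv; have uvu' := uvu; have uv0' := uv0.
have [ka kaE] : exists ka : R, ka = dot u v / dot u u by eexists.
(* [g x] is the excess [dot f v - dot v v / 2] for the foot [f] of [x] on the hyperplane of the
   facet of [u]. If it is positive, the foot is outside the cell and [x] outside the prism. *)
pose g x := dot x v - ka * dot x u + (dot u v - dot v v) / 2.
have uun : dot u u != 0 by rewrite gt_eqF.
have ka0 : 0 < ka by rewrite kaE divr_gt0.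
have ka1 : ka < 1 by rewrite kaE ltr_pdivrMr// mul1r.
have kau : ka * dot u u = dot u v by rewrite kaE divfK.
have gq : g q = 0.
  rewrite /g; have : ka * (2 * dot q u) = dot u v by rewrite qu.
  by move=> hh; lra.
(* [q'] is the mirror image of [q] in the centre [v / 2] of the facet of [v]. Positivity of [gam] is
   where both bounds on [dot u v] enter. *)
pose q' := v - q; pose gam := dot u v * (1 - ka).
have gam0 : 0 < gam by rewrite mulr_gt0// subr_gt0.
have gq' : g q' = gam.
  rewrite /g /q' !dotBl (dotC v u) /gam.
  have : ka * (2 * dot q u) = dot u v by rewrite qu.
  by lra.
have Eq : linspan L q by case/voronoiP : Vq.
have Vq' : voronoi L q'.
  apply/voronoiP; split.
    apply/hQ.2/addmx_sub; first by apply/hQ.2; exact: linspan_mem.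
    by rewrite eqmx_opp; exact/hQ.2.
  move=> l Ll; have := (voronoiP _ _).1 Vq => -[_ /(_ _ (LB Lv Ll))].
  rewrite /q' !(dotBl, dotBr) (dotC l v); lra.
pose Gam := dot v v + dot u v.
have Gam0 : 0 < Gam by rewrite ltr_wpDl ?dot_ge0.
have gb b : voronoi L b -> - Gam <= g b.
  move=> Vb; have := voronoi_dot_abs LN Vb Lu; have := voronoi_dot_abs LN Vb Lv.
  rewrite -!ler_pdivlMl// !ler_norml => /andP[b1 b2] /andP[b3 b4].
  have : ka * dot b u <= ka * (2^-1 * dot u u) by rewrite ler_wpM2l// ltW.
  rewrite /g /Gam; lra.
(* With this share of the ball, whose points satisfy [g >= - Gam], the value
   [(1 - eta) * gam + eta * g b] is still at least [gam / 2]. The step length [th] then bounds the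
   depth, as [q] has depth 0 and the other two points depth at most 1. *)
pose eta := gam / (2 * (gam + Gam)).
have gG : 0 < gam + Gam by rewrite addr_gt0.
have eta0 : 0 < eta by rewrite divr_gt0// mulr_gt0.
have etaE : eta * (gam + Gam) = gam / 2.
  by rewrite /eta; field; rewrite gt_eqF.
have eta1 : eta < 1 by rewrite ltr_pdivrMr ?mulr_gt0//; lra.
pose th := Num.min (e / 2) (2^-1).
have th0 : 0 < th.
  by rewrite /th lt_min divr_gt0//= invr_gt0 ltr0n.
have the : th < e.
  by rewrite /th gt_min ltr_pdivrMr// ltr_pMr// ltr1n.
have th1 : th < 1.
  by rewrite /th gt_min; apply/orP; right; lra.
pose z := (1 - th) *: q + (th * (1 - eta)) *: q'.
have Ez : linspan L z.
  apply/hQ.2/addmx_sub; apply/scalemx_sub/hQ.2 => //.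
  by case/voronoiP : Vq'.
have te0 : 0 < th * eta by rewrite mulr_gt0.
have [r r0 rbox] := tbox_dot_small (mulr_gt0 (mulr_gt0 te0 te0) del0).
have pz : p (coord Q z) = z by apply: coordK => //; exact/hQ.2.
apply: (@lt_le_trans _ _ (mu (tbox (coord Q z) r))).
  by rewrite lebesgue_tbox ?ltW// lte_fin exprn_gt0// mulrn_wgt0.
apply: le_measure; rewrite ?inE; [exact: measurable_tbox|exact: measurable_cap|].
move=> x /rbox; rewrite pz => xz.
pose b := (th * eta)^-1 *: (p x - z).
have Vb : voronoi L b.
  apply: ball.
    apply/hQ.2/scalemx_sub/addmx_sub; first exact: from_coord_sub.
    by rewrite eqmx_opp; exact/hQ.2.
  have te2 : 0 < th * eta * (th * eta) by exact: mulr_gt0.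
  rewrite dotZl dotZr mulrA -invfM [leLHS]mulrC (ler_pdivrMr _ _ te2).
  by rewrite [leRHS]mulrC.
have xE : p x = (1 - th) *: q + (th * (1 - eta)) *: q' + (th * eta) *: b.
  by rewrite /b scalerA mulfV ?gt_eqF// scale1r -/z addrC subrK.
have Dx y : dot (p x) y = (1 - th) * dot q y + th * (1 - eta) * dot q' y + th * eta * dot b y.
  by rewrite xE !(dotDl, dotZl).
have w1 : 0 <= 1 - th by lra.
have w2 : 0 <= th * (1 - eta) by rewrite mulr_ge0//; lra.
have w3 : 0 <= th * eta by exact: ltW.
have : cell x /\ ~ prism 0 x /\ depth x < e; last by case=> ? [? ?]; split.
split; last split.
- apply/(voronoi_coordP hQ) => l Ll; rewrite Dx.
  have h1 := ((voronoiP _ _).1 Vq).2 l Ll.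
  have h2 := ((voronoiP _ _).1 Vq').2 l Ll.
  have h3 := ((voronoiP _ _).1 Vb).2 l Ll.
  have k1 := ler_wpM2l w1 h1; have k2 := ler_wpM2l w2 h2; have k3 := ler_wpM2l w3 h3.
  lra.
- move=> Px; have := (voronoi_coordP hQ _).1 Px v Lv.
  rewrite p_retract dotDl !dotZl.
  have gx : g (p x) = (1 - th) * g q + th * (1 - eta) * g q' + th * eta * g b.
    by rewrite /g !Dx; ring.
  have : g (p x) <= 0 -> False.
    rewrite gx gq gq' mulr0 add0r; have hb := ler_wpM2l w3 (gb b Vb).
    have : 0 < th * (gam / 2) by rewrite mulr_gt0// divr_gt0.
    have : th * (eta * (gam + Gam)) = th * (gam / 2) by rewrite etaE.
    lra.
  move=> H h; apply: H; rewrite /g; move: h; rewrite /depth.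
  have -> : (1 - 0) * (2^-1 - dot (p x) u / dot u u - 2^-1) + (2^-1 - 0) =
    2^-1 - dot (p x) u / dot u u by ring.
  have -> : ka * dot (p x) u = dot (p x) u / dot u u * dot u v by rewrite kaE; ring.
  lra.
- have h1 := voronoi_dot_abs LN Vq' Lu.
  have h2 := voronoi_dot_abs LN Vb Lu.
  rewrite -ler_pdivlMl// ler_norml in h1; rewrite -ler_pdivlMl// ler_norml in h2.
  have /andP[h3 _] := h1; have /andP[h4 _] := h2.
  apply: le_lt_trans the; rewrite /depth lerBlDr -lerBlDl ler_pdivlMr// Dx.
  have k2 := ler_wpM2l w2 h3; have k3 := ler_wpM2l w3 h4.
  have k1 : (1 - th) * (2 * dot q u) = (1 - th) * dot u u by rewrite qu.
  have := ltW uu0; nra.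
Qed.

Variable facet_radius : R.
Hypothesis facet_radius_gt0 : 0 < facet_radius.
Hypothesis facet : forall y, linspan L y -> dot y u = 0 -> dot y y <= facet_radius ->
  voronoi L (2^-1 *: u + y).

Local Notation S r := (slab depth (prism r) 0 1).

Let mS r : measurable (S r).
Proof. exact: (measurable_slab measurable_depth (measurable_prism r)). Qed.

(** Points near 0 have their foot near [u / 2], inside the disc that [facet] provides. *)
Lemma prism0_pos : (0 < mu (S 0))%E.
Proof.
have uu := uu0; have fr := facet_radius_gt0.
(* Any fraction below 1/4 of [dot u u] makes Cauchy-Schwarz give [|dot (p x) u| < dot u u / 2], that
   is, a depth strictly between 0 and 1. *)
pose del := Num.min facet_radius (dot u u / 5).
have del0 : 0 < del by rewrite /del lt_min fr divr_gt0.
have del1 : del <= facet_radius by rewrite /del ge_min lexx.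
have del2 : del <= dot u u / 5 by rewrite /del ge_min lexx orbT.
have [r r0 rbox] := tbox_dot_small del0.
have p0 : p (coord Q 0) = 0 by apply: coordK => //; exact: sub0mx.
apply: (@lt_le_trans _ _ (mu (tbox (coord Q 0) r))).
  by rewrite lebesgue_tbox ?ltW// lte_fin exprn_gt0// mulrn_wgt0.
apply: le_measure; rewrite ?inE; [exact: measurable_tbox|exact: mS|].
move=> x /rbox; rewrite p0 subr0 => px.
have cs := dot_CS (p x) u.
have b1 : `|dot (p x) u| < 2^-1 * dot u u.
  rewrite ltNge; apply/negP => h.
  have : (2^-1 * dot u u) ^+ 2 <= `|dot (p x) u| ^+ 2 by rewrite ler_sqr ?nnegrE ?mulr_ge0// ltW.
  by rewrite real_normK ?num_real//; nra.
have /andP[b2 b3] : - (2^-1 * dot u u) < dot (p x) u < 2^-1 * dot u u by rewrite -ltr_norml.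
split; last first.
  rewrite /= /depth; apply/andP; split.
    by rewrite subr_ge0 ler_pdivrMr// ltW.
  rewrite ltrBlDr -ltrBlDl ltr_pdivlMr//; lra.
pose k := dot (p x) u / dot u u.
rewrite /prism /cell /=; pose y := p x - k *: u.
have -> : p (retract 0 x) = 2^-1 *: u + y.
  by rewrite p_retract /depth -/k /y; apply/rowP => i; rewrite !mxE; ring.
have yu : dot y u = 0.
  by rewrite /y dotBl dotZl /k divfK ?subrr// gt_eqF.
apply: facet => //.
  apply/hQ.2/addmx_sub; first exact: from_coord_sub.
  by rewrite eqmx_opp scalemx_sub//; apply/hQ.2; exact: linspan_mem.
apply: le_trans del1; apply: le_trans px.
rewrite /y in yu *; rewrite dotBr dotZr yu mulr0 subr0 dotBl dotZl lerBlDr lerDl (dotC u).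
rewrite /k mulrAC -expr2 divr_ge0// ?sqr_ge0//; exact: ltW.
Qed.

Definition slabvol : R := fine (mu (S 0)).
Definition lapcell (t : R) : R := t * fine (lapl depth t cell).

Let half0 : 0 <= (0 : R) <= 2^-1. Proof. by rewrite lexx invr_ge0/=. Qed.

Lemma slabvol_gt0 : 0 < slabvol.
Proof.
by apply: fine_gt0; rewrite prism0_pos; exact: prism_fin.
Qed.

Lemma lapl_cell_fin t A : 0 <= t -> measurable A -> A `<=` cell -> lapl depth t A \is a fin_num.
Proof.
move=> t0 mA AV; rewrite ge0_fin_numE ?lapl_ge0//.
apply: le_lt_trans (lapl_ub measurable_depth (a := 0) t0 mA _) _.
  by move=> x /AV/cell_depth/andP[].
rewrite mulr0 oppr0 expR0 mul1e; apply: le_lt_trans cell_fin.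
by apply: le_measure; rewrite ?inE//; exact: measurable_cell.
Qed.

Lemma prism_cellS : S 0 `<=` cell.
Proof. by move=> x [Px /= /andP[x0 x1]]; apply: prism_cell => //; rewrite x0 ltW. Qed.

Lemma lapl_slab1_fine r t : 0 <= r <= 2^-1 -> 0 < t ->
  t * fine (lapl depth t (S r)) = (1 - expR (- t)) * fine (mu (S r)).
Proof.
move=> hr t0; have := lapl_slab1 measurable_depth depth_shift (measurable_prism r)
  (prism_shift r) t0 (prism_fin hr).
move=> /(congr1 fine); rewrite !fineM//.
- by rewrite ge0_fin_numE ?measure_ge0//; exact: prism_fin.
- rewrite ge0_fin_numE ?lapl_ge0//.
  apply: le_lt_trans (lapl_ub measurable_depth (a := 0) (ltW t0) (mS r) _) _.
    by move=> x [_ /= /andP[]].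
  by rewrite mulr0 oppr0 expR0 mul1e; exact: prism_fin.
Qed.

Lemma lapcell_low e : 0 < e -> exists2 rho : R, 0 < rho & forall t, 0 < t ->
  slabvol * (1 - expR (- t)) + t * rho * expR (- (e * t)) <= lapcell t.
Proof.
move=> e0; have mC := measurable_cap e; have mc := measurable_cell.
have CV : cap e `<=` cell by move=> x [[]].
have fC : mu (cap e) \is a fin_num.
  rewrite ge0_fin_numE ?measure_ge0//; apply: le_lt_trans cell_fin.
  by apply: le_measure; rewrite ?inE.
exists (fine (mu (cap e))).
  by apply: fine_gt0; rewrite cap_pos//= -ge0_fin_numE.
move=> t t0; have t0' := ltW t0.
have fS := lapl_cell_fin t0' (mS 0) prism_cellS.
have fCl := lapl_cell_fin t0' mC CV.
have fV := lapl_cell_fin t0' mc (@subset_refl _ _).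
have le1 : fine (lapl depth t (S 0)) + fine (lapl depth t (cap e)) <= fine (lapl depth t cell).
  rewrite -fineD//; apply: fine_le => //; first by rewrite fin_numD fS.
  rewrite -lapl_setU//; first 1 last.
  - exact: measurable_depth.
  - by apply/seteqP; split => x //= -[[Px _] [[_ nPx] _]].
  apply: lapl_le => //; first exact: measurable_depth.
  - exact: measurableU.
  - by move=> x [/prism_cellS|/CV].
have le2 : expR (- (t * e)) * fine (mu (cap e)) <= fine (lapl depth t (cap e)).
  have -> : expR (- (t * e)) * fine (mu (cap e)) = fine ((expR (- (t * e)))%:E * mu (cap e)).
    by rewrite fineM.
  apply: fine_le => //; first by rewrite fin_numM.
  by apply: lapl_lb => //; [exact: measurable_depth | move=> x [_ /= /ltW]].
have := lapl_slab1_fine half0 t0; rewrite -/slabvol [(_ * slabvol)]mulrC => <-.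
rewrite /lapcell -mulrA -mulrDr ler_pM2l// (le_trans _ le1)// lerD2l.
by rewrite mulrC [e * t]mulrC.
Qed.

(** The conditions defining the prism are closed and affine in [r], so a point lying in prisms for
    arbitrarily small [r] lies in the one for [r = 0]. Continuity from above is applied to tail
    unions, which are nested by construction. *)
Lemma prism_volume_limit eps : 0 < eps -> exists2 r : R, 0 < r <= 2^-1 &
  fine (mu (S r)) <= slabvol + eps.
Proof.
move=> eps0; pose r (j : nat) : R := j.+2%:R^-1.
have r0 j : 0 < r j by rewrite invr_gt0.
have r1 j : r j <= 2^-1 by rewrite lef_pV2 ?posrE// ler_nat.
have rr j : 0 <= r j <= 2^-1 by rewrite ltW// r1.
pose E k := \bigcup_(j in [set j | (k <= j)%N]) S (r j).
have mE k : measurable (E k) by apply: bigcup_measurable => j _; exact: mS.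
have [M M0 hM] := prism_bounded.
have EM k : E k `<=` tbox [tuple 0 | i < d] M by move=> x [j _]; exact: hM.
have finE A : measurable A -> A `<=` tbox [tuple 0 | i < d] M -> (mu A < +oo)%E.
  move=> mA AM; apply: (@le_lt_trans _ _ (mu (tbox [tuple 0 | i < d] M))).
    by apply: le_measure; rewrite ?inE//; exact: measurable_tbox.
  by rewrite lebesgue_tbox// ltry.
have capE : \bigcap_n E n `<=` S 0.
  move=> x Ex; have [j _ [_ sx]] := Ex 0%N I; split=> //.
  apply/(voronoi_coordP hQ) => l Ll; apply/ler_addgt0Pr => e e0.
  pose A := 2 * dot (p (retract 0 x)) l; pose B := 2 * dot (p (retract 1 x)) l.
  have AB s : 2 * dot (p (retract s x)) l = A + (B - A) * s.
    rewrite /A /B !p_retract !dotDl !dotZl; ring.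
  have [k [_ hk]] : exists k, True /\ `|B - A| / e < k%:R.
    by exists (Num.truncn (`|B - A| / e)).+1; split=> //; exact: truncnS_gt.
  have [i /= ki [Pi _]] := Ex k I.
  have := (voronoi_coordP hQ _).1 Pi l Ll; rewrite AB => h.
  have : `|B - A| * r i <= e.
    rewrite /r ler_pdivrMr// mulrC -ler_pdivrMr// ltW// (lt_le_trans hk)//.
    by rewrite ler_nat (leq_trans ki)// -addn2 leq_addr.
  have : - ((B - A) * r i) <= `|B - A| * r i.
    by rewrite -mulNr ler_wpM2r ?(ltW (r0 i))// -normrN ler_norm.
  rewrite -/A; lra.
have mI : measurable (\bigcap_n E n) by apply: bigcap_measurableType => n _.
have cvgE : mu \o E @ \oo --> mu (\bigcap_n E n).
  apply: nonincreasing_cvg_mu => //; first by apply: finE.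
  apply/nonincreasing_seqP => n; apply/subsetPset => x [j /= nj Sx].
  by exists j => //=; exact: ltnW.
have fS0 : mu (S 0) \is a fin_num.
  by rewrite ge0_fin_numE ?measure_ge0//; exact: prism_fin.
have [k hk] : exists k, (mu (E k) <= (slabvol + eps)%:E)%E.
  apply: contrapT => hn.
  have : ((slabvol + eps)%:E <= mu (\bigcap_n E n))%E.
    apply: (cvge_to_ge cvgE); near=> n; rewrite leNgt; apply/negP => h.
    by apply: hn; exists n; exact: ltW.
  apply/negP; rewrite -ltNge; apply: (@le_lt_trans _ _ (mu (S 0))).
    by apply: le_measure; rewrite ?inE//; exact: mS.
  by rewrite -(fineK fS0) lte_fin ltrDl.
exists (r k); first by rewrite r0 r1.
have fSk : mu (S (r k)) \is a fin_num.
  by rewrite ge0_fin_numE ?measure_ge0//; exact: prism_fin.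
rewrite -lee_fin fineK//; apply: le_trans hk.
apply: le_measure; rewrite ?inE; [exact: mS|exact: mE|].
by move=> x Sx; exists k => /=.
Unshelve. all: by end_near. Qed.

Lemma lapcell_limit : lapcell t @[t --> +oo] --> slabvol.
Proof.
have N0 := slabvol_gt0; have mc := measurable_cell; have md := measurable_depth.
apply/cvgrPdist_le => eps eps0.
have e2 : 0 < eps / 2 by rewrite divr_gt0.
have [r /andP[r0 r1] hr] := prism_volume_limit e2.
have hr' : 0 <= r <= 2^-1 by rewrite ltW.
have [rho rho0 hrho] := lapcell_low ltr01.
pose MV := fine (mu cell).
have MV0 : 0 <= MV by rewrite fine_ge0// measure_ge0.
have fc : mu cell \is a fin_num by rewrite ge0_fin_numE ?measure_ge0//; exact: cell_fin.
have c1 : 0 < eps / slabvol by rewrite divr_gt0.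
have [T1 _ hT1] := expRN_small ltr01 c1.
have r2 : 0 < r / 2 by rewrite divr_gt0.
have c2 : 0 < (eps / 2) / ((r / 2)^-1 * (MV + 1)).
  by rewrite divr_gt0// mulr_gt0 ?invr_gt0// ltr_wpDl.
have [T2 _ hT2] := expRN_small r2 c2.
near=> t.
have t0 : 0 < t by near: t; exact: nbhs_pinfty_gt.
have tT1 : T1 <= t by near: t; apply: nbhs_pinfty_ge; exact: num_real.
have tT2 : T2 <= t by near: t; apply: nbhs_pinfty_ge; exact: num_real.
have low : slabvol - eps <= lapcell t.
  have := hrho t t0; have := hT1 t tT1; rewrite mul1r ler_pdivlMr// => h1.
  have : 0 <= t * rho * expR (- t) by rewrite !mulr_ge0 ?expR_ge0// ltW.
  lra.
have up : lapcell t <= slabvol + eps.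
  (* The part of the cell up to depth [r] lies in the slightly wider prism [S r]; the deeper part
     carries the weight [expR (- (t * r))] at most. *)
  pose D := cell `&` [set x | r < depth x].
  have mD : measurable D.
    apply: measurableI => //; rewrite -[X in measurable X]setTI.
    exact: measurable_fun_ltr.
  have DV : D `<=` cell by move=> x [].
  have fD := lapl_cell_fin (ltW t0) mD DV.
  have fS : lapl depth t (S r) \is a fin_num.
    rewrite ge0_fin_numE ?lapl_ge0//.
    apply: le_lt_trans (lapl_ub md (a := 0) (ltW t0) (mS r) _) _.
      by move=> x [_ /= /andP[]].
    by rewrite mulr0 oppr0 expR0 mul1e; exact: prism_fin.
  have sub : fine (lapl depth t cell) <= fine (lapl depth t (S r)) + fine (lapl depth t D).
    rewrite -fineD//; apply: fine_le.
    - exact: lapl_cell_fin (ltW t0) mc (@subset_refl _ _).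
    - by rewrite fin_numD fS.
    apply: (@le_trans _ _ (lapl depth t (S r) + lapl depth t (D `\` S r))%E); last first.
      by rewrite leeD2l// lapl_le//; exact: measurableD.
    rewrite -lapl_setU//; [|exact: measurableD|]; last first.
      by apply/seteqP; split => x //= -[Sx [_ nSx]].
    apply: lapl_le => //; first by apply: measurableU => //; exact: measurableD.
    move=> x Vx; have /andP[x0 x1] := cell_depth Vx.
    have [Sx|nSx] := pselect (S r x); [by left|right; split => //; split => //=].
    rewrite ltNge; apply/negP => xr; apply: nSx; split.
      by apply: cell_prism => //; rewrite r0; lra.
    by rewrite /= x0/=; lra.
  have ub : fine (lapl depth t D) <= expR (- (t * r)) * MV.
    have -> : expR (- (t * r)) * MV = fine ((expR (- (t * r)))%:E * mu cell) by rewrite fineM.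
    apply: fine_le => //; first by rewrite fin_numM.
    apply: le_trans (lapl_ub md (a := r) (ltW t0) mD _) _; first by move=> x [_ /= /ltW].
    rewrite lee_pmul2l ?lte_fin ?expR_gt0//.
    by apply: le_measure; rewrite ?inE.
  have s1 := lapl_slab1_fine hr' t0.
  have vol0 : 0 <= fine (mu (S r)) by rewrite fine_ge0// measure_ge0.
  have s2 : t * fine (lapl depth t (S r)) <= fine (mu (S r)).
    by rewrite s1 ler_piMl// lerBlDr lerDl expR_ge0.
  (* The exponential is split into two equal factors: one absorbs [t], the other is made small. *)
  have s3 : t * (expR (- (t * r)) * MV) <= eps / 2.
    have E : expR (- (t * r)) = expR (- (r / 2 * t)) * expR (- (r / 2 * t)).
      by rewrite -expRD; congr expR; field.
    have h1 : t * expR (- (r / 2 * t)) <= (r / 2)^-1.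
      rewrite -[(r / 2)^-1]mulr1 ler_pdivlMl// mulrA.
      have a : r / 2 * t <= expR (r / 2 * t).
        by apply: le_trans (expR_ge1Dx _); rewrite lerDr.
      by rewrite expRN ler_pdivrMr ?expR_gt0// mul1r.
    have h2 := hT2 t tT2; rewrite ler_pdivlMr ?mulr_gt0 ?invr_gt0 ?ltr_wpDl// in h2.
    apply: le_trans h2; rewrite E; set x := expR _ in h1 *.
    have x0 : 0 <= x by exact: expR_ge0.
    rewrite (_ : t * _ = (t * x) * (x * MV)); last by ring.
    apply: (@le_trans _ _ ((r / 2)^-1 * (x * (MV + 1)))); last first.
      by rewrite le_eqVlt; apply/orP; left; apply/eqP; ring.
    apply: ler_pM => //; rewrite ?mulr_ge0 ?(ltW t0)//.
    by rewrite ler_wpM2l// lerDl.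
  rewrite /lapcell; have : t * fine (lapl depth t cell) <=
    t * (fine (lapl depth t (S r)) + fine (lapl depth t D)) by rewrite ler_pM2l.
  have : t * fine (lapl depth t D) <= t * (expR (- (t * r)) * MV) by rewrite ler_pM2l.
  rewrite mulrDr; lra.
by rewrite ler_distlC low up.
Unshelve. all: by end_near. Qed.

End voronoi_laplace.

(** * The Laplace transform of a refinement equation *)

Lemma voronoi_spline_from_coord (R : realType) (N d : nat) (Q : 'M[R]_(d, N))
    (L : set 'rV[R]_N) (m : nat) (t : d.-tuple (measurableTypeR R)) :
  voronoi_spline Q L m (from_coord Q t) =
  tspline [set s : d.-tuple (measurableTypeR R) | voronoi L (from_coord Q s)] m.-1 t.
Proof.
have ind (s : d.-tuple (measurableTypeR R)) : \1_(voronoi L) (from_coord Q s) =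
    \1_[set s : d.-tuple (measurableTypeR R) | voronoi L (from_coord Q s)] s :> R.
  rewrite !indicE; set b := (_ \in _); set b' := (_ \in _).
  by have -> : b = b' by apply/idP/idP; rewrite !inE.
rewrite /voronoi_spline; elim: m.-1 t => [|k IH] t; first exact: ind.
rewrite /= /convolution /tconv; congr fine; apply: eq_integral => s _.
by rewrite IH -from_coordB ind.
Qed.

Section relation.
Context (R : realType) (N : nat) (L : set 'rV[R]_N) (K : nat).
Hypotheses (K0 : (0 < K)%N) (LK : forall l, L l -> integral_vec (K%:R *: l)).
Hypotheses (L0 : L 0) (LB : forall k l, L k -> L l -> L (k - l)).
Context (d : nat) (Q : 'M[R]_(d, N)).
Hypothesis (hQ : orthonormal_basis (linspan L) Q).
Local Notation T := (measurableTypeR R).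
Local Notation X := (d.-tuple T).
Local Notation p := (from_coord Q).
Local Notation mu := (lebesgue_tuple R d).
Local Notation cell := (cell L Q).

Let QQ : Q *m Q^T = 1%:M. Proof. by case: hQ. Qed.
Let LN l : L l -> L (- l). Proof. by move=> Ll; rewrite -sub0r; exact: LB. Qed.

Variables (la : R) (m : nat).
Hypotheses (la0 : 0 < la) (m0 : (0 < m)%N) (cell0 : (0 < mu cell)%E).

Let laL := scale la L.
Let lacell : set X := [set t | voronoi laL (p t)].
Let laE : lacell = tscale la^-1 @^-1` cell.
Proof.
by apply/seteqP; split=> t /=; rewrite /lacell /cell /= voronoi_scale// from_coordZ.
Qed.

Let mlacell : measurable lacell.
Proof.
rewrite laE -[X in measurable X]setTI.
have mt := @measurable_tscale R d la^-1.
by apply: mt => //; exact: (measurable_cell K0 LK hQ).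
Qed.

Let laL_lin k : laL k -> p (coord Q k) = k.
Proof.
move=> [l Ll <-]; apply: coordK => //; apply/hQ.2/linspanZ; exact: linspan_mem.
Qed.

Let laLB k l : laL k -> laL l -> laL (k - l).
Proof. by move=> [a La <-] [b Lb <-]; exists (a - b); [exact: LB | rewrite scalerBr]. Qed.

Let laL0 : laL 0. Proof. by exists 0 => //; rewrite scaler0. Qed.

Let laLN k : laL k -> laL (- k).
Proof. by move=> h; rewrite -sub0r; exact: laLB. Qed.

Let laLc : countable laL.
Proof. by apply: sub_countable (lattice_countable K0 LK); exact: card_image_le. Qed.

Lemma scaled_cell_bounded : exists2 M : R, 0 <= M &
  cell `<=` tbox [tuple 0 | i < d] M /\ lacell `<=` tbox [tuple 0 | i < d] M.
Proof.
have [M M0 VM] := voronoi_bounded hQ LN.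
exists (Num.max M (la * M)); first by rewrite le_max M0.
split=> [t /VM h i|t]; first by rewrite (le_trans (h i))// le_max lexx.
rewrite laE => /VM h i; have := h i; rewrite !tnth_mktuple !subr0 normrM gtr0_norm ?invr_gt0//.
by rewrite ler_pdivrMl// => h'; rewrite (le_trans h')// le_max lexx orbT.
Qed.

(** The sign [e] serves both the sums over [x + k] and those over [x - k]. *)
Lemma scaled_lattice_support_finite (x : 'rV[R]_N) (h : 'rV[R]_N -> R) (M : R) (e : R) :
  linspan L x -> `|e| = 1 ->
  (forall t : X, h (p t) != 0 -> tbox [tuple 0 | i < d] M t) ->
  finite_set (laL `&` [set k | h (x + e *: k) != 0]).
Proof.
move=> Ex e1 hM.
pose B := la^-1 * (\sum_j `|x 0 j| + \sum_j \sum_i M * `|Q i j|).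
apply: (@sub_finite_set _ _ ( *:%R la @` (L `&` [set l | forall j, `|l 0 j| <= B]))).
  move=> k [[l Ll lk] /= hk]; exists l => //; split=> // j.
  have Ek : linspan L k by rewrite -lk; apply/linspanZ/linspan_mem.
  have xkQ : ((x + e *: k)%R <= Q)%MS.
    by apply: addmx_sub; [exact/hQ.2|apply: scalemx_sub; exact/hQ.2].
  have pk := coordK QQ xkQ.
  rewrite -pk in hk; have tM := hM _ hk.
  set t := coord Q _ in pk tM.
  have lE : `|l 0 j| = la^-1 * `|k 0 j|.
    by rewrite -lk mxE normrM gtr0_norm// mulKf// gt_eqF.
  rewrite lE /B ler_pM2l ?invr_gt0//.
  have -> : `|k 0 j| = `|p t 0 j - x 0 j|.
    have -> : p t 0 j - x 0 j = e * k 0 j by rewrite pk !mxE; ring.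
    by rewrite normrM e1 mul1r.
  rewrite (le_trans (ler_normB _ _))// addrC lerD//.
    by rewrite (bigD1 j)//= lerDl sumr_ge0.
  have M0 (i : 'I_d) : 0 <= M.
    by have := tM i; rewrite tnth_mktuple => tMi; exact: le_trans (normr_ge0 _) tMi.
  rewrite (bigD1 j)//= -[leLHS]addr0 lerD//; last first.
    by apply: sumr_ge0 => j' _; apply: sumr_ge0 => i _; rewrite mulr_ge0// (M0 i).
  rewrite /from_coord mxE (le_trans (ler_norm_sum _ _ _))// ler_sum// => i _.
  rewrite mxE normrM ler_wpM2r//; have := tM i.
  by rewrite [X in _ - X]tnth_mktuple subr0.
by apply: finite_image; exact: lattice_finite K0 LK B.
Qed.

(** Translation preserves null sets and the scaled lattice is countable, so the exceptional sets of
    all translates have a null union. *)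
Lemma ae_translates (P : X -> Prop) : {ae mu, forall t, P t} ->
  {ae mu, forall t, forall k, laL k -> P (tadd t (coord Q k))}.
Proof.
move=> [A [mA A0 PA]].
have tr b : mu.-negligible [set t : X | ~ P (tadd t b)].
  have mtb : measurable_fun setT (fun t : X => tadd t b).
    exact: (measurableT_comp (@measurable_tadd R d) (pair2_measurable b)).
  have mB : measurable ((fun t : X => tadd t b) @^-1` A).
    by rewrite -[X in measurable X]setTI; exact: mtb.
  exists ((fun t : X => tadd t b) @^-1` A); split => //; last by move=> t /PA.
  rewrite -A0 -[in LHS](setIT (_ @^-1` _)) -[in RHS](setIT A) -!integral_indic//.
  have mI : measurable_fun setT (fun t : X => (\1_A t : R)%:E).
    by apply/measurable_EFinP; exact: measurable_indic.
  rewrite -(ge0_integral_tadd b mI) => [|t]; last by rewrite lee_fin indicE.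
  by apply: eq_integral => t _; rewrite !indicE.
have /countable_injP[f fI] := laLc.
have H : mu.-negligible (\bigcup_n [set t : X | exists k, [/\ laL k, f k = n & ~ P (tadd t (coord Q k))]]).
  apply: negligible_bigcup => n.
  have [[k [Lk kn]]|hn] := pselect (exists k, laL k /\ f k = n).
    apply: negligibleS (tr (coord Q k)) => t /= [k' [Lk' kn' h]].
    by rewrite (fI k k') ?inE// kn.
  by apply: negligibleS (negligible_set0 _) => t /= [k [Lk kn _]]; apply: hn; exists k.
apply: negligibleS H => t /=; move=> h; apply: contrapT => h'; apply: h => k Lk.
by apply: contrapT => nP; apply: h'; exists (f k) => //; exists k.
Qed.

Variable y : 'rV[R]_N.

Definition weight (tau : R) (t : X) : R := expR (tau * dot (p t) y).

Lemma weight_ge0 tau t : 0 <= weight tau t. Proof. exact: expR_ge0. Qed.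

Lemma weightD tau s t : weight tau (tadd s t) = weight tau s * weight tau t.
Proof. by rewrite /weight from_coordD dotDl mulrDr expRD. Qed.

Lemma measurable_weight tau : measurable_fun setT (weight tau).
Proof.
apply: measurableT_comp => //; apply: measurable_funM => //.
exact: measurable_dot_from_coord.
Qed.

Definition wint (W : set X) (tau : R) : \bar R :=
  (\int[mu]_t (weight tau t * \1_W t)%:E)%E.

Lemma measurable_wint (W : set X) tau : measurable W ->
  measurable_fun setT (fun t => (weight tau t * \1_W t)%:E).
Proof.
move=> mW; apply/measurable_EFinP; apply: measurable_funM; first exact: measurable_weight.
exact: measurable_indic.
Qed.

Lemma wint_ge0 W tau : (0 <= wint W tau)%E.
Proof. by apply: integral_ge0 => t _; rewrite lee_fin mulr_ge0// ?weight_ge0// indicE. Qed.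

Lemma wint_fin (W : set X) tau M : measurable W -> 0 <= M -> W `<=` tbox [tuple 0 | i < d] M ->
  wint W tau \is a fin_num.
Proof.
move=> mW M0 WM; rewrite ge0_fin_numE ?wint_ge0//.
pose B := \sum_(i < d) M * `|dot (row i Q) y|.
apply: (@le_lt_trans _ _ (\int[mu]_t ((expR (`|tau| * B))%:E *
    (\1_(tbox [tuple 0 | i < d] M) t)%:E))%E); last first.
  by rewrite integral_tbox ?expR_ge0// ltry.
apply: ge0_le_integral; first exact: measurableT.
- by move=> t _; rewrite lee_fin mulr_ge0// ?weight_ge0// indicE.
- exact: measurable_wint.
- by apply/measurable_EFinP/measurable_funM => //; apply: measurable_indic; exact: measurable_tbox.
move=> t _; rewrite -EFinM lee_fin indicE.
case: (boolP (t \in W)) => [|_]; last by rewrite mulr0 mulr_ge0 ?expR_ge0// indicE.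
rewrite inE => /WM tM; rewrite indicE mem_set// !mulr1 ler_expR.
apply: le_trans (ler_norm _) _; rewrite normrM ler_wpM2l// /from_coord mulmx_sum_row dot_suml.
apply: le_trans (ler_norm_sum _ _ _) _; apply: ler_sum => i _.
rewrite dotZl normrM mxE ler_wpM2r//; have := tM i.
by rewrite tnth_mktuple subr0.
Qed.

Lemma wint_lacell tau : wint lacell tau = ((la ^+ d)%:E * wint cell (la * tau))%E.
Proof.
have mw := measurable_wint tau mlacell.
have nn t : (0 <= (weight tau t * \1_lacell t)%:E)%E.
  by rewrite lee_fin mulr_ge0// ?weight_ge0// indicE.
have := ge0_integral_tscale la0 mw nn; rewrite -/(wint lacell tau) => E.
have <- : (\int[mu]_t (weight tau (tscale la t) * \1_lacell (tscale la t))%:E)%E = wint cell (la * tau).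
  apply: eq_integral => t _; congr EFin; rewrite /weight from_coordZ dotZl mulrCA mulrA.
  congr (_ * _); rewrite !indicE; set b := (_ \in _); set b' := (_ \in _).
  suff -> : b = b' by [].
  have tt : tscale la^-1 (tscale la t) = t.
    by apply: eq_from_tnth => i; rewrite !tnth_mktuple mulKf// gt_eqF.
  by apply/idP/idP; rewrite !inE laE /= tt.
by rewrite E muleA -EFinM mulfV ?mul1e// expf_neq0// gt_eqF.
Qed.

Lemma integral_tspline_shift (W : set X) M k tau b : measurable W -> 0 <= M ->
  W `<=` tbox [tuple 0 | i < d] M ->
  (\int[mu]_t (weight tau t * tspline W k (tsub t b))%:E = (weight tau b)%:E * wint W tau ^+ k.+1)%E.
Proof.
move=> mW M0 WM.
have mts : measurable_fun setT (fun t : X => tsub t b).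
  exact: (measurableT_comp (@measurable_tsub R d) (pair2_measurable b)).
have mf := measurable_tspline mW M0 WM k; have f0 := tspline_ge0 mW M0 WM k.
have mh : measurable_fun setT (fun t : X => (weight tau t * tspline W k (tsub t b))%:E).
  apply/measurable_EFinP; apply: measurable_funM; first exact: measurable_weight.
  exact: measurableT_comp.
have h0 t : (0 <= (weight tau t * tspline W k (tsub t b))%:E)%E.
  by rewrite lee_fin mulr_ge0// weight_ge0.
rewrite -(ge0_integral_tadd b mh h0).
rewrite -(integral_tspline mW M0 WM k (measurable_weight tau) (weight_ge0 tau) (weightD tau)).
rewrite -ge0_integralZl_setT ?weight_ge0//.
- by apply: eq_integral => t _; rewrite taddK weightD -EFinM; congr EFin; ring.
- by apply/measurable_EFinP; apply: measurable_funM => //; exact: measurable_weight.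
- by move=> t; rewrite lee_fin mulr_ge0// weight_ge0.
Qed.

Definition cell_transform (tau : R) : R := fine (wint cell tau).

(** The swapped identity is integrated against the weight. A shift by [j] multiplies the transform
    of a spline by [expR (tau * dot j y)], so the exponents are the numbers [dot j y] and the
    coefficients the spline values at [x0 + j]. *)
Lemma refinable_transform : refinable Q L m la -> exists r r' : seq (R * R),
  [/\ forall a, a \in r -> 0 <= a.1, forall a, a \in r' -> 0 <= a.1, expsum r 0 != 0 &
    forall tau, expsum r tau * cell_transform tau ^+ m =
      expsum r' tau * (la ^+ d * cell_transform (la * tau)) ^+ m].
Proof.
move=> /(_ 0 L0) [c hc].
have [M M0 [cM lM]] := scaled_cell_bounded.
have mcell : measurable cell by exact: (measurable_cell K0 LK hQ).
pose F := voronoi_spline Q L m; pose G := voronoi_spline Q laL m.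
have FE t : F (p t) = tspline cell m.-1 t by exact: voronoi_spline_from_coord.
have GE t : G (p t) = tspline lacell m.-1 t by exact: voronoi_spline_from_coord.
have F0 t : 0 <= F (p t) by rewrite FE; exact: (tspline_ge0 mcell M0 cM).
have G0 t : 0 <= G (p t) by rewrite GE; exact: (tspline_ge0 mlacell M0 lM).
pose rep z := F z = \sum_(k \in laL) c k * G (z - k).
have {}hc : {ae mu, forall t, rep (p t)}.
  by apply: filterS hc => t; rewrite subr0.
have good := ae_translates hc.
have lacell_gt0 : (0 < mu lacell)%E.
  have := wint_lacell 0; rewrite mulr0.
  have w0 W : measurable W -> wint W 0 = mu W.
    move=> mW; transitivity (\int[mu]_t (\1_W t)%:E)%E; last by rewrite integral_indic// setIT.
    by apply: eq_integral => t _; rewrite /weight mul0r expR0 mul1r.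
  rewrite !w0// => ->; apply: mule_gt0 => //.
  by rewrite lte_fin exprn_gt0.
(* Such a point exists because [G] has integral [mu lacell ^+ m > 0] and so does not vanish almost
   everywhere. It puts 0 into [s1], which makes [expsum r 0] positive. *)
have [x0 goodx0 Gx0] : exists2 x0 : X, (forall k, laL k -> rep (p (tadd x0 (coord Q k)))) & 0 < G (p x0).
  apply: contrapT => hn.
  have ae0 : {ae mu, forall t, (tspline lacell m.-1 t)%:E = 0%E}.
    apply: filterS good => t gt; congr EFin; apply: contrapT => /eqP nz; apply: hn; exists t => //.
    by rewrite lt_neqAle eq_sym GE nz -GE G0.
  have int0 : (\int[mu]_t (1 * tspline lacell m.-1 t)%:E = 0)%E.
    transitivity (\int[mu]_t (0 : \bar R))%E; last by rewrite integral0.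
    apply: ge0_ae_eq_integral => //.
    - apply/measurable_EFinP; apply: measurable_funM => //.
      exact: measurable_tspline mlacell M0 lM _.
    - by move=> t _; rewrite lee_fin mul1r -GE.
    - by apply: filterS ae0 => t e _; rewrite mul1r.
  have := integral_tspline mlacell M0 lM m.-1 (w := fun=> 1) (measurable_cst _)
     (fun=> ler01) (fun _ _ => esym (mul1r _)).
  rewrite int0 prednK// (_ : (\int[mu]_t _)%E = mu lacell); last first.
    transitivity (\int[mu]_t (\1_lacell t)%:E)%E; last by rewrite integral_indic// setIT.
    by apply: eq_integral => t _; rewrite mul1r.
  have fl : mu lacell \is a fin_num.
    rewrite ge0_fin_numE ?measure_ge0//.
    apply: (@le_lt_trans _ _ (mu (tbox [tuple 0 | i < d] M))).
      by apply: le_measure; rewrite ?inE//; exact: measurable_tbox.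
    by rewrite lebesgue_tbox// ltry.
  rewrite -(fineK fl) -EFin_expe => -[/esym/eqP]; rewrite expf_eq0 m0/=.
  by rewrite gt_eqF// fine_gt0// lacell_gt0 -ge0_fin_numE ?measure_ge0.
have Ex t : linspan L (p t) by apply/hQ.2; exact: from_coord_sub.
have suppF t : F (p t) != 0 -> tbox [tuple 0 | i < d] (M *+ m) t.
  by rewrite FE => /(tspline_support mcell M0 cM); rewrite prednK.
have suppG t : G (p t) != 0 -> tbox [tuple 0 | i < d] (M *+ m) t.
  by rewrite GE => /(tspline_support mlacell M0 lM); rewrite prednK.
have finP (H : 'rV[R]_N -> R) (x : X) : (forall t, H (p t) != 0 -> tbox [tuple 0 | i < d] (M *+ m) t) ->
    finite_set (laL `&` [set k | H (p x + k) != 0]).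
  move=> hH; apply: sub_finite_set (scaled_lattice_support_finite (e := 1) (Ex x) (normr1 _) hH).
  by move=> k [Lk /= hk]; split=> //=; rewrite scale1r.
have finN (x : X) : finite_set (laL `&` [set k | G (p x - k) != 0]).
  have e1 : `|-1 : R| = 1 by rewrite normrN1.
  apply: sub_finite_set (scaled_lattice_support_finite (e := -1) (Ex x) e1 suppG).
  by move=> k [Lk /= hk]; split=> //=; rewrite scaleN1r.
set S1 := laL `&` [set k | G (p x0 + k) != 0].
set S0 := laL `&` [set k | F (p x0 + k) != 0].
have fS1 : finite_set S1 by exact: finP.
have fS0 : finite_set S0 by exact: finP.
have [s1 us1 S1E] : exists2 s : seq 'rV[R]_N, uniq s & S1 = [set` s].
  have /finite_seqP[s sE] := fS1; exists (undup s); rewrite ?undup_uniq// sE.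
  by apply/seteqP; split=> k /=; rewrite mem_undup.
have [s0 us0 S0E] : exists2 s : seq 'rV[R]_N, uniq s & S0 = [set` s].
  have /finite_seqP[s sE] := fS0; exists (undup s); rewrite ?undup_uniq// sE.
  by apply/seteqP; split=> k /=; rewrite mem_undup.
have swap : {ae mu, forall x,
    \sum_(j <- s1) G (p x0 + j) * F (p x - j) =
    \sum_(l <- s0) F (p x0 + l) * G (p x - l)}.
  apply: filterS good => x gx.
  have r0 l : laL l -> rep (p x0 + l).
    by move=> Ll; have := goodx0 l Ll; rewrite from_coordD laL_lin.
  have r1 j : laL j -> rep (p x - j).
    by move=> Lj; have := gx _ (laLN Lj); rewrite from_coordD laL_lin//; exact: laLN.
  have := refinement_swap laLB laL0 r0 r1 fS1 (finN x).
  rewrite -/S1 S1E -fsbig_seq// => ->.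
  rewrite [RHS]fsbig_seq// -S0E; apply/esym/fsbig_widen => [l []//|l [Ll]] /=.
  by rewrite /S0 /= => /not_andP[//|/negP]; rewrite negbK => /eqP ->; rewrite mul0r.
exists [seq (G (p x0 + j), dot j y) | j <- s1],
  [seq (F (p x0 + l), dot l y) | l <- s0].
have S1L j : j \in s1 -> laL j by move=> js; have [] : S1 j by rewrite S1E.
have S0L j : j \in s0 -> laL j by move=> js; have [] : S0 j by rewrite S0E.
have px0 j : laL j -> p x0 + j = p (tadd x0 (coord Q j)).
  by move=> Lj; rewrite from_coordD laL_lin.
split.
- by move=> _ /mapP[j /S1L Lj ->] /=; rewrite px0.
- by move=> _ /mapP[j /S0L Lj ->] /=; rewrite px0.
- rewrite /expsum big_map /= gt_eqF//.
  have S10 : 0 \in s1.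
    have : S1 0 by split=> //=; rewrite addr0 gt_eqF.
    by rewrite S1E.
  rewrite (bigD1_seq 0)//= addr0 mulr0 expR0 mulr1 ltr_pwDl// big_seq_cond.
  by apply: sumr_ge0 => j /andP[/S1L Lj _]; rewrite mulr_ge0 ?expR_ge0// px0.
move=> tau.
have key (H H' : 'rV[R]_N -> R) (W : set X) (S : seq 'rV[R]_N) :
    measurable W -> W `<=` tbox [tuple 0 | i < d] M ->
    (forall t, H (p t) = tspline W m.-1 t) -> (forall t, 0 <= H' (p t)) ->
    (forall j, j \in S -> laL j) ->
    (\int[mu]_t (weight tau t * \sum_(j <- S) H' (p x0 + j)%R * H (p t - j)%R)%:E =
    (expsum [seq (H' (p x0 + j)%R, dot j y) | j <- S] tau)%:E * wint W tau ^+ m)%E.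
  move=> mW WM HE H'0 SL.
  have mf := measurable_tspline mW M0 WM m.-1; have f0 := tspline_ge0 mW M0 WM m.-1.
  have HpE t j : j \in S -> H (p t - j) = tspline W m.-1 (tsub t (coord Q j)).
    by move=> /SL Lj; rewrite -HE from_coordB laL_lin.
  (* The absolute value changes nothing on [S] but makes the coefficient nonnegative for every [j],
     as exchanging sum and integral of nonnegative functions requires. *)
  pose a j := `|H' (p x0 + j)|.
  have aE j : j \in S -> H' (p x0 + j) = a j by move=> /SL Lj; rewrite /a ger0_norm// px0.
  have a0 j : 0 <= a j by exact: normr_ge0.
  pose h j t := (weight tau t * tspline W m.-1 (tsub t (coord Q j)))%:E.
  have mint j : measurable_fun setT (h j).
    apply/measurable_EFinP; apply: measurable_funM; first exact: measurable_weight.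
    apply: measurableT_comp => //.
    exact: (measurableT_comp (@measurable_tsub R d) (pair2_measurable _)).
  have h0 j t : (0 <= h j t)%E by rewrite lee_fin mulr_ge0// weight_ge0.
  transitivity (\int[mu]_t \sum_(j <- S) (a j)%:E * h j t)%E.
    apply: eq_integral => t _; rewrite mulr_sumr -sumEFin.
    by apply: eq_big_seq => j jS; rewrite /h HpE// aE// -EFinM; congr EFin; ring.
  transitivity (\sum_(j <- S) \int[mu]_t ((a j)%:E * h j t))%E.
    apply: (@ge0_integral_sum _ _ R mu setT measurableT _ (fun j t => ((a j)%:E * h j t)%E)).
    - by move=> j; apply: measurable_funeM; exact: mint.
    - by move=> j t _; apply: mule_ge0; [rewrite lee_fin|exact: h0].
  transitivity ((\sum_(j <- S) (a j * weight tau (coord Q j))%:E) * wint W tau ^+ m)%E.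
    rewrite ge0_sume_distrl => [|j _]; last by rewrite lee_fin mulr_ge0 ?weight_ge0.
    apply: eq_big_seq => j jS; rewrite (ge0_integralZl_setT mu (mint j) (h0 j) (a0 j)).
    by rewrite (integral_tspline_shift _ _ _ mW M0 WM) prednK// muleA -EFinM.
  rewrite sumEFin /expsum big_map; congr (_ %:E * _)%E.
  apply: eq_big_seq => j jS; rewrite aE// /weight laL_lin; last exact: SL.
  by congr (_ * expR _); rewrite mulrC.
have f1 : wint cell tau \is a fin_num by exact: (wint_fin _ mcell M0 cM).
have f3 : wint cell (la * tau) \is a fin_num by exact: (wint_fin _ mcell M0 cM).
have mI (H H' : 'rV[R]_N -> R) (W : set X) (S : seq 'rV[R]_N) :
    measurable W -> W `<=` tbox [tuple 0 | i < d] M ->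
    (forall t, H (p t) = tspline W m.-1 t) -> (forall j, j \in S -> laL j) ->
    measurable_fun setT (fun t =>
      (weight tau t * \sum_(j <- S) H' (p x0 + j)%R * H (p t - j)%R)%:E).
  move=> mW WM HE SL; apply/measurable_EFinP; apply: measurable_funM.
    exact: measurable_weight.
  rewrite (_ : (fun t => _) = fun t => \sum_(j <- S) H' (p x0 + j)%R *
      tspline W m.-1 (tsub t (coord Q j))).
    apply: measurable_sum => j; apply: measurable_funM => //.
    apply: measurableT_comp; first exact: (measurable_tspline mW M0 WM).
    exact: (measurableT_comp (@measurable_tsub R d) (pair2_measurable _)).
  apply/funext => t; apply: eq_big_seq => j /SL Lj.
  by rewrite -HE from_coordB laL_lin.
have pos (H H' : 'rV[R]_N -> R) (S : seq 'rV[R]_N) : (forall t, 0 <= H (p t)) ->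
    (forall t, 0 <= H' (p t)) -> (forall j, j \in S -> laL j) -> forall t, [set: X] t ->
    (0 <= (weight tau t * \sum_(j <- S) H' (p x0 + j)%R * H (p t - j)%R)%:E)%E.
  move=> H0 H'0 SL t _; rewrite lee_fin mulr_ge0 ?weight_ge0// big_seq_cond sumr_ge0// => j.
  move=> /andP[/SL Lj _]; rewrite mulr_ge0//; first by rewrite px0.
  by rewrite -(laL_lin Lj) -from_coordB.
have kF := key F G cell s1 mcell cM FE G0 S1L.
have kG := key G F lacell s0 mlacell lM GE F0 S0L.
have : ((expsum [seq (G (p x0 + j), dot j y) | j <- s1] tau)%:E * wint cell tau ^+ m =
   (expsum [seq (F (p x0 + j), dot j y) | j <- s0] tau)%:E * wint lacell tau ^+ m)%E.
  apply: etrans (esym kF) (etrans _ kG).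
  apply: ge0_ae_eq_integral; first exact: measurableT.
  - exact: (mI F G cell s1 mcell cM FE S1L).
  - exact: (mI G F lacell s0 mlacell lM GE S0L).
  - exact: pos F0 G0 S1L.
  - exact: pos G0 F0 S0L.
  - by apply: filterS swap => t e _; rewrite e.
rewrite wint_lacell -(fineK f1) -(fineK f3) -EFinM -!EFin_expe -!EFinM => -[].
by [].
Qed.

End relation.

(** * A criterion for non-refinability *)

Section criterion.
Context (R : realType) (N : nat) (L : set 'rV[R]_N) (K : nat).
Hypotheses (K0 : (0 < K)%N) (LK : forall l, L l -> integral_vec (K%:R *: l)).
Hypotheses (L0 : L 0) (LB : forall k l, L k -> L l -> L (k - l)).
Variable u : 'rV[R]_N.
Hypotheses (Lu : L u).
Hypothesis relevant : forall l, L l -> l != 0 -> l != u -> dot u l < dot l l.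

Let LN l : L l -> L (- l). Proof. by move=> Ll; rewrite -sub0r; exact: LB. Qed.

Lemma relevant_abs l : L l -> `|dot u l| <= dot l l.
Proof.
have h k : L k -> dot u k <= dot k k.
  move=> Lk; have [->|k0] := eqVneq k 0; first by rewrite !dot0r.
  have [->//|ku] := eqVneq k u.
  by apply/ltW/relevant.
move=> Ll; rewrite ler_norml h// andbT lerNl.
by have := h _ (LN Ll); rewrite dotNl !dotNr opprK.
Qed.

Lemma dot_int (x y : 'rV[R]_N) : integral_vec x -> integral_vec y -> dot x y \is a Num.int.
Proof. by move=> hx hy; apply: rpred_sum => i _; exact: rpredM. Qed.

Context (d : nat) (Q : 'M[R]_(d, N)).
Hypothesis (hQ : orthonormal_basis (linspan L) Q).

(** The strict inequality [relevant] has a uniform gap: [D = dot l l - dot u l] is a positive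
    multiple of [K^-2], and it dominates [dot l l] up to a constant. Hence [2 * dot y l <= D] for
    all [l] at once when [y] is small. *)
Lemma relevant_facet : exists2 rho : R, 0 < rho & forall y, linspan L y ->
  dot y u = 0 -> dot y y <= rho -> voronoi L (2^-1 *: u + y).
Proof.
have KR : 0 < K%:R :> R by rewrite ltr0n.
have K2 : 0 < K%:R ^+ 2 :> R by rewrite exprn_gt0.
have uu := dot_ge0 u.
(* Chosen so that [dot y y <= A^-1] and [dot l l <= 2 * D * (1 + dot u u * K%:R ^+ 2)] give [dot y l
   ^+ 2 <= D / (4 * K%:R ^+ 2) <= D ^+ 2 / 4]. *)
pose A := 8 * (K%:R ^+ 2 * (1 + dot u u * K%:R ^+ 2)).
have A0 : 0 < A.
  by apply: mulr_gt0 => //; apply: mulr_gt0 => //; rewrite ltr_wpDr// mulr_ge0// ltW.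
exists A^-1; first by rewrite invr_gt0.
move=> y Ey yu yy; apply/voronoiP; split.
  apply/hQ.2/addmx_sub; last exact/hQ.2.
  by apply: scalemx_sub; apply/hQ.2; exact: linspan_mem.
move=> l Ll; rewrite dotDl dotZl.
have [->|l0] := eqVneq l 0; first by rewrite !dot0r !mulr0 addr0 mulr0.
have [->|lu] := eqVneq l u.
  by rewrite yu addr0 mulrA mulfV// mul1r.
have D0 := relevant Ll l0 lu.
pose D := dot l l - dot u l; have {}D0 : 0 < D by rewrite subr_gt0.
have D1 : 1 <= K%:R ^+ 2 * D.
  have Ki : K%:R ^+ 2 * D \is a Num.int.
    rewrite (_ : _ * _ = dot (K%:R *: l) (K%:R *: l) - dot (K%:R *: u) (K%:R *: l)); last first.
      by rewrite !(dotZl, dotZr) /D; ring.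
    by apply: rpredB; apply: dot_int; exact: LK.
  have KD : 0 < K%:R ^+ 2 * D by exact: mulr_gt0.
  by rewrite -[leRHS]gtr0_norm// norm_intr_ge1// gt_eqF.
have ll := dot_ge0 l.
have ul : dot u l <= dot u u + dot l l / 4.
  have := dot_ge0 (2 *: u - l); rewrite !(dotBl, dotBr, dotZl, dotZr) (dotC l u); lra.
have llD : dot l l <= 2 * D * (1 + dot u u * K%:R ^+ 2).
  have h1 : dot l l <= 2 * (D + dot u u) by rewrite /D; lra.
  have h2 : dot u u * 1 <= dot u u * (K%:R ^+ 2 * D) by rewrite ler_wpM2l.
  lra.
have cs := dot_CS y l.
have h3 : dot y y * dot l l <= A^-1 * (2 * D * (1 + dot u u * K%:R ^+ 2)).
  by rewrite ler_pM// dot_ge0.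
have h4 : A^-1 * (2 * D * (1 + dot u u * K%:R ^+ 2)) = D * (4 * K%:R ^+ 2)^-1.
  rewrite /A; field; rewrite (gt_eqF KR)/= gt_eqF// ltr_wpDr// mulr_ge0// ltW.
have h5 : (4 * K%:R ^+ 2)^-1 <= D / 4.
  rewrite invfM mulrC ler_pM2r ?invr_gt0//.
  by rewrite -[leLHS]mulr1 ler_pdivrMl.
have h7 : 2 * dot y l <= D.
  by rewrite leNgt; apply/negP => h; nra.
by move: h7; rewrite /D; lra.
Qed.

Variables (v q : 'rV[R]_N).
Hypotheses (Lv : L v) (Vq : voronoi L q).
Hypotheses (qu : 2 * dot q u = dot u u) (qv : 2 * dot q v = dot v v).
Hypotheses (uv0 : 0 < dot u v) (uvu : dot u v < dot u u).

(* The point [q] lies on a ridge whose belt consists of six facets; in Z^n all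
   belts have four facets, and [dot u v = 0]. *)
Theorem voronoi_spline_not_refinable (m : nat) (la : R) :
  (0 < m)%N -> 0 < la < 1 -> ~ refinable Q L m la.
Proof.
move=> m0 la01; have /andP[la0 la1] := la01.
have u0 : u != 0.
  apply/eqP => uE; have := uvu; rewrite uE !dot0l; have := uv0; rewrite uE dot0l; lra.
have uu := dot_gt0 u0.
have Vu := relevant_abs.
have [rho rho0 facet] := relevant_facet.
pose C := cell L Q; pose s := depth Q u.
have mC : measurable C := measurable_cell K0 LK hQ.
have sub := prism_cellS L0 LB hQ Lu u0.
have Clim := lapcell_limit K0 LK L0 LB hQ Lu u0 Vu Lv Vq qu qv uv0 uvu rho0 facet.
have Clow := lapcell_low K0 LK L0 LB hQ Lu u0 Lv Vq qu qv uv0 uvu.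
have Npos := slabvol_gt0 K0 LK L0 LB hQ Lu u0 rho0 facet.
have C0 : (0 < lebesgue_tuple R d C)%E.
  apply: lt_le_trans (prism0_pos K0 LK hQ Lu u0 rho0 facet) _.
  apply: le_measure; rewrite ?inE//.
  exact: (measurable_slab (measurable_depth Q u) (measurable_prism K0 LK hQ u 0)).
(* With this direction [dot (p x) y] is 1/2 minus the depth, so the transform is [expR (t / 2)]
   times the Laplace integral of the depth. *)
pose y := (dot u u)^-1 *: u.
move=> /(refinable_transform K0 LK L0 LB hQ la0 m0 C0 y)[r [r' [rp rp' rn rel]]].
pose f t := fine (lapl s t C).
have trE t : 0 < t -> cell_transform L Q y t = expR (t / 2) * f t.
  move=> t0; have ms := measurable_depth Q u.
  have fin := lapl_cell_fin K0 LK L0 LB hQ Lu u0 (ltW t0) mC (@subset_refl _ _).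
  rewrite /cell_transform /f (_ : expR (t / 2) = fine (expR (t / 2))%:E)// -fineM//.
  congr fine; rewrite /lapl -ge0_integralZl_setT ?expR_ge0//.
  - apply: eq_integral => x _; rewrite -EFinM mulrA -expRD /weight; congr (expR _ * _)%:E.
    by rewrite /y /s /depth dotZr; field; rewrite gt_eqF.
  - exact: measurable_lapl.
(* The division by [la ^+ m] compensates the factor [la * t] contained in [lapcell (la * t)]; [al]
   and [be] collect the [m]-th powers of the factors [expR (t / 2)] and [expR (la * t / 2)]. *)
apply: (laplace_scaling_contra Npos Clim Clow (m := m) (la := la)
  (Lam := la ^+ (d * m) / la ^+ m) (al := m%:R / 2) (be := m%:R * la / 2) (r := r) (r' := r')) => //.
  by rewrite divr_gt0// exprn_gt0.
move=> t t0; rewrite /lapcell -/C -/s -/(f _) -/(f _).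
have lt0 : 0 < la * t by exact: mulr_gt0.
have := rel t; rewrite !trE// => E.
have -> : expR (m%:R / 2 * t) = expR (t / 2) ^+ m by rewrite -expRM_natl; congr expR; ring.
have -> : expR (m%:R * la / 2 * t) = expR (la * t / 2) ^+ m.
  by rewrite -expRM_natl; congr expR; ring.
transitivity (t ^+ m * (expsum r t * (expR (t / 2) * f t) ^+ m)).
  by rewrite !exprMn; ring.
rewrite E !exprMn exprM; have lam : la ^+ m != 0 by rewrite expf_neq0// gt_eqF.
by field.
Qed.

End criterion.

(** * Root lattices *)

Section linear_span.
Context (R : realType) (N : nat) (L : set 'rV[R]_N).

Lemma linspanD x y : linspan L x -> linspan L y -> linspan L (x + y).
Proof.
move=> [k [B [LB xB]]] [k' [B' [LB' yB']]]; exists (k + k')%N, (col_mx B B'); split.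
  move=> i; case: (split_ordP i) => j ->; rewrite ?rowKu ?rowKd//.
rewrite -addsmxE; apply: addmx_sub_adds => //.
Qed.

Lemma linspan_sum (I : Type) (r : seq I) (F : I -> 'rV[R]_N) :
  L 0 -> (forall i, linspan L (F i)) -> linspan L (\sum_(i <- r) F i).
Proof.
move=> L0 h; apply: big_ind => //; [exact: linspan_mem|exact: linspanD].
Qed.

End linear_span.

(** * Even lattices containing a copy of A_2 *)

Section even_lattice.
Context (R : realType) (N : nat) (L : set 'rV[R]_N) (K : nat).
Hypotheses (K0 : (0 < K)%N) (LK : forall l, L l -> integral_vec (K%:R *: l)).
Hypotheses (L0 : L 0) (LB : forall k l, L k -> L l -> L (k - l)).
Hypothesis even : forall l, L l -> exists k : int, dot l l = (2 * k)%:~R.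

(** In an even lattice every vector of squared norm 2 defines a facet, and two of them at an angle
    of 60 degrees form the required pair. *)
Lemma even_lattice_not_refinable (u v : 'rV[R]_N) d (Q : 'M[R]_(d, N)) m la :
  L u -> L v -> dot u u = 2 -> dot v v = 2 -> dot u v = 1 ->
  orthonormal_basis (linspan L) Q -> (0 < m)%N -> 0 < la < 1 -> ~ refinable Q L m la.
Proof.
move=> Lu Lv uu vv uv hQ m0 la01.
have pos l : L l -> l != 0 -> exists k : int, dot l l = (2 * k)%:~R /\ 1 <= k.
  move=> Ll l0; have [k kE] := even Ll; exists k; split=> //.
  by have := dot_gt0 l0; rewrite kE ltr0z; lia.
(* Polarization: the norms of [w], [l] and [w - l] are all even. *)
have int w l : L w -> L l -> dot w w = 2 -> exists s : int, dot w l = s%:~R.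
  move=> Lw Ll ww; have [k kE] := even Ll; have [j jE] := even (LB Lw Ll).
  exists (1 + k - j); move: jE; rewrite !(dotBl, dotBr) (dotC l w) ww kE.
  rewrite !(intrD, intrM, intrB) => h; lra.
(* [q] is the circumcentre of the triangle 0, [u], [v]. *)
apply: (voronoi_spline_not_refinable K0 LK L0 LB Lu _ hQ (v := v) (q := 3^-1 *: (u + v))) => //.
- move=> l Ll l0 lu; have [k [kE k1]] := pos l Ll l0.
  have ul0 : u - l != 0 by rewrite subr_eq0 eq_sym.
  have [j [jE j1]] := pos _ (LB Lu Ll) ul0.
  have [s sE] := int u l Lu Ll uu.
  move: jE; rewrite !(dotBl, dotBr) (dotC l u) uu kE sE => h.
  rewrite ltr_int; have : 2 - s - (s - 2 * k) = 2 * j.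
    by apply/eqP; rewrite -(eqr_int R) -h !(intrD, intrM, intrB, mulrNz).
  lia.
- apply/voronoiP; split; first by apply/linspanZ/linspanD; exact: linspan_mem.
  move=> l Ll; have [k kE] := even Ll.
  have [s sE] := int u l Lu Ll uu; have [t tE] := int v l Lv Ll vv.
  have cs := dot_CS (u + v) l.
  rewrite dotZl dotDl sE tE kE mulrA.
  have : (s + t) * (s + t) <= 12 * k.
    rewrite -(ler_int R) !(intrD, intrM).
    move: cs; rewrite dotDl sE tE kE !(dotDl, dotDr) (dotC v u) uu vv uv !(intrD, intrM) expr2.
    by lra.
  have k0 : 0 <= k by have := dot_ge0 l; rewrite kE ler0z; lia.
  (* Cauchy-Schwarz gave [(s + t)^2 <= 12 k], whereas [(3 k + 1)^2 >= 15 k + 1] for integers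
     [k >= 0]. *)
  move=> h; have : s + t <= 3 * k.
    rewrite leNgt; apply/negP => w.
    have w1 : 3 * k + 1 <= s + t by lia.
    have k31 : 0 <= 3 * k + 1 by lia.
    have := ler_pM k31 k31 w1 w1; have kk : k <= k * k by nia.
    lia.
  rewrite -(ler_int R) !(intrD, intrM) => h2; lra.
- by rewrite dotZl dotDl uu (dotC v u) uv; lra.
- by rewrite dotZl dotDl vv uv; lra.
- by rewrite uv.
- by rewrite uv uu; lra.
Qed.

End even_lattice.

Section integral_vectors.
Context (R : realType).

Lemma integral_vecP N (x : 'rV[R]_N) : integral_vec x ->
  exists z : 'I_N -> int, forall i, x 0 i = (z i)%:~R.
Proof.
move=> hx; have H i : {z : int | x 0 i = z%:~R} by have /intrP/cid := hx i.
by exists (fun i => sval (H i)) => i; exact: (svalP (H i)).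
Qed.

Lemma half_integral_vecP N (x : 'rV[R]_N) : half_integral_vec x ->
  exists z : 'I_N -> int, forall i, x 0 i = (z i)%:~R + 2^-1.
Proof.
move=> hx; have H i : {z : int | x 0 i - 2^-1 = z%:~R} by have /intrP/cid := hx i.
by exists (fun i => sval (H i)) => i; rewrite -(svalP (H i)) subrK.
Qed.

Lemma int_mulS_even (z : int) : exists w : int, z * (z + 1) = 2 * w.
Proof.
have [a [->|->]] : exists a : int, z = 2 * a \/ z = 2 * a + 1.
  by exists (z %/ 2)%Z; lia.
- by exists (a * (2 * a + 1)); ring.
- by exists ((2 * a + 1) * (a + 1)); ring.
Qed.

Lemma sum_int_even (I : finType) (f : I -> int) : (forall i, exists w, f i = 2 * w) ->
  exists w, \sum_i f i = 2 * w.
Proof.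
move=> hf; have H i : {w | f i = 2 * w} by exact: cid (hf i).
exists (\sum_i sval (H i)); rewrite mulr_sumr; apply: eq_bigr => i _.
exact: (svalP (H i)).
Qed.

Lemma integral_even_norm N (x : 'rV[R]_N) : integral_vec x -> even_sum x ->
  exists k : int, dot x x = (2 * k)%:~R.
Proof.
move=> /integral_vecP[z xz] [k kE].
have [w wE] : exists w, \sum_i z i * (z i + 1) = 2 * w.
  by apply: sum_int_even => i; exact: int_mulS_even.
exists (w - k); have : (\sum_i z i)%:~R = (2 * k)%:~R :> R.
  by rewrite -kE rmorph_sum /=; apply: eq_bigr.
move/intr_inj => kE'.
have -> : dot x x = (\sum_i z i * z i)%:~R.
  by rewrite rmorph_sum /=; apply: eq_bigr => i _; rewrite !xz intrM.
congr intr; have : \sum_i z i * (z i + 1) = \sum_i z i * z i + \sum_i z i.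
  by rewrite -big_split /=; apply: eq_bigr => i _; ring.
lia.
Qed.

(** The square of [z + 1/2] is [z (z + 1) + 1/4], an even number plus a quarter, and the eight
    quarters add up to 2. *)
Lemma half_integral_even_norm (x : 'rV[R]_8) : half_integral_vec x ->
  exists k : int, dot x x = (2 * k)%:~R.
Proof.
move=> /half_integral_vecP[z xz].
have [w wE] : exists w, \sum_i z i * (z i + 1) = 2 * w.
  by apply: sum_int_even => i; exact: int_mulS_even.
exists (w + 1).
have -> : dot x x = (2 * w)%:~R + \sum_(i < 8) 4^-1.
  rewrite -wE rmorph_sum /= -big_split /=; apply: eq_bigr => i _.
  by rewrite !xz !(intrM, intrD) /=; field.
by rewrite sumr_const card_ord !(intrM, intrD) -mulr_natr; field.
Qed.

Lemma integral_vecB N (x y : 'rV[R]_N) : integral_vec x -> integral_vec y -> integral_vec (x - y).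
Proof. by move=> hx hy i; rewrite !mxE rpredB. Qed.

Lemma even_sumB N (x y : 'rV[R]_N) : even_sum x -> even_sum y -> even_sum (x - y).
Proof.
move=> [k kE] [j jE]; exists (k - j); rewrite mulrBr intrB -kE -jE -sumrB.
by apply: eq_bigr => i _; rewrite !mxE.
Qed.

Lemma dot_delta N (x : 'rV[R]_N) i : dot x (delta_mx 0 i) = x 0 i.
Proof.
rewrite /dot (bigD1 i)//= big1 => [|j ji]; rewrite !mxE ?eqxx ?mulr1 ?addr0//=.
by rewrite (negbTE ji) mulr0.
Qed.

Lemma delta_integral N (i : 'I_N) : integral_vec (delta_mx 0 i : 'rV[R]_N).
Proof. by move=> j; rewrite mxE; case: (_ && _). Qed.

Lemma sum_row N (x : 'rV[R]_N) : \sum_i x 0 i = dot x (const_mx 1).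
Proof. by apply: eq_bigr => i _; rewrite mxE mulr1. Qed.

Lemma sum_delta N (i : 'I_N) : \sum_j (delta_mx 0 i : 'rV[R]_N) 0 j = 1.
Proof. by rewrite sum_row dotC dot_delta mxE. Qed.

Lemma latA_not_refinable n d (Q : 'M[R]_(d, n.+1)) m la : (2 <= n)%N ->
  orthonormal_basis (linspan (@latA R n)) Q -> (0 < m)%N -> 0 < la < 1 -> ~ refinable Q (@latA R n) m la.
Proof.
move=> n2.
pose e i : 'rV[R]_n.+1 := delta_mx 0 i.
have H i : @latA R n (e ord0 - e i).
  split; first by apply: integral_vecB; exact: delta_integral.
  by rewrite sum_row dotBl -!sum_row !sum_delta subrr.
have n0 : (0 < n)%N by exact: leq_trans n2.
pose i1 := inord 1 : 'I_n.+1; pose i2 := inord 2 : 'I_n.+1.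
have i1v : i1 = 1%N :> nat by rewrite inordK.
have i2v : i2 = 2%N :> nat by rewrite inordK.
apply: (@even_lattice_not_refinable _ _ _ 1 isT _ _ _ _ (e ord0 - e i1) (e ord0 - e i2)) => //.
- by move=> l [hl _] i; rewrite mxE mul1r; exact: hl.
- by split; [move=> i; rewrite mxE; exact: rpred0 | rewrite sum_row dot0l].
- move=> k l [hk sk] [hl sl]; split; first exact: integral_vecB.
  by rewrite sum_row dotBl -!sum_row sk sl subrr.
- move=> l [hl sl]; apply: integral_even_norm => //.
  by exists 0; rewrite sl.
all: rewrite !(dotBl, dotBr) !dot_delta !mxE -!val_eqE /= ?i1v ?i2v /=; lra.
Qed.

Lemma latD_not_refinable n d (Q : 'M[R]_(d, n)) m la : (3 <= n)%N ->
  orthonormal_basis (linspan (@latD R n)) Q -> (0 < m)%N -> 0 < la < 1 -> ~ refinable Q (@latD R n) m la.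
Proof.
case: n Q => // n Q n3.
pose e i : 'rV[R]_n.+1 := delta_mx 0 i.
have H i : @latD R n.+1 (e ord0 - e i).
  split; first by apply: integral_vecB; exact: delta_integral.
  by exists 0; rewrite sum_row dotBl -!sum_row !sum_delta subrr.
pose i1 := inord 1 : 'I_n.+1; pose i2 := inord 2 : 'I_n.+1.
have i1v : i1 = 1%N :> nat by rewrite inordK// (leq_trans _ n3).
have i2v : i2 = 2%N :> nat by rewrite inordK.
apply: (@even_lattice_not_refinable _ _ _ 1 isT _ _ _ _ (e ord0 - e i1) (e ord0 - e i2)) => //.
- by move=> l [hl _] i; rewrite mxE mul1r; exact: hl.
- by split; [move=> i; rewrite mxE; exact: rpred0 | exists 0; rewrite sum_row dot0l].
- by move=> k l [hk sk] [hl sl]; split; [exact: integral_vecB | exact: even_sumB].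
- by move=> l [hl sl]; exact: integral_even_norm.
all: rewrite !(dotBl, dotBr) !dot_delta !mxE -!val_eqE /= ?i1v ?i2v /=; lra.
Qed.

(** * E_8 and its sublattices E_7 and E_6 *)

Lemma half_integral_double N (x : 'rV[R]_N) : half_integral_vec x -> integral_vec (2 *: x).
Proof.
move=> hx i; have /intrP[z zE] := hx i; apply/intrP; exists (2 * z + 1).
by rewrite mxE intrD intrM -zE; field.
Qed.

Lemma latE8_double l : @latE8 R l -> integral_vec (2%:R *: l).
Proof.
move=> [[hl|hl] _]; last exact: half_integral_double.
by move=> i; rewrite mxE rpredM ?rpred_nat// hl.
Qed.

Lemma latE8_0 : @latE8 R 0.
Proof.
split; first by left=> i; rewrite mxE rpred0.
by exists 0; rewrite sum_row dot0l.
Qed.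

Lemma latE8B k l : @latE8 R k -> @latE8 R l -> @latE8 R (k - l).
Proof.
move=> [hk sk] [hl sl]; split; last exact: even_sumB.
case: hk hl => hk [] hl.
- by left; exact: integral_vecB.
- right=> i; have /intrP[a aE] := hk i; have /intrP[b bE] := hl i; apply/intrP.
  by exists (a - b - 1); rewrite !mxE !intrB -aE -bE; field.
- right=> i; have /intrP[a aE] := hk i; have /intrP[b bE] := hl i; apply/intrP.
  by exists (a - b); rewrite !mxE !intrB -aE -bE; field.
- left=> i; have /intrP[a aE] := hk i; have /intrP[b bE] := hl i; apply/intrP.
  by exists (a - b); rewrite !mxE !intrB -aE -bE; field.
Qed.

Lemma latE8_even l : @latE8 R l -> exists k : int, dot l l = (2 * k)%:~R.
Proof.
move=> [[hl|hl] sl]; [exact: integral_even_norm | exact: half_integral_even_norm].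
Qed.

Lemma integral_norm2_support N (w : 'rV[R]_N) : integral_vec w -> dot w w = 2 ->
  (#|finset (fun i => (w 0 i != 0)%R)| <= 2)%N.
Proof.
move=> hw ww; rewrite -(ler_nat R) -ww -sum1_card natr_sum.
rewrite /dot [leRHS](bigID (fun i => i \in finset (fun i => (w 0 i != 0)%R))) /=.
rewrite -[leLHS]addr0 lerD//; last by apply: sumr_ge0 => i _; rewrite -expr2 sqr_ge0.
apply: ler_sum => i; rewrite inE => wi.
by rewrite -expr2 -real_normK ?num_real// exprn_ege1// norm_intr_ge1.
Qed.

(** Each squared entry is at least 1/4, and eight quarters already exhaust the norm 2. *)
Lemma half_norm2_entries (w : 'rV[R]_8) : half_integral_vec w -> dot w w = 2 ->
  forall i, w 0 i ^+ 2 = 4^-1.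
Proof.
move=> hw ww i.
have ge j : 0 <= w 0 j ^+ 2 - 4^-1.
  have /half_integral_vecP[z zE] := hw; rewrite zE.
  rewrite (_ : _ - _ = (z j * (z j + 1))%:~R); last by rewrite intrM intrD; field.
  by rewrite ler0z; case: (ltrP (z j) 0) => ?; nia.
have : \sum_j (w 0 j ^+ 2 - 4^-1) = 0.
  rewrite sumrB sumr_const card_ord (_ : \sum_j _ = 2).
    by rewrite -mulr_natr; field.
  by rewrite -ww; apply: eq_bigr => j _; rewrite expr2.
move=> /eqP; rewrite psumr_eq0// => /allP/(_ i (mem_index_enum _)) /=.
by rewrite subr_eq0 => /eqP.
Qed.

(* On three such coordinates [w] and [w'] agree up to common signs, so that vectors
   of shape (1, +-1, 0) and (1, 0, +-1) span an A_2 orthogonal to both. *)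
Lemma latE8_three_coordinates (w w' : 'rV[R]_8) :
  @latE8 R w -> @latE8 R w' -> dot w w = 2 -> dot w' w' = 2 ->
  exists S : {set 'I_8}, (2 < #|S|)%N /\ exists a b c : R, forall i, i \in S ->
    [/\ w 0 i ^+ 2 = a, w' 0 i ^+ 2 = b & w 0 i * w' 0 i = c].
Proof.
move=> [hw _] [hw' _] ww ww'; case: hw hw' => hw [] hw'.
- exists (~: (finset (fun i => (w 0 i != 0)%R) :|: finset (fun i => (w' 0 i != 0)%R)))%SET; split.
    rewrite cardsCs finset.setCK card_ord ltn_subRL.
    apply: (@leq_ltn_trans (2 + 2 + 2)) => //; rewrite leq_add2r.
    apply: leq_trans (leq_card_setU _ _) _.
    by apply: leq_add; exact: integral_norm2_support.
  exists 0, 0, 0 => i; rewrite !inE negb_or !negbK => /andP[/eqP -> /eqP ->].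
  by rewrite mul0r expr0n.
- have e' := half_norm2_entries hw' ww'.
  exists (~: finset (fun i => (w 0 i != 0)%R))%SET; split.
    rewrite cardsCs finset.setCK card_ord ltn_subRL.
    by apply: (@leq_ltn_trans (2 + 2)) => //; rewrite leq_add2r; exact: integral_norm2_support.
  exists 0, 4^-1, 0 => i; rewrite !inE negbK => /eqP ->.
  by rewrite mul0r expr0n.
- have e := half_norm2_entries hw ww.
  exists (~: finset (fun i => (w' 0 i != 0)%R))%SET; split.
    rewrite cardsCs finset.setCK card_ord ltn_subRL.
    by apply: (@leq_ltn_trans (2 + 2)) => //; rewrite leq_add2r; exact: integral_norm2_support.
  exists 4^-1, 0, 0 => i; rewrite !inE negbK => /eqP ->.
  by rewrite mulr0 expr0n.
- have e := half_norm2_entries hw ww; have e' := half_norm2_entries hw' ww'.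
  pose P := finset (fun i => (w 0 i * w' 0 i == 4^-1)%R).
  have pm i : i \notin P -> w 0 i * w' 0 i = - 4^-1.
    rewrite inE => ne; have : (w 0 i * w' 0 i - 4^-1) * (w 0 i * w' 0 i + 4^-1) = 0.
      rewrite (_ : _ * _ = w 0 i ^+ 2 * w' 0 i ^+ 2 - 4^-1 * 4^-1); last by ring.
      by rewrite e e' subrr.
    by move=> /eqP; rewrite mulf_eq0 subr_eq0 (negbTE ne)/= addr_eq0 => /eqP.
  (* All eight products are [1/4] or [- 1/4]; if at most two are positive, at least six are
     negative. *)
  have [P3|P3] := ltnP 2 #|P|.
    by exists P; split=> //; exists 4^-1, 4^-1, 4^-1 => i; rewrite inE => /eqP ->.
  exists (~: P)%SET; split.
    rewrite cardsCs finset.setCK card_ord ltn_subRL.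
    by apply: (@leq_ltn_trans (2 + 2)) => //; rewrite leq_add2r.
  by exists 4^-1, 4^-1, (- 4^-1) => i; rewrite inE => /pm ->.
Qed.

Lemma equal_up_to_sign (a b a' b' : R) : a ^+ 2 = a' ^+ 2 -> b ^+ 2 = b' ^+ 2 ->
  a * b = a' * b' -> exists s : bool, a = (-1) ^+ s * a' /\ b = (-1) ^+ s * b'.
Proof.
move=> /eqP; rewrite eqf_sqr => aa /eqP; rewrite eqf_sqr => bb ab.
have [a0|an0] := eqVneq a 0.
  have a'0 : a' = 0 by case/orP: aa => /eqP; rewrite a0 => /esym/eqP; rewrite ?oppr_eq0 => /eqP.
  case/orP: bb => /eqP bE.
    by exists false; rewrite a0 a'0 mulr0 mul1r.
  by exists true; rewrite a0 a'0 mulr0 mulN1r.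
case/orP: aa => /eqP aE.
  exists false; rewrite !mul1r; split=> //; apply: (mulfI an0).
  by rewrite ab aE.
exists true; rewrite !mulN1r; split=> //; apply: (mulfI an0).
by rewrite ab aE mulrNN.
Qed.

(** One statement for three lattices: [w] and [w'] are a basis of the copy of A_2 for E_6, the same
    vector twice for E_7, and an arbitrary root, with [M] empty, for E_8. *)
Lemma latE8_orthogonal_not_refinable (M : set 'rV[R]_8) (w w' : 'rV[R]_8)
    d (Q : 'M[R]_(d, 8)) m la :
  @latE8 R w -> @latE8 R w' -> dot w w = 2 -> dot w' w' = 2 ->
  (forall x, dot x w = 0 -> dot x w' = 0 -> orthogonal_to M x) ->
  orthonormal_basis (linspan (@latE8 R `&` orthogonal_to M)) Q ->
  (0 < m)%N -> 0 < la < 1 -> ~ refinable Q (@latE8 R `&` orthogonal_to M) m la.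
Proof.
move=> Ew Ew' ww ww' hM.
have [S [S3 [a [b [c hS]]]]] := latE8_three_coordinates Ew Ew' ww ww'.
have /card_gt2P[i [j [k [[iS jS kS] [ij jk ki]]]]] := S3.
have [iw iw' iww] := hS i iS; have [jw jw' jww] := hS j jS; have [kw kw' kww] := hS k kS.
have [s [sw sw']] : exists s : bool, w 0 i = (-1) ^+ s * w 0 j /\ w' 0 i = (-1) ^+ s * w' 0 j.
  by apply: equal_up_to_sign; rewrite ?iw ?iw' ?iww.
have [t [tw tw']] : exists s : bool, w 0 i = (-1) ^+ s * w 0 k /\ w' 0 i = (-1) ^+ s * w' 0 k.
  by apply: equal_up_to_sign; rewrite ?iw ?iw' ?iww.
pose e l : 'rV[R]_8 := delta_mx 0 l.
pose u (s : bool) l := e i - (-1) ^+ s *: e l.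
have dotu r l x : dot x (u r l) = x 0 i - (-1) ^+ r * x 0 l.
  by rewrite dotBr dotZr !dot_delta.
have Lu (r : bool) l : w 0 i = (-1) ^+ r * w 0 l -> w' 0 i = (-1) ^+ r * w' 0 l ->
    (@latE8 R `&` orthogonal_to M) (u r l).
  move=> h h'; split; last by apply: hM; rewrite dotC dotu ?h ?h' subrr.
  split.
    left; apply: integral_vecB; first exact: delta_integral.
    by move=> z; rewrite mxE rpredMsign; exact: delta_integral.
  rewrite /even_sum sum_row dotBl dotZl -!sum_row !sum_delta mulr1.
  by case: r {h h'}; [exists 1; rewrite opprK | exists 0; rewrite subrr].
apply: (@even_lattice_not_refinable _ _ _ 2 isT _ _ _ _ (u s j) (u t k)) => //.
- by move=> l [hl _]; exact: latE8_double.
- by split; [exact: latE8_0 | move=> z _; rewrite dot0l].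
- move=> p q [hp op] [hq oq]; split; first exact: latE8B.
  by move=> z Mz; rewrite dotBl op// oq// subrr.
- by move=> l [hl _]; exact: latE8_even.
- exact: Lu.
- exact: Lu.
- rewrite dotu !mxE !eqxx /= (negbTE ij) [j == i]eq_sym (negbTE ij) /=.
  by rewrite mulr0 subr0 mulr1 sub0r mulrN opprK -expr2 sqrr_sign; lra.
- rewrite dotu !mxE !eqxx /= (negbTE ki) [i == k]eq_sym (negbTE ki) /=.
  by rewrite mulr0 subr0 mulr1 sub0r mulrN opprK -expr2 sqrr_sign; lra.
- rewrite dotu !mxE !eqxx /= (negbTE ki) (negbTE ij) [k == j]eq_sym (negbTE jk) /=.
  by rewrite !mulr0; lra.
Qed.

Lemma latE6_not_refinable (M : set 'rV[R]_8) d (Q : 'M[R]_(d, 8)) m la :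
  M `<=` @latE8 R -> isometric (@latA R 2) M ->
  orthonormal_basis (linspan (@latE8 R `&` orthogonal_to M)) Q ->
  (0 < m)%N -> 0 < la < 1 -> ~ refinable Q (@latE8 R `&` orthogonal_to M) m la.
Proof.
move=> ME [f [_ fdot fM]].
pose e i : 'rV[R]_3 := delta_mx 0 i.
have H i j : @latA R 2 (e i - e j).
  split; first by apply: integral_vecB; exact: delta_integral.
  by rewrite sum_row dotBl -!sum_row !sum_delta subrr.
pose i0 : 'I_3 := inord 0; pose i1 : 'I_3 := inord 1; pose i2 : 'I_3 := inord 2.
have i0v : i0 = 0%N :> nat by rewrite inordK.
have i1v : i1 = 1%N :> nat by rewrite inordK.
have i2v : i2 = 2%N :> nat by rewrite inordK.
have [a aE] : exists a, a = e i0 - e i1 by eexists.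
have [b bE] : exists b, b = e i1 - e i2 by eexists.
have La : @latA R 2 a by rewrite aE.
have Lb : @latA R 2 b by rewrite bE.
(* [f] is controlled only on the lattice, so linearity is obtained from the norm of the difference,
   which expands into dot products that [f] preserves. *)
have fa l : @latA R 2 l -> f l = l 0 i0 *: f a - l 0 i2 *: f b.
  move=> Ll; apply/eqP; rewrite -subr_eq0; apply/eqP/dot_eq0.
  have -> : dot (f l - (l 0 i0 *: f a - l 0 i2 *: f b)) (f l - (l 0 i0 *: f a - l 0 i2 *: f b)) =
      dot (l - (l 0 i0 *: a - l 0 i2 *: b)) (l - (l 0 i0 *: a - l 0 i2 *: b)).
    by rewrite !(dotBl, dotBr, dotZl, dotZr) (fdot _ _ Ll Ll) (fdot _ _ Ll La)
      (fdot _ _ Ll Lb) (fdot _ _ La Ll) (fdot _ _ Lb Ll) (fdot _ _ La La)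
      (fdot _ _ La Lb) (fdot _ _ Lb La) (fdot _ _ Lb Lb).
  suff -> : l - (l 0 i0 *: a - l 0 i2 *: b) = 0 by rewrite dot0l.
  have [_] := Ll; rewrite !big_ord_recl big_ord0 addr0.
  have -> : ord0 = i0 by apply/val_inj; rewrite /= i0v.
  have -> : lift i0 (ord0 : 'I_2) = i1 by apply/val_inj; rewrite /= i0v i1v.
  have -> : lift i0 (lift ord0 (ord0 : 'I_1)) = i2 by apply/val_inj; rewrite /= i0v i2v.
  move=> s0; apply/rowP => j; rewrite aE bE !mxE.
  have : [\/ j = i0, j = i1 | j = i2].
    by case: j => -[|[|[|//]]] hj; [constructor 1|constructor 2|constructor 3];
       apply/val_inj; rewrite /= ?i0v ?i1v ?i2v.
  by case=> ->; rewrite -!val_eqE /= ?i0v ?i1v ?i2v /=; lra.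
have Mf l : @latA R 2 l -> M (f l) by move=> Ll; rewrite -fM; exists l.
apply: (@latE8_orthogonal_not_refinable M (f a) (f b)).
- exact/ME/Mf.
- exact/ME/Mf.
- rewrite fdot// ?aE ?bE !(dotBl, dotBr) !dot_delta !mxE -!val_eqE /= ?i0v ?i1v ?i2v /=; lra.
- rewrite fdot// ?aE ?bE !(dotBl, dotBr) !dot_delta !mxE -!val_eqE /= ?i0v ?i1v ?i2v /=; lra.
- move=> x xa xb z; rewrite -fM => -[l Ll <-].
  by rewrite fa// dotBr !dotZr xa xb !mulr0 subrr.
Qed.

Lemma latE7_not_refinable (v : 'rV[R]_8) d (Q : 'M[R]_(d, 8)) m la :
  @latE8 R v -> dot v v = 2 ->
  orthonormal_basis (linspan (@latE8 R `&` orthogonal_to [set v])) Q ->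
  (0 < m)%N -> 0 < la < 1 -> ~ refinable Q (@latE8 R `&` orthogonal_to [set v]) m la.
Proof.
move=> Ev vv; apply: (@latE8_orthogonal_not_refinable [set v] v v) => //.
by move=> x xv _ z ->.
Qed.

Lemma latE8_not_refinable d (Q : 'M[R]_(d, 8)) m la :
  orthonormal_basis (linspan (@latE8 R)) Q ->
  (0 < m)%N -> 0 < la < 1 -> ~ refinable Q (@latE8 R) m la.
Proof.
have -> : @latE8 R = @latE8 R `&` orthogonal_to set0.
  by apply/seteqP; split=> [x Ex|x []//]; split.
pose w : 'rV[R]_8 := delta_mx 0 ord0 - delta_mx 0 ord_max.
have Ew : @latE8 R w.
  split; first by left; apply: integral_vecB; exact: delta_integral.
  by exists 0; rewrite sum_row dotBl -!sum_row !sum_delta subrr.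
have ww : dot w w = 2.
  by rewrite !(dotBl, dotBr) !dot_delta !mxE /=; lra.
by apply: (@latE8_orthogonal_not_refinable set0 w w) => // x _ _ z [].
Qed.

(** * Dual lattices and the case D_n^* *)

Lemma dual0 N (L : set 'rV[R]_N) : L 0 -> dual L 0.
Proof.
by move=> L0; split; [exact: linspan_mem | move=> x _; rewrite dot0r rpred0].
Qed.

Lemma dualB N (L : set 'rV[R]_N) k l : dual L k -> dual L l -> dual L (k - l).
Proof.
move=> [Ek hk] [El hl]; split.
  by apply: linspanD => //; rewrite -scaleN1r; exact: linspanZ.
by move=> x Lx; rewrite dotBr rpredB ?hk ?hl.
Qed.

Lemma linspan_full N (L : set 'rV[R]_N) x : (forall i, L (delta_mx 0 i)) -> linspan L x.
Proof.
move=> h; exists N, 1%:M; split; last exact: submx1.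
by move=> i; rewrite rowE mulmx1; exact: h.
Qed.

Lemma dual_latD_not_refinable n d (Q : 'M[R]_(d, n)) m la : (3 <= n)%N ->
  orthonormal_basis (linspan (dual (@latD R n))) Q ->
  (0 < m)%N -> 0 < la < 1 -> ~ refinable Q (dual (@latD R n)) m la.
Proof.
case: n Q => // n Q n3.
pose e i : 'rV[R]_n.+1 := delta_mx 0 i.
pose L := @latD R n.+1.
have HD (s : bool) i j : L (e i - (-1) ^+ s *: e j).
  split.
    apply: integral_vecB; first exact: delta_integral.
    by move=> z; rewrite mxE rpredMsign; exact: delta_integral.
  rewrite /even_sum sum_row dotBl dotZl -!sum_row !sum_delta mulr1.
  by case: s; [exists 1; rewrite opprK | exists 0; rewrite subrr].
have L0 : L 0 by have := HD false ord0 ord0; rewrite expr0 scale1r subrr.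
have Ee i : linspan L (e i).
  have -> : e i = 2^-1 *: (e i - (-1) ^+ true *: e ord0) + 2^-1 *: (e i - (-1) ^+ false *: e ord0).
    by apply/rowP => z; rewrite !mxE /=; field.
  by apply: linspanD; apply/linspanZ/linspan_mem; exact: HD.
have EL x : linspan L x.
  have -> : x = \sum_i x 0 i *: e i by rewrite -row_sum_delta.
  by apply: linspan_sum => // i; exact: linspanZ.
have dualE i : dual L (e i).
  by split=> // x [hx _]; rewrite dot_delta.
(* The case [i = j] with sign plus says that [2 * l 0 i] is an integer; with the differences this
   yields the two classes of [dual_half]. *)
have int_pm (s : bool) l i j : dual L l -> l 0 i - (-1) ^+ s * l 0 j \is a Num.int.
  by move=> [_ /(_ _ (HD s i j))]; rewrite dotBl dotZl !(dotC _ l) !dot_delta.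
have dual_half l : dual L l -> integral_vec l \/ half_integral_vec l.
  move=> Dl; have /intrP[z zE] : 2 * l 0 ord0 \is a Num.int.
    by have := int_pm true l ord0 ord0 Dl; rewrite expr1 mulN1r opprK (_ : 2 * _ = l 0 ord0 + l 0 ord0)//; ring.
  have [a [za|za]] : exists a : int, z = 2 * a \/ z = 2 * a + 1.
    by exists (z %/ 2)%Z; lia.
  - left=> i; have /intrP[y yE] := int_pm false l i ord0 Dl; apply/intrP; exists (y + a).
    move: zE yE; rewrite za expr0 mul1r !(intrD, intrM) => zE <-; lra.
  - right=> i; have /intrP[y yE] := int_pm false l i ord0 Dl; apply/intrP; exists (y + a).
    move: zE yE; rewrite za expr0 mul1r !(intrD, intrM) => zE <-; lra.
pose v : 'rV[R]_n.+1 := const_mx 2^-1.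
have Dv : dual L v.
  split=> // x [_ [k kE]]; apply/intrP; exists k.
  have -> : dot x v = 2^-1 * \sum_i x 0 i.
    by rewrite /dot mulr_sumr; apply: eq_bigr => i _; rewrite mxE mulrC.
  by rewrite kE intrM; field.
have nR : 2 <= n%:R :> R by rewrite ler_nat.
(* The value of the last coordinates is forced by [2 * dot q v = dot v v]. *)
pose q : 'rV[R]_n.+1 := \row_i (if i == ord0 then 2^-1 else (n%:R - 1) / (4 * n%:R)).
have q_range i : 0 <= q 0 i <= 2^-1.
  rewrite mxE; case: ifP => _; first by rewrite lexx andbT invr_ge0.
  apply/andP; split; first by rewrite divr_ge0//; lra.
  by rewrite ler_pdivrMr; lra.
have q_sum : \sum_i q 0 i = n.+1%:R / 4.
  rewrite (bigD1 ord0)//= mxE eqxx (eq_bigr (fun=> (n%:R - 1) / (4 * n%:R))) => [|i i0].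
    rewrite sumr_const (_ : #|_| = n); last by rewrite cardC1 card_ord.
    rewrite -mulr_natr -natr1; field; rewrite pnatr_eq0; lia.
  by rewrite mxE (negbTE i0).
have uv : dot (e ord0) v = 2^-1 by rewrite dotC dot_delta mxE.
have uu : dot (e ord0) (e ord0) = 1 by rewrite dot_delta mxE eqxx.
have sumsq (l : 'rV[R]_n.+1) : l 0 ord0 ^+ 2 + \sum_(i | i != ord0) l 0 i ^+ 2 = dot l l.
  by rewrite /dot [RHS](bigD1 ord0)//= expr2; congr (_ + _); apply: eq_bigr => i _; rewrite expr2.
have sq_half (l : 'rV[R]_n.+1) i : half_integral_vec l -> 4^-1 <= l 0 i ^+ 2.
  move=> /half_integral_vecP[z zE]; rewrite zE -subr_ge0.
  rewrite (_ : _ - _ = (z i * (z i + 1))%:~R); last by rewrite intrM intrD; field.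
  by rewrite ler0z; case: (ltrP (z i) 0) => ?; nia.
move=> hQ m0 la01.
apply: (@voronoi_spline_not_refinable _ _ _ 2 isT _ _ _ (e ord0) _ _ _ _ _ v q) => //.
- by move=> l /dual_half[hl|hl]; [move=> i; rewrite mxE rpredM ?rpred_nat// hl | exact: half_integral_double].
- exact: dual0.
- exact: dualB.
- move=> l Dl l0 lu; rewrite dotC dot_delta -sumsq.
  have sum0 : 0 <= \sum_(i | i != ord0) l 0 i ^+ 2 by apply: sumr_ge0 => i _; exact: sqr_ge0.
  (* For a half-integral [l] the other [n >= 2] entries contribute at least 1/2, and
     [l 0 ord0 ^+ 2 - l 0 ord0 + 1/2] is positive. *)
  case: (dual_half l Dl) => hl; last first.
    have : \sum_(i | i != ord0 :> 'I_n.+1) 4^-1 <= \sum_(i | i != ord0) l 0 i ^+ 2.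
      by apply: ler_sum => i _; exact: sq_half.
    rewrite sumr_const (_ : #|_| = n); last by rewrite cardC1 card_ord.
    rewrite -mulr_natr => h; nra.
  have /integral_vecP[z zE] := hl.
  have z0 : l 0 ord0 <= l 0 ord0 ^+ 2 by rewrite zE expr2 -intrM ler_int; nia.
  rewrite lt_neqAle; apply/andP; split; last by lra.
  apply/negP => /eqP E.
  have s0 : \sum_(i | i != ord0) l 0 i ^+ 2 = 0 by lra.
  have li i : i != ord0 -> l 0 i = 0.
    move=> i0; move/eqP: s0; rewrite psumr_eq0 => [|j _]; last exact: sqr_ge0.
    by move=> /allP/(_ i (mem_index_enum _)); rewrite i0 /= sqrf_eq0 => /eqP.
  have : l 0 ord0 * (l 0 ord0 - 1) = 0 by rewrite s0 addr0 in E; rewrite mulrBr mulr1 -expr2 -E subrr.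
  move=> /eqP; rewrite mulf_eq0 subr_eq0 => /orP[] /eqP l00.
    move/eqP: l0; apply; apply/rowP => i; rewrite mxE.
    by have [->|/li] := eqVneq i ord0.
  move/eqP: lu; apply; apply/rowP => i; rewrite mxE /=.
  by have [->|i0] := eqVneq i ord0; rewrite ?l00 ?li.
- apply/voronoiP; split; first exact: linspan_full.
  move=> l Dl; rewrite {1}/dot mulr_sumr.
  case: (dual_half l Dl) => hl.
    apply: ler_sum => i _; have /andP[q0 q1] := q_range i.
    have /integral_vecP[z zE] := hl.
    have za : l 0 i <= l 0 i * l 0 i /\ - l 0 i <= l 0 i * l 0 i.
      by rewrite zE -intrM -mulrNz !ler_int; split; nia.
    have sq := sqr_ge0 (l 0 i); rewrite expr2 in sq.
    have [h1 h2] := za; case: (ler0P (l 0 i)) => hi; nra.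
  (* The corrections cancel in the sum, since the entries of [q] add up to [n.+1%:R / 4]. Each
     single inequality amounts to [(l_i - 1/2) (l_i + 1/2 - 2 q_i) >= 0], true because half-integers
     avoid the open interval from -1/2 to 1/2, which contains no root of either factor. *)
  apply: (@le_trans _ _ (\sum_i (l 0 i * l 0 i - 4^-1 + q 0 i))).
    apply: ler_sum => i _; have /andP[q0 q1] := q_range i.
    have /half_integral_vecP[z zE] := hl.
    have : l 0 i <= - 2^-1 \/ 2^-1 <= l 0 i.
      rewrite zE; case: (ltrP (z i) 0) => hz.
        have : (z i)%:~R <= (-1)%:~R :> R by rewrite ler_int; lia.
        by rewrite mulrN1z => h; left; lra.
      have : 0 <= (z i)%:~R :> R by rewrite ler0z.
      by move=> h; right; lra.
    have : 0 <= (l 0 i - 2^-1) * (l 0 i + 2^-1 - 2 * q 0 i) -> 2 * (q 0 i * l 0 i) <= l 0 i * l 0 i - 4^-1 + q 0 i.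
      by move=> h; lra.
    by move=> H [h|h]; apply: H; [apply: mulr_le0; lra | apply: mulr_ge0; lra].
  rewrite big_split sumrB /= q_sum sumr_const card_ord -mulr_natr.
  by rewrite (_ : _ + _ = dot l l)//; rewrite /dot -natr1; field.
- by rewrite dot_delta mxE eqxx uu; field.
- rewrite /dot mulr_sumr (eq_bigr (fun i => q 0 i)) => [|i _]; last by rewrite !mxE; field.
  rewrite q_sum (eq_bigr (fun=> 4^-1)) => [|i _]; last by rewrite !mxE; field.
  by rewrite sumr_const card_ord -[RHS]mulr_natr mulrC.
- by rewrite uv.
- by rewrite uv uu; lra.
Qed.

End integral_vectors.

(** * The case A_n^* *)

Section dual_latA.
Context (R : realType).

Lemma sum_ltn_ord s i : (i <= s)%N -> \sum_(j < s) (j < i)%N%:R = i%:R :> R.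
Proof.
elim: s => [|s IH] in i *; first by rewrite leqn0 => /eqP ->; rewrite big_ord0.
rewrite leq_eqVlt => /orP[/eqP ->|]; last first.
  rewrite ltnS => le; rewrite big_ord_recr /= IH// ltnNge le addr0//.
rewrite (eq_bigr (fun=> 1)) => [|j _]; last by rewrite ltn_ord.
by rewrite sumr_const card_ord.
Qed.

(** Vectors of the dual have sum zero and integral coordinate differences; norms and dot products
    are rewritten as sums over pairs of coordinates, where [a <= a ^+ 2] for integers [a] does the
    work. *)
Lemma dual_latA_not_refinable n d (Q : 'M[R]_(d, n.+1)) m la : (2 <= n)%N ->
  orthonormal_basis (linspan (dual (@latA R n))) Q ->
  (0 < m)%N -> 0 < la < 1 -> ~ refinable Q (dual (@latA R n)) m la.
Proof.
move=> n2.
pose e i : 'rV[R]_n.+1 := delta_mx 0 i.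
pose L := @latA R n; pose s : R := n.+1%:R.
have n0 : (0 < n)%N by exact: leq_trans n2.
have s0 : 0 < s by rewrite ltr0n.
have sn : s = n%:R + 1 by rewrite /s -natr1.
have nR : 2 <= n%:R :> R by rewrite ler_nat.
have H i j : L (e i - e j).
  split; first by apply: integral_vecB; exact: delta_integral.
  by rewrite sum_row dotBl -!sum_row !sum_delta subrr.
have L0 : L 0 by have := H ord0 ord0; rewrite subrr.
have span_sum x : linspan L x -> \sum_i x 0 i = 0.
  move=> [k [B [LB /submxP[D ->]]]]; rewrite sum_row mulmx_sum_row dot_suml big1// => i _.
  by rewrite dotZl -sum_row (LB i).2 mulr0.
have dual_sum l : dual L l -> \sum_i l 0 i = 0 by move=> [/span_sum].
pose p i : 'rV[R]_n.+1 := e i - const_mx s^-1.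
have pE i j : p i 0 j = (j == i)%:R - s^-1 by rewrite !mxE.
have dotp (x : 'rV[R]_n.+1) i : \sum_i x 0 i = 0 -> dot x (p i) = x 0 i.
  move=> x0; rewrite dotBr dot_delta (_ : const_mx s^-1 = s^-1 *: const_mx 1).
    by rewrite dotZr -sum_row x0 mulr0 subr0.
  by apply/rowP => j; rewrite !mxE mulr1.
have Dp i : dual L (p i).
  split; last by move=> x [hx x0]; rewrite dotp.
  have -> : p i = s^-1 *: \sum_j (e i - e j).
    apply/rowP => j; rewrite pE mxE summxE (eq_bigr (fun k => (j == i)%:R - (j == k)%:R)).
      rewrite sumrB sumr_const card_ord -[_ *+ n.+1]mulr_natr -/s (bigD1 j)//= eqxx big1 => [|k kj].
        by rewrite addr0 /= mulr1n; field; rewrite gt_eqF.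
      by rewrite eq_sym (negbTE kj).
    by move=> k _; rewrite !mxE.
  by apply/linspanZ/linspan_sum => // j; exact: linspan_mem.
have dual_diff l i j : dual L l -> exists a : int, l 0 i - l 0 j = a%:~R.
  move=> [_ /(_ _ (H i j))]; rewrite dotBl !(dotC _ l) !dot_delta => /intrP[a aE].
  by exists a.
have sqsum (l : 'rV[R]_n.+1) : \sum_i l 0 i = 0 -> \sum_i \sum_j (l 0 i - l 0 j) ^+ 2 = 2 * s * dot l l.
  move=> l0; transitivity (\sum_i (s * l 0 i ^+ 2 + dot l l)).
    apply: eq_bigr => i _.
    transitivity (\sum_j (l 0 i ^+ 2 - 2 * l 0 i * l 0 j + l 0 j * l 0 j)).
      by apply: eq_bigr => j _; ring.
    rewrite big_split sumrB /= sumr_const card_ord -mulr_sumr l0 mulr0 subr0.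
    by rewrite -mulr_natr -/s mulrC.
  rewrite big_split /= sumr_const card_ord -mulr_sumr -mulr_natr -/s.
  rewrite (_ : \sum_i l 0 i ^+ 2 = dot l l); first by ring.
  by apply: eq_bigr => i _; rewrite expr2.
pose i1 : 'I_n.+1 := inord 1.
have i1v : i1 = 1%N :> nat by rewrite inordK.
have i10 : i1 != ord0 by rewrite -val_eqE /= i1v.
(* The Weyl vector of A_n divided by [n + 1], a vertex of the permutohedron. *)
pose q : 'rV[R]_n.+1 := \row_i ((n%:R - 2 * i%:R) / (2 * s)).
have sg (i : 'I_n.+1) : \sum_(j < n.+1) ((i < j)%N%:R - (j < i)%N%:R) = n%:R - 2 * i%:R :> R.
  rewrite sumrB sum_ltn_ord; last exact/ltnW/ltn_ord.
  rewrite (eq_bigr (fun j : 'I_n.+1 => 1 - (j < i.+1)%N%:R)) => [|j _].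
    by rewrite sumrB sum_ltn_ord ?ltn_ord// sumr_const card_ord -!natr1; ring.
  by rewrite ltnS ltnNge; case: (j <= i)%N; rewrite ?subrr ?subr0.
(* The Weyl vector is half the sum of the positive roots, so its dot product with [l] is a signed
   sum of coordinate differences; each term is at most the corresponding square in [sqsum]. *)
have qpair (l : 'rV[R]_n.+1) : \sum_i l 0 i = 0 -> 4 * s * dot q l =
    \sum_(i < n.+1) \sum_(j < n.+1) ((i < j)%N%:R - (j < i)%N%:R) * (l 0 i - l 0 j).
  move=> l0.
  have -> : \sum_(i < n.+1) \sum_(j < n.+1) ((i < j)%N%:R - (j < i)%N%:R) * (l 0 i - l 0 j) =
      \sum_(i < n.+1) (\sum_(j < n.+1) ((i < j)%N%:R - (j < i)%N%:R)) * l 0 i +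
      \sum_(j < n.+1) (\sum_(i < n.+1) ((j < i)%N%:R - (i < j)%N%:R)) * l 0 j.
    under [X in X + _]eq_bigr do rewrite mulr_suml.
    under [X in _ + X]eq_bigr do rewrite mulr_suml.
    rewrite [X in _ + X]exchange_big -big_split; apply: eq_bigr => i _ /=.
    by rewrite -big_split; apply: eq_bigr => j _ /=; ring.
  rewrite -mulr2n -[RHS]mulr_natr; under [X in X * 2]eq_bigr do rewrite sg.
  rewrite /dot mulr_sumr mulr_suml; apply: eq_bigr => i _; rewrite mxE; field.
  exact: lt0r_neq0.
have q0 : \sum_i q 0 i = 0.
  pose D (i j : 'I_n.+1) : R := (i < j)%N%:R - (j < i)%N%:R.
  have qD : \sum_i q 0 i = (2 * s)^-1 * \sum_i \sum_j D i j.
    by rewrite mulr_sumr; apply: eq_bigr => i _; rewrite mxE sg mulrC.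
  suff h : \sum_i \sum_j D i j = - \sum_i \sum_j D i j.
    by rewrite qD (_ : \sum_i \sum_j D i j = 0) ?mulr0//; lra.
  rewrite [LHS]exchange_big -sumrN; apply: eq_bigr => i _ /=.
  by rewrite -sumrN; apply: eq_bigr => j _; rewrite opprB.
have Dq i : q 0 i = (n%:R - 2 * i%:R) / (2 * s) by rewrite mxE.
have Vspan (x : 'rV[R]_n.+1) : \sum_i x 0 i = 0 -> linspan (dual L) x.
  move=> x0; have -> : x = \sum_i x 0 i *: p i.
    apply/rowP => j; rewrite summxE; under eq_bigr do rewrite mxE pE mulrBr.
    rewrite sumrB -mulr_suml x0 mul0r subr0 (bigD1 j)//= eqxx mulr1 big1 ?addr0// => i ij.
    by rewrite eq_sym (negbTE ij) mulr0.
  by apply: linspan_sum => [|i]; [exact: dual0 | exact/linspanZ/linspan_mem].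
have p_sum i : \sum_j p i 0 j = 0 by exact: dual_sum.
have uu : dot (p ord0) (p ord0) = n%:R / s.
  by rewrite dotp// pE eqxx sn /= mulr1n; field; rewrite -sn gt_eqF.
have uv : dot (p ord0) (p ord0 + p i1) = (n%:R - 1) / s.
  by rewrite dotDr !dotp// !pE eqxx (negbTE i10) sn /= mulr1n mulr0n; field; rewrite -sn gt_eqF.
have vv : dot (p ord0 + p i1) (p ord0 + p i1) = 2 * (n%:R - 1) / s.
  rewrite dotDl ![dot _ (p ord0 + _)]dotDr !dotp// !pE !eqxx [ord0 == _]eq_sym (negbTE i10) sn /= mulr1n mulr0n.
  by field; rewrite -sn gt_eqF.
move=> hQ m0 la01.
apply: (@voronoi_spline_not_refinable _ _ _ n.+1 isT _ _ _ (p ord0) _ _ _ _ _ (p ord0 + p i1) q) => //.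
- move=> l Dl i; rewrite mxE.
  have -> : n.+1%:R * l 0 i = \sum_j (l 0 i - l 0 j).
    by rewrite sumrB dual_sum// subr0 sumr_const card_ord mulr_natl.
  by apply: rpred_sum => j _; have [a ->] := dual_diff l i j Dl; apply: rpred_int_num.
- exact: dual0.
- exact: dualB.
- move=> l Dl l0 lu; have ls := dual_sum l Dl.
  (* With [a_j = l_0 - l_j], one has [2 s |l|^2 = 2 W + U] and [s l_0 = \sum_j a_j <= W]. If
     [|l|^2 <= l_0], all estimates are equalities: every [a_j] is 0 or 1 and the entries off [ord0]
     coincide, which leaves only 0 and [p ord0]. *)
  rewrite dotC dotp// ltNge; apply/negP => ll.
  have a_sq i j : 0 <= (l 0 i - l 0 j) ^+ 2 - (l 0 i - l 0 j).
    have [a ->] := dual_diff l i j Dl; rewrite subr_ge0 expr2 -intrM ler_int; nia.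
  have T0 : \sum_j ((l 0 ord0 - l 0 j) ^+ 2 - (l 0 ord0 - l 0 j)) = 
    \sum_j (l 0 ord0 - l 0 j) ^+ 2 - s * l 0 ord0.
    by rewrite sumrB; congr (_ - _); rewrite sumrB ls subr0 sumr_const card_ord -mulr_natr mulrC.
  have := sqsum l ls; rewrite (bigD1 ord0)//=.
  have -> : \sum_(i | i != ord0) \sum_j (l 0 i - l 0 j) ^+ 2 =
     \sum_j (l 0 ord0 - l 0 j) ^+ 2 +
     \sum_(i | i != ord0) \sum_(j | j != ord0) (l 0 i - l 0 j) ^+ 2.
    rewrite [X in _ = X + _](bigD1 ord0)//= subrr expr0n add0r -big_split /=.
    apply: eq_bigr => i i0; rewrite (bigD1 ord0)//=; congr (_ + _); ring.
  set U := \sum_(i | _) \sum_(j | _) _; set W := \sum_j (l 0 ord0 - l 0 j) ^+ 2 in T0 *.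
  move=> E.
  have U0 : 0 <= U by apply: sumr_ge0 => i _; apply: sumr_ge0 => j _; exact: sqr_ge0.
  have T1 : 0 <= \sum_j ((l 0 ord0 - l 0 j) ^+ 2 - (l 0 ord0 - l 0 j)) by apply: sumr_ge0.
  have sl : s * dot l l <= s * l 0 ord0 by rewrite ler_pM2l.
  have T2 : \sum_j ((l 0 ord0 - l 0 j) ^+ 2 - (l 0 ord0 - l 0 j)) = 0 by lra.
  have U2 : U = 0 by lra.
  have aj j : (l 0 ord0 - l 0 j) * (l 0 ord0 - l 0 j - 1) = 0.
    move/eqP: T2; rewrite psumr_eq0// => /allP/(_ j (mem_index_enum _)) /= /eqP <-.
    by ring.
  have lij j : j != ord0 -> l 0 j = l 0 i1.
    move=> j0; move/eqP: U2; rewrite psumr_eq0; last by move=> i _; apply: sumr_ge0 => k _; exact: sqr_ge0.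
    move=> /allP/(_ j (mem_index_enum _)); rewrite j0 /= psumr_eq0; last by move=> k _; exact: sqr_ge0.
    move=> /allP/(_ i1 (mem_index_enum _)); rewrite i10 /= sqrf_eq0 subr_eq0 => /eqP; exact.
  have sumE : l 0 ord0 + n%:R * l 0 i1 = 0.
    rewrite -ls (bigD1 ord0)//=; congr (_ + _).
    rewrite (eq_bigr (fun=> l 0 i1)); last by move=> j /lij.
    by rewrite sumr_const (_ : #|_| = n) ?mulr_natl// cardC1 card_ord.
  move/eqP: (aj i1); rewrite mulf_eq0 => /orP[]; rewrite ?subr_eq0 => /eqP h.
    move/eqP: l0; apply; apply/rowP => j; rewrite mxE.
    have l1 : l 0 i1 = 0.
      have : s * l 0 i1 = 0 by rewrite -sumE h sn; ring.
      by move=> /eqP; rewrite mulf_eq0 gt_eqF//= => /eqP.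
    by have [->|/lij ->] := eqVneq j ord0; rewrite ?h l1.
  move/eqP: lu; apply; apply/rowP => j; rewrite pE.
  have h' : l 0 ord0 = l 0 i1 + 1 by lra.
  have l1 : l 0 i1 = - s^-1.
    have : s * l 0 i1 = -1 by move: sumE; rewrite h' sn; lra.
    by move=> E1; apply: (mulfI (lt0r_neq0 s0)); rewrite E1 mulrN mulfV ?gt_eqF.
  have [->|j0] := eqVneq j ord0; first by rewrite h' l1 addrC.
  by rewrite lij// l1 sub0r.
- by rewrite -[p i1]opprK -[- p i1]sub0r; do !apply: dualB => //; exact: dual0.
- apply/voronoiP; split; first exact: Vspan.
  move=> l Dl; have ls := dual_sum l Dl.
  rewrite -(ler_pM2l (mulr_gt0 (ltr0n R 2) s0)) -sqsum// mulrA.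
  rewrite (_ : 2 * s * 2 = 4 * s); last by ring.
  rewrite qpair//; apply: ler_sum => i _; apply: ler_sum => j _.
  have [a ->] := dual_diff l i j Dl.
  rewrite expr2 -intrM; case: (ltngtP i j) => _ /=.
  - by rewrite subr0 mul1r ler_int; nia.
  - by rewrite sub0r mulN1r -mulrNz ler_int; nia.
  - by rewrite subrr mul0r ler0z; nia.
- rewrite dotp// Dq uu mulr0 subr0; field; exact: lt0r_neq0.
- rewrite dotDr !dotp// !Dq vv i1v mulr0 subr0 mulr1; field; exact: lt0r_neq0.
- by rewrite uv divr_gt0//; lra.
- by rewrite uv uu ltr_pM2r ?invr_gt0//; lra.
Qed.

End dual_latA.

Theorem corollary3 (R : realType) (N : nat) (L : set 'rV[R]_N)
    (hL : non_cartesian_root_lattice L)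
    (d : nat) (Q : 'M[R]_(d, N)) (hQ : orthonormal_basis (linspan L) Q)
    (m : nat) (hm : (1 <= m)%N)
    (lambda : R) (hlambda : 0 < lambda < 1) :
  ~ refinable Q L m lambda.
Proof.
case: hL Q hQ => [n n2|n n2|n n3|n n3|M ME hM|v Ev vv|] Q hQ.
- exact: latA_not_refinable.
- exact: dual_latA_not_refinable.
- exact: latD_not_refinable.
- exact: dual_latD_not_refinable.
- exact: latE6_not_refinable.
- exact: latE7_not_refinable.
- exact: latE8_not_refinable.
Qed.
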